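(* Let $X_K$ be an algebraic variety over the field $K=\mathbb{C}\{t\}$ of convergent Laurent series, with associated meromorphic degeneration $X\to\mathbb{D}^\times$ and hybrid space $\pi\colon X^{\mathrm{hyb}}\to\mathbb{D}$. Then $X^{\mathrm{hyb}}$ is Hausdorff and locally compact. If $X_K$ is further projective, then the map $\pi\colon X^{\mathrm{hyb}}\to\mathbb{D}$ is proper.
   Context: $K=\mathbb{C}\{t\}$ is the field of convergent complex Laurent series $a(t)=\sum_{k\ge -N}a_kt^k$ (germs at $0$ of meromorphic functions), with discrete valuation $v_K=\mathrm{ord}_0$. $\mathbb{D}\subset\mathbb{C}$ is a small open disc centered at $0$ (shrunk whenever necessary), $\mathbb{D}^\times=\mathbb{D}\setminus\{0\}$. A variety $X_K$ over $K$ induces (its equations having coefficients convergent on $\mathbb{D}^\times$) a complex analytic family $\pi\colon X\to\mathbb{D}^\times$ with fibers $X_t=\pi^{-1}(t)$, called the meromorphic degeneration attached to $X_K$. Berkovich space: $X_0:=X_K^{\mathrm{an}}$. For an affine open $U_K\subset X_K$, $U_0=U_K^{\mathrm{an}}$ is the set of semivaluations $v\colon\mathcal{O}(U_K)\to\mathbb{R}\cup\{+\infty\}$ (i.e. $v(fg)=v(f)+v(g)$, $v(f+g)\ge\min\{v(f),v(g)\}$, $v(0)=+\infty$) with $v|_K=v_K$, with the topology of pointwise convergence; $X_0$ is obtained by gluing the $U_0$'s as open subsets. Write $|f(v)|=e^{-v(f)}$. Hybrid space: $X^{\mathrm{hyb}}:=\coprod_{t\in\mathbb{D}}X_t$, with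 $\pi\colon X^{\mathrm{hyb}}\to\mathbb{D}$ sending $X_t$ to $t$. Set $\varepsilon_t:=(\log|t|^{-1})^{-1}\in(0,1)$ for $t\neq0$. The hybrid topology is the coarsest topology such that for each affine open $U_K\subset X_K$: (i) $U^{\mathrm{hyb}}=\coprod_t U_t\subset X^{\mathrm{hyb}}$ is open; (ii) for each $f\in\mathcal{O}(U_K)$ the function $|f|^{\mathrm{hyb}}\colon U^{\mathrm{hyb}}\to\mathbb{R}_{\ge0}$ equal to $x\mapsto|f(x)|^{\varepsilon_t}$ on $U_t$, $t\ne0$, and to $v\mapsto|f(v)|=e^{-v(f)}$ on $U_0$, is continuous. Equivalently: $X\hookrightarrow X^{\mathrm{hyb}}$ is an open embedding, $X_0\hookrightarrow X^{\mathrm{hyb}}$ is a closed embedding, and a net $x_i\in X_{t_i}$ with $t_i\to0$ converges to $v\in X_0$ iff for each affine open $U_K$ with $v\in U_0$ one has $x_i\in U_{t_i}$ for $i$ large and $\lim_i\log|f(x_i)|/\log|t_i|=v(f)$ for all $f\in\mathcal{O}(U_K)$. *)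

(* Defs.v *)
From HB Require Import structures.
From mathcomp Require Import all_boot all_order all_algebra.
From mathcomp Require Import -(notations) mpoly.
From mathcomp Require Import all_classical all_reals all_analysis.
From mathcomp Require Import complex.
From mathcomp Require Import zify.
From Stdlib Require Import Relation_Operators.
Set Implicit Arguments.
Unset Strict Implicit.
Unset Printing Implicit Defensive.
Import Order.TTheory GRing.Theory Num.Theory numFieldNormedType.Exports.
Local Open Scope classical_set_scope.
Local Open Scope ring_scope.

(* The topology of C is the one given by the modulus. *)
HB.instance Definition _ (R : realType) :=
  PseudoMetricNormedZmod.copy R[i] (R[i]^o).

Notation cmod := ComplexField.Normc.normc.

Section Laurent.
Variable R : realType.
Local Notation C := R[i].
Implicit Types (a b c : int -> C) (s t k : int) (n : nat).

(* The Laurent series with coefficients a has a finite principal part and a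
   positive radius of convergence (at least 1/A). *)
Definition convergent_laurent a :=
  exists s (M A : R), (forall k, k < s -> a k = 0) /\
    (forall n, cmod (a (s + n%:Z)) <= M * A ^+ n).

Record laurent := Laurent {
  coef :> int -> C;
  coefP : convergent_laurent coef
}.

HB.instance Definition _ := gen_eqMixin laurent.
HB.instance Definition _ := gen_choiceMixin laurent.

Lemma laurentP (f g : laurent) : coef f =1 coef g -> f = g.
Proof.
case: f g => [a pa] [b pb] /= /funext eab; subst b.
by rewrite (Prop_irrelevance pa pb).
Qed.

Let cbound a s (M A : R) := [/\ 0 <= M, 1 <= A,
  (forall k, k < s -> a k = 0) &
  (forall n, cmod (a (s + n%:Z)) <= M * A ^+ n)].

Let cmod_ge0 (z : C) : 0 <= cmod z.
Proof. by rewrite /cmod; case: z => x y; rewrite sqrtr_ge0. Qed.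

Let cmodD (x y : C) : cmod (x + y) <= cmod x + cmod y.
Proof. exact: le_normcD. Qed.

Let cmodM (x y : C) : cmod (x * y) = cmod x * cmod y.
Proof. exact: ComplexField.Normc.normcM. Qed.

Let cmod0 : cmod (0 : C) = 0. Proof. exact: ComplexField.Normc.normc0. Qed.

Let cmod_sum (I : Type) (r : seq I) (F : I -> C) :
  cmod (\sum_(i <- r) F i) <= \sum_(i <- r) cmod (F i).
Proof.
elim/big_rec2: _ => [|i x y _ h]; first by rewrite cmod0.
by apply: le_trans (cmodD _ _) _; rewrite lerD2l.
Qed.

Let cbound_conv a s M A : cbound a s M A -> convergent_laurent a.
Proof. by case=> _ _ h1 h2; exists s, M, A. Qed.

Let conv_cbound a : convergent_laurent a ->
  exists s M A, cbound a s M A.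
Proof.
case=> s [M] [A] [h1 h2]; exists s, `|M|, (Num.max 1 `|A|); split=> //.
  by rewrite le_max lexx.
move=> n; apply: le_trans (h2 n) _; apply: le_trans (ler_norm _) _.
rewrite normrM ler_wpM2l// normrX.
have h : `|A| <= Num.max 1 `|A| by rewrite le_max lexx orbT.
by apply: lerXn2r => //; rewrite nnegrE (le_trans _ h).
Qed.

Let cbound_shift a s M A t : t <= s -> cbound a s M A -> cbound a t M A.
Proof.
move=> ts [M0 A1 h1 h2]; split=> // [k kt|n]; first exact/h1/(lt_le_trans kt).
have [lt|le] := ltP (t + n%:Z) s.
  by rewrite h1// cmod0 mulr_ge0// exprn_ge0// (le_trans _ A1).
have [m e] : exists m : nat, t + n%:Z = s + m%:Z /\ (m <= n)%N.
  exists (absz (t + n%:Z - s)%R); split; lia.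
case: e => -> mn; apply: le_trans (h2 m) _; rewrite ler_wpM2l//.
exact: ler_weXn2l.
Qed.

Let cbound_common a b : convergent_laurent a -> convergent_laurent b ->
  exists s M A, cbound a s M A /\ cbound b s M A.
Proof.
move=> /conv_cbound[s [M [A ha]]] /conv_cbound[t [N [B hb]]].
exists (Num.min s t), (M + N), (A + B).
have [M0 A1 _ _] := ha; have [N0 B1 _ _] := hb.
have A0 : 0 <= A by apply: le_trans A1.
have B0 : 0 <= B by apply: le_trans B1.
have hs : Num.min s t <= s by rewrite ge_min lexx.
have ht : Num.min s t <= t by rewrite ge_min lexx orbT.
have [_ _ a1 a2] := cbound_shift hs ha; have [_ _ b1 b2] := cbound_shift ht hb.
by split; split=> //; rewrite ?addr_ge0// ?(le_trans A1)// ?lerDl//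
   => n; [apply: le_trans (a2 n) _ | apply: le_trans (b2 n) _];
   apply: ler_pM; rewrite ?exprn_ge0// ?lerDl ?lerDr// lerXn2r ?nnegrE ?addr_ge0//
   ?lerDl ?lerDr.
Qed.

Lemma conv0 : convergent_laurent (fun=> 0).
Proof. by exists 0, 0, 0; split=> // n; rewrite cmod0 mul0r. Qed.

Lemma conv_const (z : C) : convergent_laurent (fun k => if k == 0 then z else 0).
Proof.
exists 0, (cmod z), 1; split=> [k|n]; first by rewrite lt_neqAle => /andP[/negbTE->].
by rewrite expr1n mulr1 add0r; case: ifP; rewrite ?cmod0.
Qed.

Lemma convN a : convergent_laurent a -> convergent_laurent (fun k => - a k).
Proof.
move=> /conv_cbound[s [M [A [M0 A1 h1 h2]]]]; exists s, M, A; split=> [k /h1->|n].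
  by rewrite oppr0.
by rewrite -mulN1r cmodM normcN ComplexField.Normc.normc1 mul1r.
Qed.

Lemma convD a b : convergent_laurent a -> convergent_laurent b ->
  convergent_laurent (fun k => a k + b k).
Proof.
move=> ha hb; have [s [M [A [[M0 A1 a1 a2] [_ _ b1 b2]]]]] := cbound_common ha hb.
exists s, (M + M), A; split=> [k ks|n]; first by rewrite a1// b1// addr0.
by rewrite mulrDl (le_trans (cmodD _ _))// lerD.
Qed.

Definition cauchy_prod a b : int -> C :=
  fun k => \sum_(i \in [set: int]) (a i * b (k - i)).

Lemma cauchy_prod_lt a b s t k : (forall i, i < s -> a i = 0) ->
  (forall i, i < t -> b i = 0) -> k < s + t -> cauchy_prod a b k = 0.
Proof.
move=> ha hb kst; rewrite /cauchy_prod fsbig1// => i _.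
have [/ha->|si] := ltP i s; first by rewrite mul0r.
by rewrite hb ?mulr0//; lia.
Qed.

Lemma cauchy_prodE a b s t n : (forall i, i < s -> a i = 0) ->
  (forall i, i < t -> b i = 0) ->
  cauchy_prod a b (s + t + n%:Z) =
    \sum_(i < n.+1) a (s + i%:Z) * b (t + (n - i)%N%:Z).
Proof.
move=> ha hb; rewrite /cauchy_prod.
pose r := [seq s + i%:Z | i <- iota 0 n.+1].
have ur : uniq r.
  by rewrite map_inj_uniq ?iota_uniq// => i j; lia.
rewrite -(fsbig_widen [set` r] setT) => [||i [_ /=]]//; last first.
  move=> ir; have [/ha->|si] := ltP i s; first by rewrite mul0r.
  rewrite hb ?mulr0// ltNge; apply/negP => h; apply: ir.
  apply/mapP; exists (absz (i - s)%R); last lia.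
  by rewrite mem_iota; lia.
rewrite -fsbig_seq//= big_map -[iota 0 n.+1]/(index_iota 0 n.+1) big_mkord.
apply: eq_bigr => i _; congr (_ * b _); have := ltn_ord i; lia.
Qed.

Lemma convM a b : convergent_laurent a -> convergent_laurent b ->
  convergent_laurent (cauchy_prod a b).
Proof.
move=> ha hb; have [s [M [A [[M0 A1 a1 a2] [_ _ b1 b2]]]]] := cbound_common ha hb.
exists (s + s), (M * M), (2 * A); split=> [k|n]; first exact: cauchy_prod_lt.
have A0 : 0 <= A by apply: le_trans A1.
rewrite cauchy_prodE// (le_trans (cmod_sum _ _))//.
apply: (@le_trans _ _ (\sum_(i < n.+1) M * M * A ^+ n)).
  apply: ler_sum => i _; rewrite cmodM.
  have -> : A ^+ n = A ^+ i * A ^+ (n - i).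
    by rewrite -exprD subnKC// -ltnS.
  by rewrite mulrACA ler_pM.
rewrite sumr_const card_ord exprMn [leRHS]mulrCA -[leLHS]mulr_natl; apply: ler_wpM2r.
  by rewrite !mulr_ge0// exprn_ge0.
by rewrite -natrX ler_nat ltn_expl.
Qed.

Definition laurent0 := Laurent conv0.
Definition laurent_const z := Laurent (conv_const z).
Definition laurentN (f : laurent) := Laurent (convN (coefP f)).
Definition laurentD (f g : laurent) := Laurent (convD (coefP f) (coefP g)).
Definition laurentM (f g : laurent) := Laurent (convM (coefP f) (coefP g)).

Fact laurentDA : associative laurentD.
Proof. by move=> f g h; apply: laurentP => k /=; rewrite addrA. Qed.
Fact laurentDC : commutative laurentD.
Proof. by move=> f g; apply: laurentP => k /=; rewrite addrC. Qed.
Fact laurent0D : left_id laurent0 laurentD.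
Proof. by move=> f; apply: laurentP => k /=; rewrite add0r. Qed.
Fact laurentND : left_inverse laurent0 laurentN laurentD.
Proof. by move=> f; apply: laurentP => k /=; rewrite addNr. Qed.

HB.instance Definition _ :=
  GRing.isZmodule.Build laurent laurentDA laurentDC laurent0D laurentND.

Let coef_lt (f : laurent) : exists s, forall k, k < s -> f k = 0.
Proof. by have [s [_ [_ [h _]]]] := coefP f; exists s. Qed.

Let trunc a s n : {poly C} := \poly_(i < n) a (s + i%:Z).

Let prod_trunc a b s t n m : (forall i, i < s -> a i = 0) ->
  (forall i, i < t -> b i = 0) -> (n < m)%N ->
  cauchy_prod a b (s + t + n%:Z) = (trunc a s m * trunc b t m)`_n.
Proof.
move=> ha hb nm; rewrite cauchy_prodE// coefM; apply: eq_bigr => i _.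
by rewrite !coef_poly (leq_trans (ltn_ord i)) ?(leq_ltn_trans (leq_subr _ _)).
Qed.

Fact laurentMC : commutative laurentM.
Proof.
move=> f g; apply: laurentP => k /=.
have [s hs] := coef_lt f; have [t ht] := coef_lt g.
have [kst|kst] := ltP k (s + t).
  by rewrite (cauchy_prod_lt hs ht)// (cauchy_prod_lt ht hs)// addrC.
have -> : k = s + t + (absz (k - (s + t))%R)%:Z by lia.
rewrite (prod_trunc hs ht (ltnSn _)) mulrC -(prod_trunc ht hs (ltnSn _)).
by rewrite (addrC t).
Qed.

Fact laurentMA : associative laurentM.
Proof.
move=> f g h; apply: laurentP => k /=.
have [s hs] := coef_lt f; have [t ht] := coef_lt g; have [u hu] := coef_lt h.
have hfg i := @cauchy_prod_lt f g s t i hs ht.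
have hgh i := @cauchy_prod_lt g h t u i ht hu.
have [kst|kst] := ltP k (s + t + u).
  by rewrite (cauchy_prod_lt hfg hu)// (cauchy_prod_lt hs hgh)// addrA.
have -> : k = s + t + u + (absz (k - (s + t + u))%R)%:Z by lia.
set n := (absz _).
rewrite (prod_trunc hfg hu (ltnSn n)) -(addrA s t) (prod_trunc hs hgh (ltnSn n)).
rewrite [LHS](_ : _ = (trunc f s n.+1 * (trunc g t n.+1 * trunc h u n.+1))`_n).
  rewrite mulrA coefM [RHS]coefM; apply: eq_bigr => i _; congr (_ * _).
  by rewrite [RHS]coef_poly ltn_ord -prod_trunc.
rewrite coefM [RHS]coefM; apply: eq_bigr => i _; congr (_ * _).
have hi : (n - i < n.+1)%N by rewrite ltnS leq_subr.
by rewrite [LHS]coef_poly hi -prod_trunc.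
Qed.

Fact laurent1M : left_id (laurent_const 1) laurentM.
Proof.
move=> f; apply: laurentP => k /=; rewrite /cauchy_prod.
rewrite -(fsbig_widen [set 0] setT) => [||i [_ /= /eqP/negbTE->]]//.
  by rewrite fsbig_set1 eqxx mul1r subr0.
by rewrite mul0r.
Qed.

Fact laurentMDl : left_distributive laurentM laurentD.
Proof.
move=> f g h; apply: laurentP => k /=.
have [s' hs'] := coef_lt f; have [s'' hs''] := coef_lt g.
have [u hu] := coef_lt h.
pose s := Num.min s' s''.
have hs i : i < s -> f i = 0 by rewrite lt_min => /andP[/hs'].
have ht i : i < s -> g i = 0 by rewrite lt_min => /andP[_ /hs''].
have hst i : i < s -> f i + g i = 0 by move=> h'; rewrite hs// ht// addr0.
have [kst|kst] := ltP k (s + u).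
  by rewrite !(@cauchy_prod_lt _ _ s u)// addr0.
have -> : k = s + u + (absz (k - (s + u))%R)%:Z by lia.
rewrite !cauchy_prodE// -big_split; apply: eq_bigr => i _; exact: mulrDl.
Qed.

Fact laurent10 : laurent_const 1 != laurent0.
Proof.
by apply/eqP => /(congr1 (fun f => coef f 0)) /= /eqP; rewrite oner_eq0.
Qed.

HB.instance Definition _ := GRing.Zmodule_isComNzRing.Build laurent
  laurentMA laurentMC laurent1M laurentMDl laurent10.

Section Inverse.
Variable p : nat -> C.

Fixpoint inv_seq n : seq C := if n is m.+1 then
    rcons (inv_seq m) ((p 0%N)^-1 *
      ((m == 0%N)%:R - \sum_(i < m) (inv_seq m)`_i * p (m - i)%N))
  else [::].
Definition inv_coef n : C := (inv_seq n.+1)`_n.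

Lemma size_inv_seq n : size (inv_seq n) = n.
Proof. by elim: n => //= n IH; rewrite size_rcons IH. Qed.

Lemma nth_inv_seq n i : (i < n)%N -> (inv_seq n)`_i = inv_coef i.
Proof.
elim: n => // n IH; rewrite ltnS leq_eqVlt => /predU1P[->//|lin].
by rewrite /= nth_rcons size_inv_seq lin IH.
Qed.

Lemma inv_coefE n : inv_coef n = (p 0%N)^-1 *
   ((n == 0%N)%:R - \sum_(i < n) inv_coef i * p (n - i)%N).
Proof.
rewrite /inv_coef /= nth_rcons size_inv_seq ltnn eqxx; congr (_ * (_ - _)).
by apply: eq_bigr => i _; rewrite nth_inv_seq.
Qed.

Lemma inv_coefP n : p 0%N != 0 ->
  \sum_(i < n.+1) inv_coef i * p (n - i)%N = (n == 0%N)%:R.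
Proof.
move=> p0; rewrite big_ord_recr /= subnn inv_coefE mulrAC mulVf// mul1r.
by rewrite addrC subrK.
Qed.

Lemma inv_coef_bound (A : R) : 0 < A -> p 0%N != 0 ->
  (forall n, cmod (p n.+1) <= cmod (p 0%N) * A ^+ n.+1) ->
  forall n, cmod (inv_coef n) <= cmod (p 0%N)^-1 * (2 * A) ^+ n.
Proof.
move=> A0 p0 hp.
have A2 : 0 <= 2 * A by rewrite mulr_ge0 // ltW.
elim/ltn_ind => -[_|n IH].
  by rewrite inv_coefE big_ord0 subr0 mulr1 expr0 mulr1.
rewrite inv_coefE sub0r cmodM ler_wpM2l// normcN.
apply: le_trans (cmod_sum _ _) _.
apply: (@le_trans _ _ (\sum_(i < n.+1) (2 ^+ i * A ^+ n.+1))).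
  apply: ler_sum => i _; rewrite cmodM.
  have lin := ltn_ord i.
  have {}hp : cmod (p (n.+1 - i)%N) <= cmod (p 0%N) * A ^+ (n.+1 - i).
    by rewrite subSn//; apply: hp.
  apply: le_trans (ler_pM _ _ (IH i lin) hp) _ => //.
  rewrite mulrACA -cmodM mulVf// ComplexField.Normc.normc1 mul1r exprMn -mulrA.
  by rewrite -exprD subnKC// ltnW.
rewrite -mulr_suml exprMn ler_wpM2r ?exprn_ge0 ?(ltW A0)//.
have := subrX1 (2 : R) n.+1; rewrite [2 - 1]addrK mul1r => <-.
by rewrite lerBlDr lerDl.
Qed.
End Inverse.

Lemma laurent_neq0 (f : laurent) : f != 0 ->
  exists s, f s != 0 /\ forall k, k < s -> f k = 0.
Proof.
move=> f0; have [s hs] := coef_lt f.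
have [k fk] : exists k, f k != 0.
  apply/not_existsP => h; move/eqP: f0; apply; apply: laurentP => k /=.
  by apply/eqP; move: (h k) => /negP/negPn.
have ex : exists n : nat, f (s + n%:Z) != 0.
  exists (absz (k - s)%R); have [ks|ks] := ltP k s; first by rewrite hs ?eqxx in fk.
  by have -> : s + (absz (k - s)%R)%:Z = k by lia.
exists (s + (ex_minn ex)%:Z); case: ex_minnP => m fm hm; split=> // i im.
have [/hs//|si] := ltP i s; apply/eqP/negPn/negP => fi.
have := hm (absz (i - s)%R); have -> : s + (absz (i - s)%R)%:Z = i by lia.
by move=> /(_ fi); lia.
Qed.

Lemma laurent_inv_ex (f : laurent) : f != 0 -> exists g, g * f = 1.
Proof.
move=> /laurent_neq0[s [fs hs]].
pose p n := f (s + n%:Z); pose q := inv_coef p.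
have p0 : p 0%N != 0 by rewrite /p addr0.
pose g k := if k < - s then 0 else q (absz (k + s)%R).
have gE n : g (- s + n%:Z) = q n.
  by rewrite /g ifF; [congr (q _); lia|lia].
have hg k : k < - s -> g k = 0 by rewrite /g => ->.
have conv_g : convergent_laurent g.
  have [u [M [A [hb1 hb2]]]] := coefP f.
  have [u' [M' [A' hb]]] := conv_cbound (coefP f).
  have [M0 A1 _ _] := hb.
  have us : u' <= s.
    by rewrite leNgt; apply/negP => su; case: hb => _ _ h _; rewrite h ?eqxx in fs.
  pose d := (absz (s - u')%R).
  have c0 : 0 < cmod (p 0%N).
    rewrite lt_neqAle cmod_ge0 andbT eq_sym; apply: contra p0 => /eqP.
    by move=> /ComplexField.Normc.eq0_normc->.
  pose B := Num.max 1 (M' * A' ^+ d / cmod (p 0%N)) * A'.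
  have A'0 : 0 < A' by apply: lt_le_trans A1.
  have m1 : 1 <= Num.max 1 (M' * A' ^+ d / cmod (p 0%N)) by rewrite le_max lexx.
  have B0 : 0 < B by rewrite mulr_gt0// (lt_le_trans _ m1).
  exists (- s), (cmod (p 0%N)^-1), (2 * B); split=> // n; rewrite gE.
  apply: inv_coef_bound => // {}n.
  have -> : p n.+1 = f (u' + (d + n.+1)%N%:Z) by rewrite /p; congr (coef f _); lia.
  case: hb => _ _ _ /(_ (d + n.+1)%N) h; apply: le_trans h _.
  rewrite exprD mulrA exprMn [leRHS]mulrA ler_wpM2r ?exprn_ge0 ?(ltW A'0)//.
  rewrite [leRHS]mulrC -ler_pdivrMr//; apply: (@le_trans _ _ (Num.max 1 (M' * A' ^+ d / cmod (p 0%N)))).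
    by rewrite le_max lexx orbT.
  by rewrite exprS ler_peMr// ?(le_trans _ m1)// exprn_ege1.
exists (Laurent conv_g); apply: laurentP => k /=.
have [k0|k0] := ltP k 0.
  by rewrite (@cauchy_prod_lt _ _ (- s) s)// ?addNr// ifF//; lia.
have -> : k = - s + s + (absz (k)%R)%:Z by lia.
rewrite cauchy_prodE//; under eq_bigr do rewrite gE.
rewrite inv_coefP// addNr add0r eqz_nat; by case: ifP.
Qed.

Definition laurent_inv (f : laurent) : laurent :=
  if pselect (f != 0) is left f0 then sval (cid (laurent_inv_ex f0)) else 0.

Fact laurentVM f : f != 0 -> laurent_inv f * f = 1.
Proof. by rewrite /laurent_inv; case: pselect => // f0 _; case: cid. Qed.

Fact laurentV0 : laurent_inv 0 = 0.
Proof. by rewrite /laurent_inv; case: pselect => // h; exfalso; move: h; rewrite eqxx. Qed.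

HB.instance Definition _ :=
  GRing.ComNzRing_isField.Build laurent laurentVM laurentV0.

(* The sum of f_k t^k over -n <= k < n, so that no bound on the order of the pole
   has to be chosen. *)
Definition laurent_sum (t : C) (f : laurent) : nat -> C :=
  fun n => \sum_(0 <= i < n.*2) f (i%:Z - n%:Z) * t ^ (i%:Z - n%:Z).

Definition laurent_eval (t : C) (f : laurent) : C := limn (laurent_sum t f).

Definition converges_on (r : R) (f : laurent) :=
  forall t : C, 0 < cmod t < r -> cvgn (laurent_sum t f).

(* The infimum of the empty set is +oo, so [ord_zero 0 = +oo]. *)
Definition ord_zero (f : laurent) : \bar R :=
  ereal_inf [set (k%:~R : R)%:E | k in [set k | f k != 0]].

End Laurent.

Definition peval (n : nat) (k : fieldType) (A : comPzRingType) (c : k -> A)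
    (x : 'I_n -> A) (p : mpoly n k) : A :=
  \sum_(m <- msupp p)
    c (mcoeff m p) * \prod_(i < n) x i ^+ m i.

Definition ideal_span (A : comNzRingType) (G : seq A) : set A :=
  [set a | exists q : 'I_(size G) -> A, a = \sum_i q i * G`_i].

Definition prime_ideal (A : comPzRingType) (P : set A) :=
  [/\ P 0, ~ P 1, (forall a b, P a -> P b -> P (a + b)),
      (forall a b, P b -> P (a * b)) &
      (forall a b, P (a * b) -> P a \/ P b)].

Section Schemes.
Variable k : fieldType.

(* [sect U] is the k-algebra O(U) of an open U; its values at sets that are
   not open carry no meaning and are never used. *)
Record ringed_space := RingedSpace {
  space :> topologicalType;
  sect : set space -> comPzRingType;
  restr : forall U V : set space, V `<=` U -> {rmorphism sect U -> sect V};
  scal : forall U : set space, {rmorphism k -> sect U};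
  restr_id : forall U (h : U `<=` U) f, restr h f = f;
  restr_comp : forall U V W (h : V `<=` U) (h' : W `<=` V) (h'' : W `<=` U) f,
    restr h' (restr h f) = restr h'' f;
  restr_scal : forall U V (h : V `<=` U) a, restr h (scal U a) = scal V a
}.

Definition is_sheaf (X : ringed_space) :=
  forall (I : Type) (U : I -> set X) (W : set X),
    (forall i, open (U i)) -> W = \bigcup_i U i ->
  (forall f g : sect W,
     (forall i (h : U i `<=` W), restr h f = restr h g) -> f = g) /\
  (forall s : forall i, sect (U i),
     (forall i j, restr (@subIsetl _ (U i) (U j)) (s i) =
                  restr (@subIsetr _ (U i) (U j)) (s j)) ->
     exists f : sect W, forall i (h : U i `<=` W), restr h f = s i).

(* the germ of f at x is a unit of the stalk O_{X,x} *)
Definition invertible_at (X : ringed_space) (U : set X) (f : sect U) (x : X) :=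
  exists (V : set X) (h : V `<=` U),
    [/\ open V, V x & exists g, restr h f * g = 1].

Definition locally_ringed (X : ringed_space) :=
  forall (U : set X) (x : X), open U -> U x ->
    ~ invertible_at (0 : sect U) x /\
    forall f g : sect U, invertible_at (f + g) x ->
      invertible_at f x \/ invertible_at g x.

Definition principal_open (X : ringed_space) (U : set X) (f : sect U) : set X :=
  [set x | invertible_at f x].

Lemma principal_open_sub (X : ringed_space) (U : set X) (f : sect U) :
  principal_open f `<=` U.
Proof. by move=> x [V [h [_ /h]]]. Qed.

(* The canonical map U -> Spec O(U), sending x to the ideal of the f whose germ
   at x is not a unit, is an isomorphism of locally ringed spaces: it is
   bijective, the preimages D(f) of the principal opens are a basis of U, and
   O(D(f)) is the localization O(U)_f. *)
Definition is_affine (X : ringed_space) (U : set X) :=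
  [/\ open U,
      (forall p : set (sect U), prime_ideal p ->
         exists! x, U x /\ p = [set f | ~ invertible_at f x]),
      (forall V x, open V -> V `<=` U -> V x ->
         exists2 f : sect U, principal_open f x & principal_open f `<=` V) &
      (forall f : sect U,
         (forall g : sect (principal_open f), exists (a : sect U) (n : nat),
            restr (principal_open_sub (f := f)) a =
            g * restr (principal_open_sub (f := f)) f ^+ n) /\
         (forall a : sect U, restr (principal_open_sub (f := f)) a = 0 ->
            exists n, f ^+ n * a = 0))].

Definition is_scheme (X : ringed_space) :=
  [/\ is_sheaf X, locally_ringed X &
      forall x : X, exists2 U, is_affine U & U x].

Definition generates (X : ringed_space) (U : set X) (n : nat)
    (x : 'I_n -> sect U) :=
  forall f : sect U, exists p, peval (scal U) x p = f.

Definition finite_type (X : ringed_space) :=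
  exists (m : nat) (U : 'I_m -> set X),
    [/\ (forall i, is_affine (U i)), \bigcup_i U i = setT &
        forall i, exists (n : nat) (x : 'I_n -> sect (U i)), generates x].

Definition reduced (X : ringed_space) :=
  forall (U : set X) (f : sect U) (n : nat), open U -> f ^+ n = 0 -> f = 0.

(* The diagonal X -> X x X is a closed immersion. X x X is covered by the affine
   opens U x V, with O(U x V) = O(U) (x) O(V), and the preimage of U x V under
   the diagonal is U `&` V. *)
Definition separated (X : ringed_space) :=
  forall U V : set X, is_affine U -> is_affine V ->
    is_affine (U `&` V) /\
    forall h : sect (U `&` V), exists (n : nat)
        (f : 'I_n -> sect U) (g : 'I_n -> sect V),
      h = \sum_(i < n) restr (@subIsetl _ U V) (f i) *
                       restr (@subIsetr _ U V) (g i).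

Definition algebraic_variety (X : ringed_space) :=
  [/\ is_scheme X, finite_type X, separated X & reduced X].

Record morphism (X Y : ringed_space) := Morphism {
  mor :> X -> Y;
  mor_continuous : continuous mor;
  pull : forall V : set Y, open V -> {rmorphism sect V -> sect (mor @^-1` V)};
  pull_restr : forall (U V : set Y) (oU : open U) (oV : open V)
      (h : V `<=` U) (h' : mor @^-1` V `<=` mor @^-1` U) (f : sect U),
    pull oV (restr h f) = restr h' (pull oU f);
  pull_scal : forall (V : set Y) (oV : open V) a,
    pull oV (scal V a) = scal (mor @^-1` V) a;
  pull_local : forall (V : set Y) (oV : open V) (f : sect V) (x : X),
    V (mor x) -> invertible_at (pull oV f) x -> invertible_at f (mor x)
}.

Definition closed_immersion (X Y : ringed_space) (phi : morphism X Y) :=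
  forall (V : set Y) (oV : open V), is_affine V ->
    is_affine (phi @^-1` V) /\
    forall g, exists f : sect V, pull phi oV f = g.

(* P is the projective space of dimension n: the scheme glued from the affine
   spaces D i = D_+(T_i), with coordinates u i j = T_j / T_i, j != i. *)
Definition is_projective_space (n : nat) (P : ringed_space) :=
  is_scheme P /\
  exists (D : 'I_n.+1 -> set P) (u : forall i, 'I_n.+1 -> sect (D i)),
    [/\ (forall i, is_affine (D i)) /\ \bigcup_i D i = setT,
        (forall i, u i i = 1),
        (forall i j, D i `&` D j = principal_open (u i j)),
        (forall i j l, restr (@subIsetl _ (D i) (D j)) (u i l) =
           restr (@subIsetl _ (D i) (D j)) (u i j) *
           restr (@subIsetr _ (D i) (D j)) (u j l)) &
        (forall i (f : sect (D i)), exists! p,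
           peval (scal (D i)) (fun j : 'I_n => u i (lift i j)) p = f)].

Definition projective (X : ringed_space) :=
  exists (n : nat) (P : ringed_space) (phi : morphism X P),
    is_projective_space n P /\ closed_immersion phi.

End Schemes.

(* The quotient of T by the equivalence relation generated by r. *)
Section Gluing.
Variables (T : choiceType) (r : T -> T -> Prop).

Definition glue_rel (x y : T) : bool := `[< clos_refl_sym_trans T r x y >].

Fact glue_rel_refl : reflexive glue_rel.
Proof. by move=> x; apply/asboolP; exact: rst_refl. Qed.
Fact glue_rel_sym : ssrbool.symmetric glue_rel.
Proof. by move=> x y; apply/asboolP/asboolP; exact: rst_sym. Qed.
Fact glue_rel_trans : transitive glue_rel.
Proof.
by move=> y x z /asboolP h /asboolP h'; apply/asboolP; exact: rst_trans h'.
Qed.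

Canonical glue_equiv := EquivRel glue_rel glue_rel_refl glue_rel_sym glue_rel_trans.
Definition glued : choiceType := {eq_quot glue_equiv}%qT.
Definition glue (x : T) : glued := (\pi_{eq_quot glue_equiv} x)%qT.
Definition glued_repr (c : glued) : T := repr (c : {eq_quot glue_equiv}%qT).
End Gluing.
Arguments glue {T} r x.

Section Hybrid.
Variable R : realType.
Local Notation C := R[i].
Local Notation K := (laurent R).
Local Notation "'K[' n ]" := (mpoly n K) (at level 0, format "'K[' n ]").
Variable X : ringed_space K.

Section Berkovich.

Definition semivaluation (U : set X) (v : sect U -> \bar R) :=
  [/\ (forall f, v f != -oo%E) /\ v 0 = +oo%E,
      (forall f g, v (f * g) = (v f + v g)%E),
      (forall f g, (mine (v f) (v g) <= v (f + g)%R)%E) &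
      (forall a, v (scal U a) = ord_zero a)].

Record affine_semivaluation := AffineSemivaluation {
  sv_dom : set X;
  sv_fun : sect sv_dom -> \bar R;
  sv_affine : is_affine sv_dom;
  sv_semival : semivaluation sv_fun
}.

HB.instance Definition _ := gen_eqMixin affine_semivaluation.
HB.instance Definition _ := gen_choiceMixin affine_semivaluation.

(* v and w are identified if both restrict to an affine open W contained in
   their domains, with the same restriction. *)
Definition same_semivaluation (v w : affine_semivaluation) :=
  exists (z : affine_semivaluation)
    (hv : sv_dom z `<=` sv_dom v) (hw : sv_dom z `<=` sv_dom w),
    (forall f, sv_fun (restr hv f) = sv_fun f) /\
    (forall f, sv_fun (restr hw f) = sv_fun f).

Definition berkovich : choiceType := glued same_semivaluation.

Definition abs_semivaluation (v : \bar R) : R := fine (expeR (- v)).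

End Berkovich.

Record affine_chart := AffineChart {
  dom : set X;
  dom_affine : is_affine dom;
  dim : nat;
  coord : 'I_dim -> sect dom;
  coord_generates : generates coord
}.

Definition overlap_coord (c d : affine_chart) (l : 'I_(dim c + dim d)%N) :
    sect (dom c `&` dom d) :=
  match fintype.split l with
  | inl i => restr (@subIsetl _ (dom c) (dom d)) (coord i)
  | inr j => restr (@subIsetr _ (dom c) (dom d)) (coord j)
  end.

(* G generates the kernel of K[x, y] -> O(U `&` V), where x and y are the
   coordinates of the charts U and V; so G = 0 are equations of U `&` V as a
   closed subvariety of U x V. *)
Definition overlap_equations (c d : affine_chart) (G : seq K[(dim c + dim d)%N]) :=
  forall p, peval (scal (dom c `&` dom d)) (@overlap_coord c d) p = 0 <->
            ideal_span G p.

Record atlas := Atlas {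
  natlas : nat;
  chart : 'I_natlas -> affine_chart;
  chart_cover : \bigcup_i dom (chart i) = setT;
  trans : forall i j, seq K[(dim (chart i) + dim (chart j))%N];
  transP : forall i j, overlap_equations (trans i j)
}.

Definition poly_at (t : C) (n : nat) (p : K[n]) (x : 'rV[C]_n) : C :=
  peval (laurent_eval t) (x 0) p.

Definition zeros_at (t : C) (n : nat) (G : seq K[n]) : set 'rV[C]_n :=
  [set x | forall g, g \in G -> poly_at t g x = 0].

Definition poly_converges_on (s : R) (n : nat) (p : K[n]) :=
  forall m, converges_on s (mcoeff m p).

(* The disc has radius r; it is small enough when the coefficients of the
   equations of the atlas converge on it and the relation [same_point] below is
   an equivalence relation, which holds for all r near 0. *)
Section Degeneration.
Variables (A : atlas) (r : R).

(* The equations [trans A i i] cut out the diagonal of U_i x U_i, so this is the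
   fiber at t of the closed subset of C^n given by the equations of U_i. *)
Definition chart_fiber (i : 'I_(natlas A)) (t : C) : set 'rV[C]_(dim (chart i)) :=
  [set x | 0 < cmod t < r /\ zeros_at t (trans i i) (row_mx x x)].

Record chart_point := ChartPoint {
  cp_idx : 'I_(natlas A);
  cp_t : C;
  cp_x : 'rV[C]_(dim (chart cp_idx));
  cp_fiber : chart_fiber cp_t cp_x
}.

HB.instance Definition _ := gen_eqMixin chart_point.
HB.instance Definition _ := gen_choiceMixin chart_point.

Definition same_point (p q : chart_point) :=
  cp_t p = cp_t q /\
  zeros_at (cp_t p) (trans (cp_idx p) (cp_idx q)) (row_mx (cp_x p) (cp_x q)).

(* the total space of X over the punctured disc of radius r *)
Definition degeneration : choiceType := glued same_point.

Definition degeneration_pt i t x (h : chart_fiber (i := i) t x) : degeneration :=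
  glue same_point (ChartPoint h).

Definition analytic_open (O : set degeneration) :=
  forall i t x (h : chart_fiber (i := i) t x), O (degeneration_pt h) ->
    \forall z \near (t, x),
      forall h' : chart_fiber (i := i) z.1 z.2, O (degeneration_pt h').

Definition hybrid : Type := (degeneration + berkovich)%type.

HB.instance Definition _ := Choice.on hybrid.

Definition hybrid_proj (z : hybrid) : C :=
  match z with inl c => cp_t (glued_repr c) | inr _ => 0 end.

Definition hybrid_exponent (t : C) : R := (ln (cmod t)^-1)^-1.

(* The points of U^hyb over the disc of radius s at which |f|^hyb is in W; here
   U is the domain of d, f = p(coord d), and G i are equations for the overlap of
   U with the i-th chart of the atlas. A point of X_t with coordinates x in that
   chart is in U_t if (x, y) satisfies G i at t for some y, and then f takes the
   value p(y) at that point. *)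
Definition hybrid_basic (d : affine_chart)
    (G : forall i, seq K[(dim (chart (a := A) i) + dim d)%N])
    (p : K[dim d]) (s : R) (W : set R) : set hybrid :=
  [set z | match z with
   | inl c => exists i t x (h : chart_fiber (i := i) t x) (y : 'rV[C]_(dim d)),
       [/\ c = degeneration_pt h, cmod t < s,
           zeros_at t (G i) (row_mx x y) &
           W (cmod (poly_at t p y) `^ hybrid_exponent t)]
   | inr b => exists v (hv : semivaluation (U := dom d) v),
       b = glue same_semivaluation
             (AffineSemivaluation (dom_affine d) hv) /\
       W (abs_semivaluation (v (peval (scal (dom d)) (@coord d) p)))
   end].

(* The equations G and p only determine U_t and f for t near 0; the last
   condition says that s is small enough for U and f to be defined over the
   punctured disc of radius s, with |f| continuous there. *)
Definition hybrid_subbase : set_system hybrid :=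
  [set B | (exists2 O, analytic_open O & B = inl @` O) \/
    exists (d : affine_chart)
        (G : forall i, seq K[(dim (chart (a := A) i) + dim d)%N])
        (p : K[dim d]) (s : R) (W : set R),
      [/\ (forall i, overlap_equations (G i)),
          (forall i g, g \in G i -> poly_converges_on s g) /\
          poly_converges_on s p,
          0 < s /\ open W,
          B = hybrid_basic G p s W &
          analytic_open (inl @^-1` B)]].

HB.instance Definition _ :=
  isSubBaseTopological.Build hybrid hybrid_subbase id.

Definition hybrid_proper :=
  continuous hybrid_proj /\
  forall L : set C, compact L -> L `<=` [set t | cmod t < r] ->
    compact (hybrid_proj @^-1` L).

End Degeneration.
End Hybrid.

(* Main.v *)
From HB Require Import structures.
From mathcomp Require Import all_boot all_order all_algebra.
From mathcomp Require Import -(notations) mpoly.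
From mathcomp Require Import all_classical all_reals all_analysis.
From mathcomp Require Import complex.
From mathcomp Require Import zify ring lra.
From Stdlib Require Import Relation_Operators.
Require Import Defs.
Set Implicit Arguments.
Unset Strict Implicit.
Unset Printing Implicit Defensive.
Import Order.TTheory GRing.Theory Num.Theory numFieldNormedType.Exports.
Local Open Scope classical_set_scope.
Local Open Scope ring_scope.

(** Every assertion is tested on ultrafilters. Consider a family of points x_s of
    the fibers of X over parameters t_s that tend to 0 along an ultrafilter.
    Germs of complex functions of s along the ultrafilter form a field, which
    contains K because Laurent series can be evaluated at t_s, and the family is a
    single point of the scheme over this field ([gpoint_of_coords]). What should
    hold on X_t for all small t thus becomes a statement about points of a scheme
    with values in a field, and a compactness argument ([saturation]) turns it back
    into finitely many equations over one punctured disc. In this way the charts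
    of the degeneration glue along rational formulas over every small disc
    ([good_radius_near]).

    Near the central fiber, a family of points of the degeneration gives
    renormalized absolute values of sections, and a family of points of the
    analytification gives absolute values; both are nets in the sense of the record
    [net]. If the coordinates of an affine open are bounded along a net, then all
    its sections are, and their limits along the ultrafilter form a multiplicative
    seminorm. It is ultrametric because 2 ^ eps tends to 1, and it extends the
    absolute value of K because |t| ^ eps = 1 / e. So it is a point of the
    analytification ([net_limit]), to which the ultrafilter converges for the
    hybrid topology ([net_conv] and [hybrid_net_ex]).

    The three assertions follow. Separation: if an ultrafilter has limits b in U_i
    and b' in U_j on the central fiber, then the coordinates of both charts are
    bounded along its net and generate the sections on the intersection of U_i and
    U_j, because X is separated; so the net has a limit in this intersection, which
    is both b and b' ([inr_unique]). Outside the central fiber the equations of the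
    overlaps are closed conditions ([inl_unique]). Local compactness: the points of
    a chart over |t| <= s whose coordinates have renormalized absolute values at most
    M form a compact neighborhood for large M ([polydisc_compact]). Properness: dividing by the largest
    homogeneous coordinate, every family of points of a projective variety is
    bounded in one of the standard charts ([net_homogeneous]), hence has a limit
    whenever the parameter has one. *)

(** * Limits in the complex plane along filters *)

Section ComplexPlane.
Variable R : realType.
Local Notation C := R[i].
Local Notation Re := complex.Re.
Local Notation Im := complex.Im.

Lemma cmod_ge0 (z : C) : 0 <= cmod z.
Proof. by case: z => x y; rewrite sqrtr_ge0. Qed.
Lemma cmodD (x y : C) : cmod (x + y) <= cmod x + cmod y.
Proof. exact: le_normcD. Qed.
Lemma cmodM (x y : C) : cmod (x * y) = cmod x * cmod y.
Proof. exact: ComplexField.Normc.normcM. Qed.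
Lemma cmod0 : cmod (0 : C) = 0. Proof. exact: ComplexField.Normc.normc0. Qed.
Lemma cmod1 : cmod (1 : C) = 1. Proof. exact: ComplexField.Normc.normc1. Qed.
Lemma cmodN (x : C) : cmod (- x) = cmod x. Proof. exact: normcN. Qed.
Lemma cmodV (x : C) : cmod (x^-1) = (cmod x)^-1.
Proof. exact: ComplexField.Normc.normcV. Qed.
Lemma cmodB (x y : C) : cmod (x - y) = cmod (y - x).
Proof. by rewrite -cmodN opprB. Qed.
Lemma cmod_eq0 (x : C) : (cmod x == 0) = (x == 0).
Proof.
apply/eqP/eqP => [|->]; [exact: ComplexField.Normc.eq0_normc|exact: cmod0].
Qed.
Lemma cmod_gt0 (x : C) : (0 < cmod x) = (x != 0).
Proof. by rewrite lt_neqAle cmod_ge0 andbT eq_sym cmod_eq0. Qed.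
Lemma cmodX (x : C) n : cmod (x ^+ n) = cmod x ^+ n.
Proof. by elim: n => [|n IH]; rewrite ?expr0 ?cmod1// !exprS cmodM IH. Qed.
Lemma cmod_sum (I : Type) (r : seq I) (P : pred I) (F : I -> C) :
  cmod (\sum_(i <- r | P i) F i) <= \sum_(i <- r | P i) cmod (F i).
Proof.
elim/big_rec2: _ => [|i x y _ h]; first by rewrite cmod0.
by apply: le_trans (cmodD _ _) _; rewrite lerD2l.
Qed.
Lemma cmod_triangle (y x z : C) : cmod (x - z) <= cmod (x - y) + cmod (y - z).
Proof.
have -> : x - z = (x - y) + (y - z) by ring.
exact: cmodD.
Qed.
Lemma cmodB_ge (x y : C) : `|cmod x - cmod y| <= cmod (x - y).
Proof.
have h (a b : C) : cmod a - cmod b <= cmod (a - b).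
  rewrite lerBlDr; apply: le_trans (cmodD _ _); by rewrite subrK.
by rewrite ler_norml h lerNl opprB cmodB h.
Qed.
Lemma cmod_Re (z : C) : `|Re z| <= cmod z.
Proof.
by case: z => x y /=; rewrite -sqrtr_sqr ler_wsqrtr// lerDl sqr_ge0.
Qed.
Lemma cmod_Im (z : C) : `|Im z| <= cmod z.
Proof. by case: z => x y /=; rewrite -sqrtr_sqr ler_wsqrtr// lerDr sqr_ge0. Qed.
Lemma cmod_leReIm (z : C) : cmod z <= `|Re z| + `|Im z|.
Proof.
case: z => x y /=; rewrite -[leRHS]ger0_norm ?addr_ge0// -sqrtr_sqr.
rewrite ler_wsqrtr// sqrrD !real_normK ?num_real// addrAC lerDl.
by rewrite mulrn_wge0// mulr_ge0.
Qed.

Lemma normrC_cmod (z : C) : `|z| = (cmod z)%:C%C.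
Proof. by case: z. Qed.

Lemma ltC_real (x : R) (e : C) : 0 < e -> x < Re e -> (x%:C%C : C) < e.
Proof. by rewrite !ltcE /= => /andP[/eqP -> _] ->; rewrite eqxx. Qed.

Lemma posC_Re (e : C) : 0 < e -> 0 < Re e /\ e = (Re e)%:C%C.
Proof. by case: e => a b; rewrite ltcE /= => /andP[/eqP ->]. Qed.

(** Convergence in [C] is stated with the real modulus and arbitrary filters,
    which lets one notion serve limits of sequences, continuity and limits
    along ultrafilters. *)
Section Convergence.
Variables (S : Type) (F : set_system S).
Definition tends (a : S -> C) (l : C) :=
  forall e : R, 0 < e -> F [set s | cmod (a s - l) < e].
Context {FF : Filter F}.

Lemma tends_cst l : tends (fun=> l) l.
Proof. by move=> e e0; apply: filterE => s /=; rewrite subrr cmod0. Qed.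

Lemma tends_near (a b : S -> C) l : F [set s | a s = b s] -> tends a l -> tends b l.
Proof.
move=> ab al e e0; apply: filterS2 ab (al e e0) => s /= <-//.
Qed.

Lemma tendsD a b l m : tends a l -> tends b m -> tends (fun s => a s + b s) (l + m).
Proof.
move=> al bm e e0; have e2 : 0 < e / 2 by rewrite divr_gt0.
apply: filterS2 (al _ e2) (bm _ e2) => s /= h1 h2.
have -> : a s + b s - (l + m) = (a s - l) + (b s - m) by ring.
by apply: le_lt_trans (cmodD _ _) _; rewrite (splitr e) ltrD.
Qed.

Lemma tends_cmod_lt a l (e : R) : tends a l -> cmod l < e -> F [set s | cmod (a s) < e].
Proof.
move=> al le; have h : 0 < e - cmod l by rewrite subr_gt0.
apply: filterS (al _ h) => s /= hs; rewrite -(subrK l (a s)).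
by apply: le_lt_trans (cmodD _ _) _; rewrite -ltrBrDr.
Qed.

Lemma tends0M a b (l : C) : tends a 0 -> tends b l -> tends (fun s => a s * b s) 0.
Proof.
move=> a0 bl e e0.
have M0 : 0 < cmod l + 1 by rewrite ltr_wpDl ?cmod_ge0.
have /a0 h : 0 < e / (cmod l + 1) by rewrite divr_gt0.
apply: filterS2 h (tends_cmod_lt bl (e := cmod l + 1) _) => [s /=|].
  rewrite !subr0 cmodM => h1 h2.
  apply: le_lt_trans (_ : _ <= cmod (a s) * (cmod l + 1)) _.
    by rewrite ler_wpM2l ?cmod_ge0// ltW.
  by rewrite -ltr_pdivlMr.
by rewrite ltrDl.
Qed.

Lemma tends_sub0 a l : tends a l <-> tends (fun s => a s - l) 0.
Proof.
by split=> h e e0; apply: filterS (h e e0) => s /=; rewrite subr0.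
Qed.

Lemma tendsM a b l m : tends a l -> tends b m -> tends (fun s => a s * b s) (l * m).
Proof.
move=> al bm; apply/tends_sub0.
have h1 := tends0M (proj1 (tends_sub0 _ _) al) bm.
have h2 := tends0M (proj1 (tends_sub0 _ _) bm) (tends_cst l).
have := tendsD h1 h2; rewrite addr0; apply: tends_near.
by apply: filterE => s /=; ring.
Qed.

Lemma tendsN a l : tends a l -> tends (fun s => - a s) (- l).
Proof.
move=> al e e0; apply: filterS (al e e0) => s /=.
by rewrite -opprD cmodN.
Qed.

Lemma tendsB a b l m : tends a l -> tends b m -> tends (fun s => a s - b s) (l - m).
Proof. by move=> al bm; apply: tendsD => //; exact: tendsN. Qed.

Lemma tendsV a l : l != 0 -> tends a l -> tends (fun s => (a s)^-1) l^-1.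
Proof.
move=> l0 al e e0; have cl : 0 < cmod l by rewrite cmod_gt0.
have h2 : 0 < cmod l / 2 by rewrite divr_gt0.
have h3 : 0 < e * (cmod l * (cmod l / 2)) by rewrite !mulr_gt0// invr_gt0.
apply: filterS2 (al _ h2) (al _ h3) => s /= h4 h5.
have h6 : cmod l / 2 < cmod (a s).
  have := cmodD (a s) (l - a s); rewrite addrC subrK cmodB => h.
  lra.
have as0 : a s != 0 by rewrite -cmod_gt0 (lt_trans h2).
have -> : (a s)^-1 - l^-1 = (l - a s) * (l * a s)^-1 by field; rewrite as0 l0.
rewrite cmodM cmodV cmodM cmodB ltr_pdivrMr; last by rewrite mulr_gt0// cmod_gt0.
by apply: lt_le_trans h5 _; rewrite ler_wpM2l ?(ltW e0)// ler_wpM2l ?ltW.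
Qed.

Lemma tendsX a l n : tends a l -> tends (fun s => a s ^+ n) (l ^+ n).
Proof.
move=> al; elim: n => [|n IH].
  by apply: tends_near (tends_cst 1); apply: filterE => s; rewrite /= expr0.
rewrite exprS; apply: tends_near (tendsM al IH).
by apply: filterE => s /=; rewrite exprS.
Qed.

Lemma tends_expz a l (k : int) : l != 0 -> tends a l -> tends (fun s => a s ^ k) (l ^ k).
Proof.
move=> l0 al; case: k => n; first exact: tendsX.
by apply: tendsV; [rewrite expf_neq0|exact: tendsX].
Qed.

Lemma tends_sum (I : Type) (r : seq I) (a : I -> S -> C) l :
  (forall i, tends (a i) (l i)) -> tends (fun s => \sum_(i <- r) a i s) (\sum_(i <- r) l i).
Proof.
move=> h; elim: r => [|i r IH].
  by rewrite big_nil; apply: tends_near (tends_cst 0); apply: filterE => s; rewrite /= big_nil.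
rewrite big_cons; apply: tends_near (tendsD (h i) IH).
by apply: filterE => s; rewrite /= big_cons.
Qed.

Lemma tends_prod (I : Type) (r : seq I) (a : I -> S -> C) l :
  (forall i, tends (a i) (l i)) -> tends (fun s => \prod_(i <- r) a i s) (\prod_(i <- r) l i).
Proof.
move=> h; elim: r => [|i r IH].
  by rewrite big_nil; apply: tends_near (tends_cst 1); apply: filterE => s; rewrite /= big_nil.
rewrite big_cons; apply: tends_near (tendsM (h i) IH).
by apply: filterE => s; rewrite /= big_cons.
Qed.

Lemma tends_cmod a l : tends a l -> cmod (a s) @[s --> F] --> cmod l.
Proof.
move=> al; apply/cvgrPdistC_lt => e e0; apply: filterS (al e e0) => s /= h.
exact: le_lt_trans (cmodB_ge _ _) h.
Qed.
End Convergence.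

Lemma tends_le (S : Type) (F : set_system S) {FF : ProperFilter F} (a : S -> C) (l : C) (M : R) :
  tends F a l -> F [set s | cmod (a s) <= M] -> cmod l <= M.
Proof.
move=> al h; rewrite leNgt; apply/negP => Ml.
have e0 : 0 < cmod l - M by rewrite subr_gt0.
have [s /= [h1 h2]] := filter_ex (filterI (al _ e0) h).
have h3 := cmodD (l - a s) (a s); rewrite subrK cmodB in h3.
by move: (lt_le_trans h1 (lexx _)); lra.
Qed.

Lemma tends_uniq (S : Type) (F : set_system S) {FF : ProperFilter F} (a : S -> C) (l m : C) :
  tends F a l -> tends F a m -> l = m.
Proof.
move=> al am; have h : tends F (fun s => a s - a s) (l - m) by exact: tendsB.
have : cmod (l - m) <= 0.
  apply: (tends_le h); apply: filterE => s /=; by rewrite subrr cmod0.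
by rewrite le_eqVlt ltNge cmod_ge0 orbF cmod_eq0 subr_eq0 => /eqP.
Qed.

Lemma filter_seq (I : eqType) (s : seq I) (S : Type) (F : set_system S) (P : I -> S -> Prop) :
  Filter F -> (forall i, i \in s -> F [set z | P i z]) -> F [set z | forall i, i \in s -> P i z].
Proof.
move=> FF; elim: s => [|i s IH] h; first by apply: filterE.
have h1 := h i (mem_head _ _).
have h2 : F [set z | forall j, j \in s -> P j z].
  by apply: IH => j js; apply: h; rewrite in_cons js orbT.
apply: filterS2 h1 h2 => z h1 h2 j; rewrite in_cons => /predU1P[->//|]; exact: h2.
Qed.

Lemma ultra_setVsetC (S : Type) (F : set_system S) (FU : UltraFilter F) A :
  ~ F A -> F (~` A).
Proof. by have [|//] := in_ultra_setVsetC A FU. Qed.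

Lemma ultra_fmap (S T : Type) (F : set_system S) (f : S -> T) :
  UltraFilter F -> UltraFilter (f @ F).
Proof.
move=> FU; split; first exact: fmap_proper_filter.
move=> G GF FG; apply/predeqP => A; split; last exact: FG.
move=> GA; apply: contrapT => nA.
have GC : G (~` A) by apply: FG; exact: (ultra_setVsetC FU (A := f @^-1` A)).
by have /filter_ex[x []] : G (A `&` ~` A) by exact: filterI.
Qed.

Lemma ultra_bounded_real (S : Type) (F : set_system S) (FU : UltraFilter F) (a : S -> R) (M : R) :
  F [set s | `|a s| <= M] -> exists l : R, a s @[s --> F] --> l.
Proof.
move=> h; have := @segment_compact R (- M) M; rewrite compact_ultra.
move=> /(_ (fmap a F) (ultra_fmap a FU)) [].
  by move: h; apply: (@filterS _ F) => s /=; rewrite ler_norml in_itv.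
by move=> l [_ hl]; exists l.
Qed.

Lemma ultra_bounded (S : Type) (F : set_system S) (FU : UltraFilter F) (a : S -> C) (M : R) :
  F [set s | cmod (a s) <= M] -> exists l, tends F a l.
Proof.
move=> h.
have [x hx] : exists l : R, Re (a s) @[s --> F] --> l.
  apply: (@ultra_bounded_real _ _ _ (fun s => Re (a s)) M); apply: filterS h => s /=.
  exact/le_trans/cmod_Re.
have [y hy] : exists l : R, Im (a s) @[s --> F] --> l.
  apply: (@ultra_bounded_real _ _ _ (fun s => Im (a s)) M); apply: filterS h => s /=.
  exact/le_trans/cmod_Im.
exists (x +i* y)%C => e e0; have e2 : 0 < e / 2 by rewrite divr_gt0.
have /cvgrPdistC_lt/(_ _ e2) hx' := hx; have /cvgrPdistC_lt/(_ _ e2) hy' := hy.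
apply: filterS2 hx' hy' => s /= h1 h2; apply: le_lt_trans (cmod_leReIm _) _.
by case: (a s) h1 h2 => u v /= h1 h2; rewrite (splitr e) ltrD.
Qed.

Lemma nbhsC (t : C) (A : set C) :
  nbhs t A <-> exists2 e : R, 0 < e & forall z, cmod (z - t) < e -> A z.
Proof.
split.
  move=> /nbhs_ballP[e /= e0 h]; have [e1 e2] := posC_Re e0.
  exists (Re e) => // z hz; apply: h; rewrite /ball /= normrC_cmod.
  by apply: ltC_real => //; rewrite cmodB.
move=> [e e0 h]; apply/nbhs_ballP; exists (e%:C%C) => /=; first by rewrite ltcR.
by move=> z; rewrite /ball /= normrC_cmod ltcR cmodB => /h.
Qed.

Lemma nbhsC_row n (t : C) (x : 'rV[C]_n) (A : set (C * 'rV[C]_n)) :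
  nbhs (t, x) A <-> exists2 e : R, 0 < e & forall (z : C) (y : 'rV[C]_n), cmod (z - t) < e ->
    (forall l, cmod (y 0 l - x 0 l) < e) -> A (z, y).
Proof.
split.
  move=> /nbhs_ballP[e /= e0 h]; have [e1 e2] := posC_Re e0.
  exists (Re e) => // z y hz hy; apply: h; split => /=.
    by rewrite /ball /= normrC_cmod; apply: ltC_real => //; rewrite cmodB.
  rewrite /ball /= /mx_ball; split=> // i j; rewrite !ord1 /ball /= normrC_cmod.
  by apply: ltC_real => //; rewrite cmodB.
move=> [e e0 h]; apply/nbhs_ballP; exists (e%:C%C) => /=; first by rewrite ltcR.
move=> [z y] [/= h1 [_ h2]]; apply: h.
  by move: h1; rewrite /ball /= normrC_cmod ltcR cmodB.
by move=> l; have := h2 0 l; rewrite /ball /= normrC_cmod ltcR cmodB.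
Qed.

Lemma tends_limn (u : nat -> C) l : tends \oo u l -> cvgn u /\ limn u = l.
Proof.
move=> ul; have h : u n @[n --> \oo] --> l.
  apply/cvgrPdistC_lt => e e0; have [e1 e2] := posC_Re e0.
  apply: filterS (ul _ e1) => n /= hn; rewrite normrC_cmod; exact: ltC_real.
by split; [apply/cvg_ex; exists l|exact: cvg_lim].
Qed.

End ComplexPlane.

(** * Sums of convergent Laurent series *)

Section PowerSeries.
Variable R : realType.
Local Notation C := R[i].
Implicit Types (c d : nat -> C) (t : C) (M A : R).

Local Notation half n := ((2^-1 : R) ^+ n).

Lemma half_small M (e : R) : 0 < e -> \forall n \near \oo, M * half n < e.
Proof.
move=> e0; have h : (fun n => M * half n) @ \oo --> M * 0.
  apply: cvgMr; apply: cvg_expr; rewrite ger0_norm ?invr_ge0// invf_lt1// ltr1n//.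
rewrite mulr0 in h; move/cvgrPdistC_lt: h => /(_ e e0); apply: filterS => n.
rewrite subr0; exact/le_lt_trans/ler_norm.
Qed.

Lemma geo_step (u : nat -> C) M : 0 <= M ->
  (forall n, cmod (u n.+1 - u n) <= M * half n) ->
  forall n m, (n <= m)%N -> cmod (u n - u m) <= 2 * M * half n.
Proof.
move=> M0 h n m nm; rewrite -(subnKC nm); move: (m - n)%N => k {m nm}.
suff : cmod (u n - u (n + k)%N) <= 2 * M * half n * (1 - half k).
  move/le_trans; apply; rewrite ler_piMr ?mulr_ge0 ?exprn_ge0//.
elim: k => [|k IH]; first by rewrite addn0 subrr cmod0 expr0 subrr mulr0.
apply: le_trans (cmod_triangle (u (n + k)%N) _ _) _.
have := h (n + k)%N; rewrite cmodB -addnS => h2.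
apply: le_trans (lerD IH h2) _; rewrite exprD exprS.
by rewrite le_eqVlt; apply/orP; left; apply/eqP; field.
Qed.

(** A bounded sequence converges along an ultrafilter, and the geometric bound
    turns this limit into the limit of the sequence. *)
Lemma geo_limit (u : nat -> C) M : 0 <= M ->
  (forall n, cmod (u n.+1 - u n) <= M * half n) ->
  exists l, forall n, cmod (u n - l) <= 2 * M * half n.
Proof.
move=> M0 h; have hs := geo_step M0 h.
have [G [GU sG]] := @ultraFilterLemma nat \oo _.
have [l hl] : exists l, tends G u l.
  apply: (@ultra_bounded _ _ _ GU u (cmod (u 0%N) + 2 * M)); apply: filterE => n /=.
  have := hs _ _ (leq0n n); rewrite expr0 mulr1 cmodB => h1.
  rewrite -(subrK (u 0%N) (u n)) addrC; apply: le_trans (cmodD _ _) _.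
  by rewrite lerD2l.
exists l => n; apply: (tends_le (tendsB (tends_cst (F := G) (u n)) hl)).
by apply: sG; exists n => // m /= nm; exact: hs.
Qed.

Definition partial c t n := \sum_(k < n) c k * t ^+ k.
Definition psum c t := limn (partial c t).

(* The product of two series with coefficients at most M A ^ n has coefficients
   at most M ^ 2 (2 A) ^ n; with A |t| <= 1/8 it is dominated by 4 ^ - n. *)
Definition geometric c M A := [/\ 0 <= M, 1 <= A & forall n, cmod (c n) <= M * A ^+ n].
Definition small A t := A * cmod t <= 8^-1.

Section Tail.
Variables (c : nat -> C) (M A : R) (t : C).
Hypotheses (hc : geometric c M A) (ht : small A t).

Lemma geometric_term n : cmod (c n * t ^+ n) <= M * 8^-1 ^+ n.
Proof.
have [M0 A1 h] := hc; rewrite cmodM cmodX.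
apply: le_trans (_ : _ <= M * (A * cmod t) ^+ n) _.
  by rewrite exprMn mulrA ler_wpM2r// exprn_ge0 ?cmod_ge0.
rewrite ler_wpM2l// lerXn2r// nnegrE ?invr_ge0//.
by rewrite mulr_ge0 ?cmod_ge0// (le_trans _ A1).
Qed.

Lemma partial_step n : cmod (partial c t n.+1 - partial c t n) <= M * half n.
Proof.
rewrite /partial big_ord_recr /= addrAC subrr add0r.
apply: le_trans (geometric_term n) _; have [M0 _ _] := hc.
rewrite ler_wpM2l// lerXn2r// ?nnegrE ?invr_ge0// lef_pV2 ?posrE// ler_nat//.
Qed.

Lemma psum_tail n : cmod (partial c t n - psum c t) <= 2 * M * half n.
Proof.
have [M0 _ _] := hc.
have [l hl] := geo_limit M0 partial_step; suff -> : psum c t = l by exact: hl.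
apply: (proj2 (tends_limn _)) => e e0.
by apply: filterS (half_small (2 * M) e0) => k /=; apply: le_lt_trans (hl k).
Qed.

Lemma partial_tends : tends \oo (partial c t) (psum c t).
Proof.
move=> e e0; apply: filterS (half_small (2 * M) e0) => k /=.
exact: le_lt_trans (psum_tail k).
Qed.
End Tail.

Lemma psumE c t l : tends \oo (partial c t) l -> psum c t = l.
Proof. by move=> /tends_limn[]. Qed.

Lemma psumD c d M A t : geometric c M A -> geometric d M A -> small A t ->
  psum (fun n => c n + d n) t = psum c t + psum d t.
Proof.
move=> hc hd ht; apply: psumE.
apply: tends_near (tendsD (partial_tends hc ht) (partial_tends hd ht)).
apply: filterE => n /=; rewrite /partial -big_split /=.
by apply: eq_bigr => k _; rewrite mulrDl.
Qed.

Lemma partial_horner c t n : partial c t n = (\poly_(i < n) c i).[t].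
Proof. by rewrite horner_poly. Qed.

(** The product of two partial sums exceeds the partial sum of the product by the
    monomials of degree n to 2n - 1 of a product of polynomials: at most n terms,
    each at most M ^ 2 / 4 ^ n, and n <= 2 ^ n. *)
Lemma psumM c d M A t : geometric c M A -> geometric d M A -> small A t ->
  psum (fun n => \sum_(i < n.+1) c i * d (n - i)%N) t = psum c t * psum d t.
Proof.
move=> hc hd ht; apply: psumE; set e := fun n => _.
have [M0 A1 hc'] := hc; have [_ _ hd'] := hd.
have A0 : 0 <= A by apply: le_trans A1.
have key n : cmod (partial c t n * partial d t n - partial e t n) <= M * M * half n.
  rewrite !partial_horner -hornerM; set p := _ * _.
  have sp : (size p <= n + n)%N.
    apply: leq_trans (size_polyMleq _ _) _.
    apply: leq_trans (leq_pred _) _; apply: leq_add; exact: size_poly.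
  rewrite (horner_coef_wide _ sp) horner_poly.
  rewrite -(big_mkord xpredT (fun i => p`_i * t ^+ i)) (big_cat_nat (n := n)) ?leq_addr//=.
  rewrite -(big_mkord xpredT (fun i => e i * t ^+ i)).
  rewrite [X in X + _ - _](_ : _ = \sum_(0 <= i < n) e i * t ^+ i); last first.
    rewrite big_nat [RHS]big_nat; apply: eq_bigr => i /andP[_ lin].
    congr (_ * _); rewrite /p coefM; apply: eq_bigr => j _.
    by rewrite !coef_poly (leq_ltn_trans _ lin) ?leq_ord// (leq_ltn_trans (leq_subr _ _)).
  rewrite addrAC subrr add0r; apply: le_trans (cmod_sum _ _ _) _.
  apply: (@le_trans _ _ (\sum_(n <= i < n + n) M * M * 4^-1 ^+ n)).
    rewrite big_nat [leRHS]big_nat; apply: ler_sum => i /andP[ni lin].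
    have pi : cmod p`_i <= 2 ^+ i * (M * M) * A ^+ i.
      rewrite /p coefM; apply: le_trans (cmod_sum _ _ _) _.
      apply: (@le_trans _ _ (\sum_(j < i.+1) M * M * A ^+ i)).
        apply: ler_sum => j _; rewrite cmodM !coef_poly.
        have -> : A ^+ i = A ^+ j * A ^+ (i - j) by rewrite -exprD subnKC// leq_ord.
        by rewrite mulrACA ler_pM ?cmod_ge0//; case: ifP => // _;
           rewrite cmod0 mulr_ge0// exprn_ge0.
      rewrite sumr_const card_ord -[leLHS]mulr_natl -(mulrA (2 ^+ i)) ler_wpM2r//.
        by rewrite mulr_ge0 ?mulr_ge0// exprn_ge0.
      by rewrite -natrX ler_nat ltn_expl.
    rewrite cmodM cmodX; apply: le_trans (ler_wpM2r _ pi) _.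
      by rewrite exprn_ge0 ?cmod_ge0.
    rewrite -[leLHS]mulrA -exprMn mulrAC -exprMn [leLHS]mulrC ler_wpM2l ?mulr_ge0//.
    apply: (@le_trans _ _ (4^-1 ^+ i)).
      rewrite lerXn2r ?nnegrE ?invr_ge0 ?mulr_ge0 ?cmod_ge0//.
      move: ht; rewrite /small; lra.
    by apply: ler_wiXn2l => //; rewrite ?invr_ge0 ?invf_le1// ler1n.
  rewrite sumr_const_nat addnK -[leLHS]mulr_natl mulrCA ler_wpM2l ?mulr_ge0//.
  have -> : (4^-1 : R) = 2^-1 * 2^-1 by field.
  rewrite exprMn mulrA ler_piMl ?exprn_ge0//.
  rewrite exprVn ler_pdivrMr ?exprn_gt0// mul1r -natrX ler_nat.
  exact/ltnW/ltn_expl.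
have hcd : tends \oo (fun n => partial c t n * partial d t n) (psum c t * psum d t).
  exact: tendsM (partial_tends hc ht) (partial_tends hd ht).
have h0 : tends \oo (fun n => partial c t n * partial d t n - partial e t n) 0.
  move=> r r0; apply: filterS (half_small (M * M) r0) => k /=.
  by rewrite subr0; apply: le_lt_trans (key k).
rewrite -[_ * psum d t]subr0; apply: tends_near (tendsB hcd h0).
by apply: filterE => n /=; ring.
Qed.

Lemma psum_continuous c M A (S : Type) (F : set_system S) {FF : Filter F}
    (t : S -> C) t0 : geometric c M A -> small A t0 ->
  F [set s | small A (t s)] -> tends F t t0 ->
  tends F (fun s => psum c (t s)) (psum c t0).
Proof.
move=> hc h0 hF ht e e0; have e3 : 0 < e / 3 by rewrite divr_gt0.
have [n hn] := filter_ex (half_small (2 * M) e3).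
have hp : tends F (fun s => partial c (t s) n) (partial c t0 n).
  apply: tends_sum => i; apply: tendsM; [exact: tends_cst|exact: tendsX].
apply: filterS2 hF (hp _ e3) => s /= hs h.
have h1 := psum_tail hc hs n; have h2 := psum_tail hc h0 n.
have h3 := cmod_triangle (partial c (t s) n) (psum c (t s)) (psum c t0).
have h4 := cmod_triangle (partial c t0 n) (partial c (t s) n) (psum c t0).
rewrite cmodB in h1; lra.
Qed.

Lemma psum0 c : psum c 0 = c 0%N.
Proof.
apply: psumE => e e0; exists 1%N => // n /= n0.
rewrite /partial; case: n n0 => // n _; rewrite big_ord_recl expr0 mulr1 big1.
  by rewrite addr0 subrr cmod0.
by move=> i _; rewrite expr0n /= mulr0.
Qed.

End PowerSeries.

Section LaurentEvaluation.
Variable R : realType.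
Local Notation C := R[i].
Local Notation K := (laurent R).
Implicit Types (f g : K) (t : C) (s : int).

(** The order of vanishing is only bounded below: sums and products of series can
    then be compared from a common starting index. *)
Definition starts f s := forall k, k < s -> f k = 0.

Lemma starts_ex f : exists s, starts f s.
Proof. by have [s [_ [_ [h _]]]] := coefP f; exists s. Qed.

Lemma starts_le f s s' : s' <= s -> starts f s -> starts f s'.
Proof. by move=> ss h k ks; apply: h; exact: lt_le_trans ss. Qed.

Definition shifted f s (n : nat) := f (s + n%:Z).

Lemma shifted_geometric f s : starts f s -> exists M A, geometric (shifted f s) M A.
Proof.
move=> hs; have [u [M [A [h1 h2]]]] := coefP f.
pose A' := Num.max 1 `|A|; pose d := absz (s - u)%R.
have A1 : 1 <= A' by rewrite /A' le_max lexx.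
have A0 : 0 <= A' by apply: le_trans A1.
have AA : `|A| <= A' by rewrite /A' le_max lexx orbT.
have h3 n : cmod (f (u + n%:Z)) <= `|M| * A' ^+ n.
  apply: le_trans (h2 n) _; apply: le_trans (ler_norm _) _.
  by rewrite normrM ler_wpM2l// normrX lerXn2r ?nnegrE.
exists (`|M| * A' ^+ d), A'; split=> // [|n]; first by rewrite mulr_ge0// exprn_ge0.
have [lt|le] := ltP (s + n%:Z) u.
  by rewrite /shifted h1// cmod0 !mulr_ge0// exprn_ge0.
rewrite /shifted; have [m [-> mn]] : exists m : nat, s + n%:Z = u + m%:Z /\ (m <= d + n)%N.
  by exists (absz (s + n%:Z - u)%R); rewrite /d; split; lia.
apply: le_trans (h3 m) _; rewrite -mulrA -exprD ler_wpM2l//; exact: ler_weXn2l.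
Qed.

Lemma geometric_le (c : nat -> C) (M A M' A' : R) : M <= M' -> A <= A' ->
  geometric c M A -> geometric c M' A'.
Proof.
move=> MM AA [M0 A1 h]; have A0 : 0 <= A by apply: le_trans A1.
split; [exact: le_trans MM|exact: le_trans AA|move=> n].
apply: le_trans (h n) _; apply: ler_pM => //; first exact: exprn_ge0.
by rewrite lerXn2r ?nnegrE ?(le_trans A0).
Qed.

Lemma laurent_sum_partial f s t n : starts f s -> t != 0 -> (`|s| <= n)%N ->
  laurent_sum t f n = t ^ s * partial (shifted f s) t (absz (n%:Z - s)).
Proof.
move=> hs t0 sn; rewrite /laurent_sum.
pose a := absz (n%:Z + s).
have an : (a <= n.*2)%N by rewrite /a; lia.
rewrite (big_cat_nat (n := a))//= big_nat big1 ?add0r; last first.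
  by move=> i /andP[_ ia]; rewrite hs ?mul0r//; move: ia; rewrite /a; lia.
rewrite -{1}(add0n a) big_addn /partial mulr_sumr.
have -> : (n.*2 - a)%N = absz (n%:Z - s) by rewrite /a; lia.
rewrite big_mkord; apply: eq_bigr => i _.
have -> : (i + a)%N%:Z - n%:Z = s + i%:Z by rewrite /a; lia.
by rewrite expfzDr// mulrCA.
Qed.

Lemma laurent_eval_psum f s M A t : starts f s -> geometric (shifted f s) M A ->
  t != 0 -> small A t ->
  cvgn (laurent_sum t f) /\ laurent_eval t f = t ^ s * psum (shifted f s) t.
Proof.
move=> hs hg t0 ht; apply: tends_limn => e e0.
have ts : 0 < cmod (t ^ s) by rewrite cmod_gt0 expfz_neq0.
have e1 : 0 < e / cmod (t ^ s) by rewrite divr_gt0.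
have [N _ hN] := partial_tends hg ht e1.
exists (N + `|s|)%N => // n /= Nn.
rewrite (laurent_sum_partial hs t0); last by lia.
rewrite -mulrBr cmodM mulrC -ltr_pdivlMr//; apply: hN => /=; lia.
Qed.

(** Near 0 the truncated sums are a fixed power of [t] times the partial sums of
    one power series, so convergence and continuity are those of that series. *)
Lemma laurent_radius f : exists2 r : R, 0 < r & converges_on r f /\
  forall (S : Type) (F : set_system S), Filter F -> forall (t : S -> C) t0,
    0 < cmod t0 < r -> tends F t t0 ->
    tends F (fun u => laurent_eval (t u) f) (laurent_eval t0 f).
Proof.
have [s hs] := starts_ex f; have [M [A hg]] := shifted_geometric hs.
have [_ A1 _] := hg; have A0 : 0 < A by apply: lt_le_trans A1.
have sm t : cmod t < 8^-1 / A -> small A t.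
  by rewrite ltr_pdivlMr// mulrC => /ltW.
exists (8^-1 / A); first by rewrite divr_gt0// invr_gt0.
split=> [t /andP[t0 /sm ts]|S F FF t t0 /andP[t00 t0r] ht].
  by rewrite cmod_gt0 in t0; have [] := laurent_eval_psum hs hg t0 ts.
have n0 : t0 != 0 by rewrite -cmod_gt0.
have hr : F [set u | cmod (t u) < 8^-1 / A] by exact: tends_cmod_lt ht t0r.
have h0 : F [set s | t s != 0].
  apply: filterS (ht _ t00) => u /= h; apply: contraTneq h => ->.
  by rewrite sub0r cmodN ltxx.
rewrite (proj2 (laurent_eval_psum hs hg n0 (sm _ t0r))).
apply: (@tends_near _ _ _ FF (fun u => t u ^ s * psum (shifted f s) (t u))).
  by apply: filterS2 hr h0 => u /= /sm h1 h2; rewrite (proj2 (laurent_eval_psum hs hg h2 h1)).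
apply: tendsM; first exact: tends_expz.
apply: psum_continuous hg (sm _ t0r) _ ht.
by apply: filterS hr => u /sm.
Qed.

Definition near0 (P : C -> Prop) := exists2 r : R, 0 < r & forall t, 0 < cmod t < r -> P t.

Lemma near0S (P Q : C -> Prop) : (forall t, P t -> Q t) -> near0 P -> near0 Q.
Proof. by move=> PQ [r r0 h]; exists r => // t /h/PQ. Qed.

Lemma near0I (P Q : C -> Prop) : near0 P -> near0 Q -> near0 (fun t => P t /\ Q t).
Proof.
move=> [r r0 h] [r' r0' h']; exists (Num.min r r'); first by rewrite lt_min r0.
by move=> t; rewrite lt_min => /and3P[t0 h1 h2]; split; [apply: h|apply: h']; rewrite t0.
Qed.

Lemma near0_small A : 0 < A -> near0 (fun t => small A t).
Proof.
move=> A0; exists (8^-1 / A); first by rewrite divr_gt0// invr_gt0.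
by move=> t /andP[_]; rewrite ltr_pdivlMr// mulrC => /ltW.
Qed.

Lemma near0_neq0 : near0 (fun t => t != 0).
Proof. by exists 1 => // t /andP[]; rewrite cmod_gt0. Qed.

Lemma near0_psum f s : starts f s ->
  near0 (fun t => laurent_eval t f = t ^ s * psum (shifted f s) t).
Proof.
move=> hs; have [M [A hg]] := shifted_geometric hs.
have [_ A1 _] := hg; have A0 : 0 < A by apply: lt_le_trans A1.
apply: near0S (near0I near0_neq0 (near0_small A0)) => t [t0 ht].
by have [] := laurent_eval_psum hs hg t0 ht.
Qed.

Lemma geometric_common (c d : nat -> C) : (exists M A, geometric c M A) ->
  (exists M A, geometric d M A) -> exists M A, geometric c M A /\ geometric d M A.
Proof.
move=> [M [A h]] [M' [A' h']]; exists (Num.max M M'), (Num.max A A').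
by split; [apply: geometric_le h|apply: geometric_le h']; rewrite le_max lexx ?orbT.
Qed.

Lemma laurent_evalD f g :
  near0 (fun t => laurent_eval t (f + g) = laurent_eval t f + laurent_eval t g).
Proof.
have [s' hf] := starts_ex f; have [s'' hg] := starts_ex g.
pose s := Num.min s' s''.
have {}hf : starts f s by apply: starts_le hf; rewrite ge_min lexx.
have {}hg : starts g s by apply: starts_le hg; rewrite ge_min lexx orbT.
have hfg : starts (f + g) s by move=> k ks /=; rewrite hf// hg// addr0.
have [M [A [h1 h2]]] := geometric_common (shifted_geometric hf) (shifted_geometric hg).
have [_ A1 _] := h1; have A0 : 0 < A by apply: lt_le_trans A1.
apply: near0S (near0I (near0_small A0) (near0I (near0_psum hf)
  (near0I (near0_psum hg) (near0_psum hfg)))) => t [ht [-> [-> ->]]].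
by rewrite -mulrDr -(psumD h1 h2 ht).
Qed.

Lemma laurent_evalM f g :
  near0 (fun t => laurent_eval t (f * g) = laurent_eval t f * laurent_eval t g).
Proof.
have [s hf] := starts_ex f; have [u hg] := starts_ex g.
have hfg : starts (f * g) (s + u) by move=> k ks; exact: cauchy_prod_lt ks.
have [M [A [h1 h2]]] := geometric_common (shifted_geometric hf) (shifted_geometric hg).
have [_ A1 _] := h1; have A0 : 0 < A by apply: lt_le_trans A1.
apply: near0S (near0I near0_neq0 (near0I (near0_small A0) (near0I (near0_psum hf)
  (near0I (near0_psum hg) (near0_psum hfg))))) => t [t0 [ht [-> [-> ->]]]].
rewrite expfzDr// mulrACA -(psumM h1 h2 ht); congr (_ * psum _ _).
by apply/funext => n; rewrite /shifted [LHS](cauchy_prodE n hf hg).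
Qed.

Lemma laurent_eval_const (z : C) : near0 (fun t => laurent_eval t (laurent_const z) = z).
Proof.
exists 1 => // t t01; apply: (proj2 (tends_limn _)) => e e0; exists 1%N => // n /= n0.
rewrite /laurent_sum (bigD1_seq n) ?iota_uniq//=; last by rewrite mem_index_iota; lia.
rewrite subrr eqxx expr0z mulr1 big1 ?addr0 ?subrr ?cmod0// => i ni.
by rewrite ifF ?mul0r//; lia.
Qed.

End LaurentEvaluation.

(** * Parameters tending to zero *)

Section TowardsZero.
Variable R : realType.
Local Notation C := R[i].
Local Notation K := (laurent R).

(** The filters that see the puncture: parameters are also required to be nonzero,
    where Laurent series can be evaluated. *)
Definition to0 (S : Type) (F : set_system S) (t : S -> C) :=
  forall d : R, 0 < d -> F [set s | 0 < cmod (t s) < d].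

Section Filter.
Variables (S : Type) (F : set_system S) (t : S -> C).
Context {FF : Filter F}.
Hypothesis F0 : to0 F t.

Lemma to0_near0 P : near0 P -> F [set s | P (t s)].
Proof. by move=> [r r0 h]; apply: filterS (F0 r0) => s /= /h. Qed.

Lemma to0_tends : tends F t 0.
Proof. by move=> e e0; apply: filterS (F0 e0) => s /=; rewrite subr0 => /andP[]. Qed.

Lemma hybrid_exponentE (z : C) : 0 < cmod z -> hybrid_exponent z = (- ln (cmod z))^-1.
Proof. by move=> z0; rewrite /hybrid_exponent lnV. Qed.

Lemma hybrid_exponent_gt0 (z : C) : 0 < cmod z < 1 -> 0 < hybrid_exponent z.
Proof.
by move=> /andP[z0 z1]; rewrite hybrid_exponentE// invr_gt0 oppr_gt0 ln_lt0// z0.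
Qed.

Lemma hybrid_exponent_small (e : R) : 0 < e ->
  F [set s | 0 < hybrid_exponent (t s) < e].
Proof.
move=> e0; have h1 : F [set s | 0 < cmod (t s) < 1] by exact: F0.
have h2 : F [set s | 0 < cmod (t s) < expR (- e^-1)] by apply: F0; exact: expR_gt0.
apply: filterS2 h1 h2 => s /= h1 /andP[z0 h2]; rewrite hybrid_exponent_gt0//=.
rewrite hybrid_exponentE// -[ltRHS]invrK ltf_pV2 ?posrE ?invr_gt0//.
  by rewrite ltrNr -ltr_expR lnK.
by rewrite oppr_gt0 ln_lt0.
Qed.

Lemma hybrid_exponent_cvg : hybrid_exponent (t s) @[s --> F] --> (0 : R).
Proof.
apply/cvgrPdistC_lt => e e0; apply: filterS (hybrid_exponent_small e0) => s /= /andP[h1 h2].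
by rewrite subr0 ger0_norm// ltW.
Qed.

Lemma powR_hybrid_cvg1 (a : S -> R) (l : R) : 0 < l -> a s @[s --> F] --> l ->
  a s `^ hybrid_exponent (t s) @[s --> F] --> (1 : R).
Proof.
move=> l0 al.
have h1 : ln (a s) @[s --> F] --> ln l.
  by apply: continuous_cvg al; exact: continuous_ln.
have h2 : hybrid_exponent (t s) * ln (a s) @[s --> F] --> 0 * ln l.
  by apply: cvgM => //; exact: hybrid_exponent_cvg.
rewrite mul0r in h2.
have h3 : expR (hybrid_exponent (t s) * ln (a s)) @[s --> F] --> expR (0 : R).
  by apply: continuous_cvg h2; exact: continuous_expR.
rewrite expR0 in h3; apply: cvg_trans h3; apply: near_eq_cvg.
have : \forall s \near F, 0 < a s by apply: cvgr_gt al _ l0.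
by apply: filterS => s a0; rewrite /powR gt_eqF.
Qed.

Lemma ord_zeroE (f : K) s : f s != 0 -> starts f s -> ord_zero f = (s%:~R)%:E.
Proof.
move=> fs hs; apply/eqP; rewrite eq_le; apply/andP; split.
  by apply: ereal_inf_lbound; exists s.
apply: le_ereal_inf_tmp => _ [k /= fk <-]; rewrite lee_fin ler_int leNgt.
by apply/negP => /hs/eqP; rewrite (negPf fk).
Qed.

Lemma ord_zero0 : ord_zero (0 : K) = +oo%E.
Proof.
rewrite /ord_zero [X in ereal_inf X](_ : _ = set0) ?ereal_inf0//.
by apply/seteqP; split=> // x [k /=]; rewrite eqxx.
Qed.

(** Write f as t ^ k psi(t) with psi(0) nonzero. The factor |psi(t)| tends to a
    nonzero limit, so its renormalization tends to 1, while |t| ^ eps = 1 / e for all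
    t. Thus the absolute value of K is the limit of those of C. *)
Lemma laurent_eval_cvg (f : K) :
  cmod (laurent_eval (t s) f) `^ hybrid_exponent (t s) @[s --> F] -->
    abs_semivaluation (ord_zero f).
Proof.
have [->|f0] := eqVneq f 0.
  rewrite ord_zero0 /abs_semivaluation /=.
  have [s0 h0] := starts_ex (0 : K).
  apply: (@cvg_trans _ ((fun=> 0 : R) @ F)); last exact: cvg_cst.
  apply: near_eq_cvg; have := to0_near0 (laurent_evalD (0 : K) 0).
  apply: filterS2 (hybrid_exponent_small ltr01) => s /= /andP[e0 _].
  rewrite addr0 => /eqP; rewrite -subr_eq0 opprD addNKr oppr_eq0 => /eqP ->.
  by rewrite cmod0 powR0// gt_eqF.
have [k [fk hk]] := laurent_neq0 f0.
rewrite (ord_zeroE fk hk) /abs_semivaluation /=.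
have [M [A hg]] := shifted_geometric hk.
have [_ A1 _] := hg; have A0 : 0 < A by apply: lt_le_trans A1.
pose psi s := psum (shifted f k) (t s).
have hpsi : tends F psi (f k).
  (* psi(0) is the leading coefficient of f *)
  have -> : f k = psum (shifted f k) 0 by rewrite psum0 /shifted addr0.
  apply: (@psum_continuous _ _ _ _ _ _ _ _ _ hg) => //.
  - by rewrite /small cmod0 mulr0 invr_ge0.
  - exact: (to0_near0 (near0_small A0)).
  - exact: to0_tends.
have h1 := powR_hybrid_cvg1 (_ : 0 < cmod (f k)) (tends_cmod hpsi).
have {h1} h1 : cmod (psi s) `^ hybrid_exponent (t s) @[s --> F] --> (1 : R).
  by apply: h1; rewrite cmod_gt0.
have h2 : expR (- k%:~R) * cmod (psi s) `^ hybrid_exponent (t s) @[s --> F]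
    --> expR (- k%:~R) * (1 : R) by apply: cvgM => //; exact: cvg_cst.
rewrite mulr1 in h2; apply: cvg_trans h2; apply: near_eq_cvg.
apply: filterS2 (to0_near0 (near0_psum hk)) (F0 ltr01) => s /= -> /andP[t0 t1].
rewrite cmodM powRM ?cmod_ge0//; congr (_ * _).
have -> : cmod (t s ^ k) = cmod (t s) ^ k.
  by case: k {fk hk hg psi hpsi h1} => n /=; rewrite ?NegzE -?exprnN ?cmodV cmodX.
rewrite -powR_intmul ?cmod_ge0// -powRrM /powR gt_eqF//; congr expR.
rewrite hybrid_exponentE// invrN mulrN mulNr -mulrA mulVf ?mulr1//.
by rewrite lt_eqF// ln_lt0// t0.
Qed.

End Filter.

Lemma powR_cvg (S : Type) (F : set_system S) (FF : Filter F) (a e : S -> R) (a0 e0 : R) :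
  0 < e0 -> (forall s, 0 <= a s) -> 0 <= a0 ->
  a s @[s --> F] --> a0 -> e s @[s --> F] --> e0 ->
  a s `^ e s @[s --> F] --> a0 `^ e0.
Proof.
move=> he ha; rewrite le_eqVlt => /predU1P[<-|ha0] al el.
  rewrite powR0 ?gt_eqF//; apply/cvgrPdistC_lt => r r0.
  (* the base is eventually below 1, where lowering the exponent to e0 / 2 only
     increases the power; m is chosen so that m ^ (e0 / 2) <= r *)
  have e2 : e0 / 2 < e0 by lra.
  have e3 : 0 < e0 / 2 by lra.
  have h1 : \forall s \near F, e0 / 2 < e s by exact: cvgr_gt el _ e2.
  pose m := Num.min 1 (r `^ (e0 / 2)^-1).
  have m0 : 0 < m by rewrite lt_min ltr01 powR_gt0.
  have h2 : \forall s \near F, a s < m by exact: cvgr_lt al _ m0.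
  apply: filterS2 h1 h2 => s h1 h2; rewrite subr0 ger0_norm ?powR_ge0//.
  have [->|as0] := eqVneq (a s) 0; first by rewrite powR0// gt_eqF// (lt_trans e3).
  have as1 : 0 < a s by rewrite lt_neqAle eq_sym as0 ha.
  apply: (@le_lt_trans _ _ (a s `^ (e0 / 2))).
    apply: ger_powR (ltW h1); rewrite as1/=; apply: ltW (lt_le_trans h2 _).
    by rewrite /m ge_min lexx.
  apply: (@lt_le_trans _ _ (m `^ (e0 / 2))).
    by apply: gt0_ltr_powR => //; rewrite nnegrE ltW.
  have -> : r = (r `^ (e0 / 2)^-1) `^ (e0 / 2).
    by rewrite -powRrM mulVf ?lt0r_neq0// powRr1// ltW.
  apply: (ge0_ler_powR (ltW e3)); rewrite ?nnegrE ?powR_ge0 ?(ltW m0) ?(ltW e3)//.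
  by rewrite /m ge_min lexx orbT.
have h1 : ln (a s) @[s --> F] --> ln a0.
  by apply: continuous_cvg al; exact: continuous_ln.
have h2 : e s * ln (a s) @[s --> F] --> e0 * ln a0 by exact: cvgM.
have h3 : expR (e s * ln (a s)) @[s --> F] --> expR (e0 * ln a0).
  by apply: continuous_cvg h2; exact: continuous_expR.
rewrite {2}/powR gt_eqF//; apply: cvg_trans h3; apply: near_eq_cvg.
have : \forall s \near F, 0 < a s by exact: cvgr_gt al _ ha0.
by apply: filterS => s as0; rewrite /powR gt_eqF.
Qed.

Section Saturation.
Variables (S : Type) (t : S -> C) (I J : eqType).
Variables (P : I -> set S) (Q : J -> set S).

(** If no finite lists and no disc worked, the counterexamples would generate a
    filter, and an ultrafilter containing it would satisfy every [P i] and no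
    [Q j]. Statements over a field of germs, where infinitely many equations can be
    used one at a time, become in this way finitely many equations on one disc. *)
Theorem saturation :
  (forall E : set_system S, UltraFilter E -> to0 E t -> (forall i, E (P i)) ->
     exists j, E (Q j)) ->
  exists (I0 : seq I) (J0 : seq J), near0 (fun z => forall s, t s = z ->
    (forall i, i \in I0 -> P i s) -> exists2 j, j \in J0 & Q j s).
Proof.
move=> hE; apply: contrapT => hn.
pose base (x : seq I * seq J * R) : set S := [set s | [/\ 0 < cmod (t s) < x.2,
  forall i, i \in x.1.1 -> P i s & forall j, j \in x.1.2 -> ~ Q j s]].
pose D : set (seq I * seq J * R) := [set x | 0 < x.2].
have FF : ProperFilter (filter_from D base).
  apply: filter_from_proper; last first.
    move=> [[I0 J0] r] /= r0; apply: contrapT => h0; apply: hn.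
    exists I0, J0, r => // z hz s tsz hI; apply: contrapT => hJ; apply: h0.
    exists s; split=> //=; first by rewrite tsz.
    by move=> j jJ qj; apply: hJ; exists j.
  apply: filter_from_filter; first by exists ([::], [::], 1) => /=; exact: ltr01.
  move=> [[I0 J0] r] [[I1 J1] r'] /= r0 r'0.
  exists (I0 ++ I1, J0 ++ J1, Num.min r r') => /=; first by rewrite /D/= lt_min r0.
  move=> s [/=]; rewrite lt_min => /and3P[t0 t1 t2] hI hJ.
  split; split=> //=; rewrite ?t0//.
  - by move=> i iI; apply: hI; rewrite mem_cat iI.
  - by move=> i iI; apply: hJ; rewrite mem_cat iI.
  - by move=> i iI; apply: hI; rewrite mem_cat iI orbT.
  - by move=> i iI; apply: hJ; rewrite mem_cat iI orbT.
have [E [EU sE]] := ultraFilterLemma FF.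
have E0 : to0 E t.
  by move=> d d0; apply: sE; exists ([::], [::], d) => // s [].
have EP i : E (P i).
  apply: sE; exists ([:: i], [::], 1) => /=; first exact: ltr01.
  by move=> s [_ h _]; apply: h; rewrite mem_head.
have [j Ej] := hE E EU E0 EP.
have Ej' : E (~` Q j).
  apply: sE; exists ([::], [:: j], 1) => /=; first exact: ltr01.
  by move=> s [_ _ h]; apply: h; rewrite mem_head.
by have /filter_ex[s []] : E (Q j `&` ~` Q j) by exact: filterI.
Qed.

End Saturation.

Corollary saturation1 (S : Type) (t : S -> C) (I : eqType) (P : I -> set S) (Q : set S) :
  (forall E : set_system S, UltraFilter E -> to0 E t -> (forall i, E (P i)) -> E Q) ->
  exists I0 : seq I, near0 (fun z => forall s, t s = z ->
    (forall i, i \in I0 -> P i s) -> Q s).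
Proof.
move=> h; have [|I0 [J0 hr]] := @saturation S t I unit P (fun=> Q).
  by move=> E EU E0 /(h E EU E0) EQ; exists tt.
by exists I0; apply: near0S hr => z hz s sz /(hz s sz)[].
Qed.

Corollary saturation0 (S : Type) (t : S -> C) (P Q : set S) :
  (forall E : set_system S, UltraFilter E -> to0 E t -> E P -> E Q) ->
  near0 (fun z => forall s, t s = z -> P s -> Q s).
Proof.
move=> h; have [|I0 hr] := @saturation1 S t unit (fun=> P) Q.
  by move=> E EU E0 EP; apply: h => //; exact: EP tt.
by apply: near0S hr => z hz s sz Ps; apply: hz.
Qed.

Lemma ultra_finite (S : Type) (E : set_system S) (EU : UltraFilter E) (I : finType)
    (A : I -> set S) : E (\bigcup_i A i) -> exists i, E (A i).
Proof.
move=> h; apply: contrapT => hn.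
have hC i : E (~` A i) by apply: ultra_setVsetC => Ai; apply: hn; exists i.
have : E [set s | forall i, (~` A i) s] by exact: filter_forall.
move=> hA; have /filter_ex[s [[i _ Ai] /(_ i)]] :
    E ((\bigcup_i A i) `&` [set s | forall i, (~` A i) s]) by exact: filterI.
by [].
Qed.

End TowardsZero.

(** * The field of germs along an ultrafilter *)

Section PolynomialValues.
Variables (k : fieldType) (A : comPzRingType) (c : {rmorphism k -> A}).
Variables (n : nat) (x : 'I_n -> A).
Implicit Types (p q : mpoly n k) (m : multinom n).

Let mon m := \prod_(i < n) x i ^+ m i.

Lemma peval_wide r p : uniq r -> {subset msupp p <= r} ->
  peval c x p = \sum_(m <- r) c (mcoeff m p) * mon m.
Proof.
move=> ur sr; rewrite /peval [RHS](bigID (fun m => m \in msupp p))/=.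
rewrite [X in _ + X]big1 ?addr0; last first.
  by move=> m /memN_msupp_eq0 ->; rewrite rmorph0 mul0r.
rewrite -[RHS]big_filter; apply: perm_big; apply: uniq_perm.
- exact: msupp_uniq.
- exact: filter_uniq.
- by move=> m; rewrite mem_filter; case: (boolP (m \in msupp p)) => // /sr ->.
Qed.

Lemma pevalD p q : peval c x (p + q) = peval c x p + peval c x q.
Proof.
pose r := undup (msupp p ++ msupp q ++ msupp (p + q)).
have sub u : u \in [:: p; q; p + q] -> {subset msupp u <= r}.
  rewrite !inE => h m hm; rewrite mem_undup !mem_cat.
  by case/or3P: h hm => /eqP -> ->; rewrite ?orbT.
have w u : u \in [:: p; q; p + q] -> peval c x u = \sum_(m <- r) c (mcoeff m u) * mon m.
  by move=> hu; apply: peval_wide; [exact: undup_uniq|exact: sub].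
rewrite !w ?inE ?eqxx ?orbT//.
by rewrite -big_split /=; apply: eq_bigr => m _; rewrite mcoeffD rmorphD mulrDl.
Qed.

Lemma pevalZX a m : peval c x (a *: mpolyX k m) = c a * mon m.
Proof.
rewrite (@peval_wide [:: m])//; last first.
  by move=> m' /msuppZ_le; rewrite msuppX.
by rewrite big_seq1 mcoeffZ mcoeffX eqxx mulr1.
Qed.

Lemma peval0 : peval c x 0 = 0.
Proof. by rewrite /peval msupp0 big_nil. Qed.

Lemma pevalM p q : peval c x (p * q) = peval c x p * peval c x q.
Proof.
elim/mpolyind: p q => [|a m p _ _ IH] q; first by rewrite mul0r peval0 mul0r.
rewrite mulrDl !pevalD IH mulrDl; congr (_ + _).
elim/mpolyind: q => [|b m' q _ _ IHq]; first by rewrite mulr0 peval0 mulr0.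
rewrite mulrDr !pevalD IHq mulrDr; congr (_ + _).
rewrite -scalerAl -scalerAr scalerA -mpolyXD !pevalZX rmorphM mulrACA.
congr (_ * _); rewrite /mon -big_split /=; apply: eq_bigr => i _.
by rewrite mnmDE exprD.
Qed.

Lemma pevalC a : peval c x (mpolyC n a) = c a.
Proof.
have -> : mpolyC n a = a *: mpolyX k (@mnm0 n) by rewrite mpolyX0 -mul_mpolyC mulr1.
by rewrite pevalZX /mon big1 ?mulr1// => i _; rewrite mnm0E expr0.
Qed.

Lemma pevalX i : peval c x (mpolyX k (mnm1 i)) = x i.
Proof.
rewrite -[mpolyX _ _]scale1r pevalZX rmorph1 mul1r /mon (bigD1 i)//= mnm1E eqxx expr1.
by rewrite big1 ?mulr1// => j ji; rewrite mnm1E eq_sym (negPf ji) expr0.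
Qed.

End PolynomialValues.

Section PevalMorphism.
Variables (k : fieldType).

Lemma peval_rmorph (A B : comPzRingType) (f : {rmorphism A -> B}) n (c : k -> A)
    (x : 'I_n -> A) p : f (peval c x p) = peval (f \o c) (f \o x) p.
Proof.
rewrite /peval rmorph_sum; apply: eq_bigr => m _; rewrite rmorphM rmorph_prod.
by congr (_ * _); apply: eq_bigr => i _; rewrite rmorphXn.
Qed.

Lemma eq_peval (A : comPzRingType) n (c c' : k -> A) (x x' : 'I_n -> A) p :
  c =1 c' -> x =1 x' -> peval c x p = peval c' x' p.
Proof.
move=> cc xx; rewrite /peval; apply: eq_bigr => m _; rewrite cc; congr (_ * _).
by apply: eq_bigr => i _; rewrite xx.
Qed.

Variables (A : comPzRingType) (c : {rmorphism k -> A}) (n : nat) (x : 'I_n -> A).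

Definition pvalues : set A := [set a | exists p, peval c x p = a].

Lemma pvaluesC a : pvalues (c a).
Proof. by exists (mpolyC n a); rewrite pevalC. Qed.
Lemma pvaluesX i : pvalues (x i).
Proof. by exists (mpolyX k (mnm1 i)); rewrite pevalX. Qed.
Lemma pvaluesD a b : pvalues a -> pvalues b -> pvalues (a + b).
Proof. by move=> [p <-] [q <-]; exists (p + q); rewrite pevalD. Qed.
Lemma pvaluesM a b : pvalues a -> pvalues b -> pvalues (a * b).
Proof. by move=> [p <-] [q <-]; exists (p * q); rewrite pevalM. Qed.

Lemma pevalN p : peval c x (- p) = - peval c x p.
Proof. by apply/eqP; rewrite -addr_eq0 -pevalD addNr peval0. Qed.
Lemma pevalB p q : peval c x (p - q) = peval c x p - peval c x q.
Proof. by rewrite pevalD pevalN. Qed.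
Lemma peval1 : peval c x 1 = 1.
Proof. by rewrite -(mpolyC1 n k) pevalC rmorph1. Qed.

Lemma pvalues_peval m (y : 'I_m -> A) q : (forall j, pvalues (y j)) ->
  pvalues (peval c y q).
Proof.
move=> hy; rewrite /peval; elim/big_rec: _ => [|u b _ hb]; first by exists 0; rewrite peval0.
apply: pvaluesD hb; apply: pvaluesM; first exact: pvaluesC.
elim/big_rec: _ => [|i d _ hb']; first by exists 1; rewrite peval1.
apply: pvaluesM hb'; elim: (u i) => [|e IH]; first by exists 1; rewrite expr0 peval1.
by rewrite exprS; apply: pvaluesM.
Qed.

End PevalMorphism.

Section Germs.
Variable R : realType.
Local Notation C := R[i].
Local Notation K := (laurent R).

(** Germs at the puncture are taken along an ultrafilter, not along all small
    parameters, so that a germ is either 0 or invertible. *)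
Record place (S : Type) := Place {
  pl_filter : set_system S;
  pl_t : S -> C;
  pl_ultra : UltraFilter pl_filter;
  pl_to0 : to0 pl_filter pl_t
}.

Variables (S : Type) (E : place S).
Local Notation F := (pl_filter E).
Local Notation t := (pl_t E).
Let FU : UltraFilter F := pl_ultra E.
Local Existing Instance FU.

Definition germ_class (a : S -> C) : set (S -> C) := [set b | F [set s | a s = b s]].

(** A germ is the set of all its representatives, so that functions that agree along
    the ultrafilter have equal germs. *)
Record germ := Germ {
  germ_set : set (S -> C);
  germ_setP : exists a, germ_set = germ_class a
}.

HB.instance Definition _ := gen_eqMixin germ.
HB.instance Definition _ := gen_choiceMixin germ.

Definition germ_of a : germ := @Germ (germ_class a) (ex_intro _ a erefl).
Definition germ_repr (x : germ) : S -> C := sval (cid (germ_setP x)).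

Lemma germ_ofP a b : germ_of a = germ_of b <-> F [set s | a s = b s].
Proof.
split=> [[h]|h].
  have : germ_class b b by rewrite /germ_class /=; apply: filterE.
  by rewrite -h.
have h1 : germ_class a = germ_class b.
  apply/seteqP; split=> c; rewrite /germ_class /= => h2; apply: filterS2 h h2 => s /= -> //.
rewrite /germ_of; move: (ex_intro _ _ _) (ex_intro _ _ _); rewrite h1 => p q.
by congr Germ; exact: Prop_irrelevance.
Qed.

Lemma germ_reprK x : germ_of (germ_repr x) = x.
Proof.
case: x => X p; rewrite /germ_repr /germ_of /=; case: cid => a /= e; subst X.
by congr Germ; exact: Prop_irrelevance.
Qed.

Lemma germ_repr_of a : F [set s | germ_repr (germ_of a) s = a s].
Proof. by apply/germ_ofP; rewrite germ_reprK. Qed.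

Definition germ_map (f : C -> C) x := germ_of (f \o germ_repr x).
Definition germ_map2 (f : C -> C -> C) x y :=
  germ_of (fun s => f (germ_repr x s) (germ_repr y s)).

Lemma germ_mapE f a : germ_map f (germ_of a) = germ_of (f \o a).
Proof. by apply/germ_ofP; apply: filterS (germ_repr_of a) => s /= ->. Qed.
Lemma germ_map2E f a b : germ_map2 f (germ_of a) (germ_of b) = germ_of (fun s => f (a s) (b s)).
Proof.
by apply/germ_ofP; apply: filterS2 (germ_repr_of a) (germ_repr_of b) => s /= -> ->.
Qed.

Definition germ0 := germ_of (fun=> 0).
Definition germ1 := germ_of (fun=> 1).
Definition germN := germ_map -%R.
Definition germV := germ_map GRing.inv.
Definition germD := germ_map2 +%R.
Definition germM := germ_map2 *%R.

Lemma germ_ex (x : germ) : exists a, x = germ_of a.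
Proof. by exists (germ_repr x); rewrite germ_reprK. Qed.

Ltac germ_tac := repeat
  (let x := fresh in let a := fresh in move=> x; have [a ->] := germ_ex x);
  rewrite ?/germD ?/germM ?/germN ?/germV ?/germ0 ?/germ1 ?germ_mapE ?germ_map2E;
  congr germ_of; apply/funext => ? /=.

Fact germDA : associative germD. Proof. by germ_tac; rewrite addrA. Qed.
Fact germDC : commutative germD. Proof. by germ_tac; rewrite addrC. Qed.
Fact germ0D : left_id germ0 germD. Proof. by germ_tac; rewrite add0r. Qed.
Fact germND : left_inverse germ0 germN germD. Proof. by germ_tac; rewrite addNr. Qed.

HB.instance Definition _ := GRing.isZmodule.Build germ germDA germDC germ0D germND.

Fact germMA : associative germM. Proof. by germ_tac; rewrite mulrA. Qed.
Fact germMC : commutative germM. Proof. by germ_tac; rewrite mulrC. Qed.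
Fact germ1M : left_id germ1 germM. Proof. by germ_tac; rewrite mul1r. Qed.
Fact germMDl : left_distributive germM germD. Proof. by germ_tac; rewrite mulrDl. Qed.
Fact germ10 : germ1 != germ0.
Proof.
apply/eqP => /germ_ofP /filter_ex[s /= /eqP]; by rewrite oner_eq0.
Qed.

HB.instance Definition _ := GRing.Zmodule_isComNzRing.Build germ
  germMA germMC germ1M germMDl germ10.

Fact germVM x : x != 0 -> germM (germV x) x = 1.
Proof.
have [a ->] := germ_ex x => a0; rewrite /germM /germV germ_mapE germ_map2E.
apply/germ_ofP.
(* a function that is not eventually 0 is eventually nonzero, by maximality *)
have : F (~` [set s | a s = 0]).
  by apply: ultra_setVsetC => h; move/eqP: a0; apply; apply/germ_ofP.
by apply: filterS => s /= /eqP h; rewrite mulVf.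
Qed.
Fact germV0 : germV 0 = 0.
Proof. by rewrite [LHS]germ_mapE; congr germ_of; apply/funext => s /=; rewrite invr0. Qed.

HB.instance Definition _ := GRing.ComNzRing_isField.Build germ germVM germV0.

Lemma germ_of0 : germ_of (fun=> 0) = 0. Proof. by []. Qed.
Lemma germ_of1 : germ_of (fun=> 1) = 1. Proof. by []. Qed.
Lemma germ_ofD a b : germ_of (fun s => a s + b s) = germ_of a + germ_of b.
Proof. by rewrite [RHS]germ_map2E. Qed.
Lemma germ_ofM a b : germ_of (fun s => a s * b s) = germ_of a * germ_of b.
Proof. by rewrite [RHS]germ_map2E. Qed.

Lemma germ_ofV a : germ_of (fun s => (a s)^-1) = (germ_of a)^-1.
Proof. by rewrite [RHS]germ_mapE. Qed.
Lemma germ_ofX a n : germ_of (fun s => a s ^+ n) = germ_of a ^+ n.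
Proof.
elim: n => [|n IH]; first by rewrite expr0.
by rewrite exprS -IH -germ_ofM; congr germ_of; apply/funext => s; rewrite exprS.
Qed.
Lemma germ_of_sum (I : Type) (r : seq I) (a : I -> S -> C) :
  germ_of (fun s => \sum_(i <- r) a i s) = \sum_(i <- r) germ_of (a i).
Proof.
elim: r => [|i r IH]; first by rewrite big_nil -germ_of0; congr germ_of; apply/funext => s; rewrite big_nil.
by rewrite big_cons -IH -germ_ofD; congr germ_of; apply/funext => s; rewrite big_cons.
Qed.
Lemma germ_of_prod (I : Type) (r : seq I) (a : I -> S -> C) :
  germ_of (fun s => \prod_(i <- r) a i s) = \prod_(i <- r) germ_of (a i).
Proof.
elim: r => [|i r IH]; first by rewrite big_nil -germ_of1; congr germ_of; apply/funext => s; rewrite big_nil.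
by rewrite big_cons -IH -germ_ofM; congr germ_of; apply/funext => s; rewrite big_cons.
Qed.

(** The field of germs is an extension of K, since an identity between Laurent
    series holds at all small parameters. *)
Definition germ_laurent (f : K) : germ := germ_of (fun s => laurent_eval (t s) f).

Lemma germ_near0 (a b : C -> C) : near0 (fun z => a z = b z) ->
  germ_of (a \o t) = germ_of (b \o t).
Proof. by move=> h; apply/germ_ofP; exact: (to0_near0 (pl_to0 E) h). Qed.

Fact germ_laurentD f g : germ_laurent (f + g) = germ_laurent f + germ_laurent g.
Proof. by rewrite -germ_ofD; exact: (germ_near0 (laurent_evalD f g)). Qed.
Fact germ_laurent_zmod : zmod_morphism germ_laurent.
Proof.
move=> f g; apply/eqP; rewrite -(addrK (germ_laurent g) (germ_laurent (f - g))).
by rewrite -germ_laurentD subrK.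
Qed.
Fact germ_laurent_monoid : monoid_morphism germ_laurent.
Proof.
split; first by exact: (germ_near0 (laurent_eval_const 1)).
by move=> f g; rewrite -germ_ofM; exact: (germ_near0 (laurent_evalM f g)).
Qed.

HB.instance Definition _ := GRing.isZmodMorphism.Build K germ germ_laurent germ_laurent_zmod.
HB.instance Definition _ := GRing.isMonoidMorphism.Build K germ germ_laurent germ_laurent_monoid.

Lemma germ_poly_at n (p : mpoly n K) (x : S -> 'rV[C]_n) :
  germ_of (fun s => poly_at (t s) p (x s)) =
    peval germ_laurent (fun i => germ_of (fun s => x s 0 i)) p.
Proof.
rewrite /poly_at /peval germ_of_sum; apply: eq_bigr => m _; rewrite germ_ofM.
congr (_ * _); rewrite germ_of_prod; apply: eq_bigr => i _; exact: germ_ofX.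
Qed.

Lemma germ_poly_at0 n (p : mpoly n K) (x : S -> 'rV[C]_n) :
  F [set s | poly_at (t s) p (x s) = 0] <->
    peval germ_laurent (fun i => germ_of (fun s => x s 0 i)) p = 0.
Proof. by rewrite -germ_poly_at -germ_of0 germ_ofP. Qed.

End Germs.

(** * Values of sections at a point of a scheme *)

Section Invertibility.
Variables (k : fieldType) (X : ringed_space k).
Implicit Types (U V W : set X) (x : X).

Lemma restr_irr U V (h h' : V `<=` U) (f : sect U) : restr h f = restr h' f.
Proof. by rewrite (Prop_irrelevance h h'). Qed.

Lemma invertible_restr U V (h : V `<=` U) (f : sect U) x : open V -> V x ->
  invertible_at (restr h f) x <-> invertible_at f x.
Proof.
move=> oV Vx; split=> [[W [hW [oW Wx [g hg]]]]|[W [hW [oW Wx [g hg]]]]].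
  have h' : W `<=` U by move=> y /hW/h.
  by exists W, h'; split=> //; exists g; rewrite -(restr_comp h hW).
have h' : W `&` V `<=` V by [].
exists (W `&` V), h'; split=> //; first exact: openI.
exists (restr (@subIsetl _ W V) g).
rewrite (restr_comp _ h' (subset_trans (@subIsetl _ W V) hW)).
by rewrite -(restr_comp hW (@subIsetl _ W V)) -rmorphM hg rmorph1.
Qed.

Lemma invertibleM U (f g : sect U) x :
  invertible_at (f * g) x <-> invertible_at f x /\ invertible_at g x.
Proof.
split=> [[W [hW [oW Wx [u hu]]]]|[[W [hW [oW Wx [u hu]]]] [V [hV [oV Vx [v hv]]]]]].
  rewrite rmorphM in hu.
  split; exists W, hW; split=> //.
    by exists (restr hW g * u); rewrite mulrA.
  by exists (restr hW f * u); rewrite mulrCA mulrA.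
have h : W `&` V `<=` U by move=> y [/hW].
exists (W `&` V), h; split=> //; first exact: openI.
exists (restr (@subIsetl _ W V) u * restr (@subIsetr _ W V) v).
rewrite rmorphM -(restr_comp hW (@subIsetl _ W V) h) -(restr_comp hV (@subIsetr _ W V) h).
by rewrite mulrACA -!rmorphM hu hv !rmorph1 mulr1.
Qed.

Lemma principal_open_open U (f : sect U) : open (principal_open f).
Proof.
rewrite openE => x [W [hW [oW Wx hg]]]; rewrite /interior.
apply: filterS (open_nbhs_nbhs (conj oW Wx)) => y Wy.
by exists W, hW.
Qed.

Lemma principal_openM U (f g : sect U) :
  principal_open (f * g) = principal_open f `&` principal_open g.
Proof. by apply/seteqP; split=> x /=; rewrite /principal_open/= invertibleM. Qed.

Lemma affine_open U : is_affine U -> open U. Proof. by case. Qed.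

End Invertibility.

Section Points.
Variables (k : fieldType) (X : ringed_space k) (F : fieldType).
Implicit Types (U V W : set X) (x : X).

(** What ring morphisms to a field and absolute values have in common: enough
    to have a prime kernel and to extend to fractions. *)
Definition mpoint U (mu : sect U -> F) :=
  [/\ mu 0 = 0, mu 1 = 1, (forall f g, mu (f * g) = mu f * mu g) &
      (forall f g, mu f = 0 -> mu g = 0 -> mu (f + g) = 0)].

(** The kernel of [mu] is the prime ideal of the point [x]. *)
Definition centered U (mu : sect U -> F) x :=
  U x /\ forall f, mu f = 0 <-> ~ invertible_at f x.

Lemma mpoint_prime U (mu : sect U -> F) : mpoint mu -> prime_ideal [set f | mu f = 0].
Proof.
move=> [m0 m1 mM mD]; split=> //=.
- by rewrite m1; apply/eqP; rewrite oner_eq0.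
- by move=> a b hb; rewrite mM hb mulr0.
- by move=> a b /eqP; rewrite mM mulf_eq0 => /orP[/eqP|/eqP]; [left|right].
Qed.

Lemma center_ex U (mu : sect U -> F) : is_affine U -> mpoint mu ->
  exists x, centered mu x.
Proof.
move=> [_ h _ _] /mpoint_prime/h[x [[Ux hx] _]]; exists x; split=> // f.
by have /(congr1 (fun A => A f))/= -> := hx.
Qed.

Lemma center_uniq U (mu : sect U -> F) x y : is_affine U -> mpoint mu ->
  centered mu x -> centered mu y -> x = y.
Proof.
move=> [_ h _ _] /mpoint_prime/h[z [_ hz]] [Ux hx] [Uy hy].
have e (w : X) : U w -> (forall f, mu f = 0 <-> ~ invertible_at f w) -> z = w.
  move=> Uw hw; apply: hz; split=> //; apply/seteqP; split=> f /=; by rewrite hw.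
by rewrite -(e x)// -(e y).
Qed.

Lemma centered_neq0 U (mu : sect U -> F) x f : centered mu x ->
  mu f != 0 <-> invertible_at f x.
Proof.
move=> [_ h]; split=> [/eqP hf|hf]; last by apply/eqP => /h.
by apply: contrapT => /h.
Qed.

Lemma mpointX U (mu : sect U -> F) f n : mpoint mu -> mu (f ^+ n) = mu f ^+ n.
Proof.
move=> [_ m1 mM _]; elim: n => [|n IH]; first by rewrite !expr0.
by rewrite !exprS mM IH.
Qed.

Section Extension.
Variables (U : set X) (mu : sect U -> F).

Let fin (f : sect U) := principal_open_sub (f := f).

(** [h = a / f ^ n] on a principal open that contains the center of [mu]. *)
Definition fraction_at W (h : sect W) f a n := exists hs : principal_open f `<=` W,
  mu f != 0 /\ restr (@fin f) a = restr hs h * restr (@fin f) f ^+ n.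

Definition stalk_rel W (h : sect W) c :=
  exists f a n, fraction_at h f a n /\ c = mu a / mu f ^+ n.

Definition stalk_eval W (h : sect W) : F := xget 0 [set c | stalk_rel h c].

Variable x : X.
Hypotheses (aU : is_affine U) (hmu : mpoint mu) (cx : centered mu x).

(** Equal fractions satisfy a cross relation after multiplication by a power of the
    denominators, which [mu] does not send to 0. *)
Lemma fraction_uniq W (h : sect W) f a n f' a' n' :
  fraction_at h f a n -> fraction_at h f' a' n' -> mu a / mu f ^+ n = mu a' / mu f' ^+ n'.
Proof.
move=> [hs [mf ha]] [hs' [mf' ha']]; have [_ _ _ haff] := aU.
have [_ m1 mM _] := hmu.
pose e := f * f'.
have h1 : principal_open e `<=` principal_open f by rewrite principal_openM; exact: subIsetl.
have h2 : principal_open e `<=` principal_open f' by rewrite principal_openM; exact: subIsetr.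
have h3 : principal_open e `<=` W by move=> y /h1/hs.
have e1 u : restr (@fin e) u = restr h1 (restr (@fin f) u) by rewrite (restr_comp _ h1 (@fin e)).
have e2 u : restr (@fin e) u = restr h2 (restr (@fin f') u) by rewrite (restr_comp _ h2 (@fin e)).
have ea : restr (@fin e) a = restr h3 h * restr (@fin e) f ^+ n.
  by rewrite !e1 ha rmorphM rmorphXn (restr_comp _ h1 h3).
have ea' : restr (@fin e) a' = restr h3 h * restr (@fin e) f' ^+ n'.
  by rewrite !e2 ha' rmorphM rmorphXn (restr_comp _ h2 h3).
have : restr (@fin e) (a * f' ^+ n' - a' * f ^+ n) = 0.
  by rewrite rmorphB !rmorphM !rmorphXn ea ea' mulrAC subrr.
have [_ hz] := haff e; move=> /hz[m]; rewrite mulrBr => /eqP; rewrite subr_eq0 => /eqP.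
move=> /(congr1 mu); rewrite !mM !mpointX// mM.
have em : (mu f * mu f') ^+ m != 0 by rewrite expf_neq0// mulf_neq0.
move=> /(mulfI em) hh; apply/eqP; rewrite eqr_div ?expf_neq0//; exact/eqP.
Qed.

(** The center has a principal neighborhood inside [W]. Two sections are written with
    one denominator because sums have to be evaluated. *)
Lemma fraction_ex W (h1 h2 : sect W) : open W -> W x ->
  exists f a1 a2 n, fraction_at h1 f a1 n /\ fraction_at h2 f a2 n.
Proof.
move=> oW Wx; have [oU _ hb haff] := aU; have [Ux _] := cx.
have [||//|f fx fs] := hb (W `&` U) x; [exact: openI|exact: subIsetr|].
have hs : principal_open f `<=` W by move=> y /fs[].
have mf : mu f != 0 by apply/(centered_neq0 _ cx).
have [hfr _] := haff f.
have [a1 [n1 e1]] := hfr (restr hs h1); have [a2 [n2 e2]] := hfr (restr hs h2).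
exists f, (a1 * f ^+ n2), (a2 * f ^+ n1), (n1 + n2)%N.
split; exists hs; split=> //; rewrite rmorphM rmorphXn ?e1 ?e2 -mulrA -exprD//.
by rewrite addnC.
Qed.

Lemma stalk_eval_eq W (h : sect W) f a n : fraction_at h f a n ->
  stalk_eval h = mu a / mu f ^+ n.
Proof.
move=> hf; rewrite /stalk_eval; case: xgetP => [c -> /=|/(_ (mu a / mu f ^+ n))/=].
  by move=> [f' [a' [n' [h' ->]]]]; exact: fraction_uniq h' hf.
by move=> hn; exfalso; apply: hn; exists f, a, n.
Qed.

Lemma stalk_eval_self (h : sect U) : stalk_eval h = mu h.
Proof.
have [_ m1 _ _] := hmu.
rewrite (@stalk_eval_eq _ _ 1 h 0%N); first by rewrite expr0 divr1.
by exists (@fin 1); rewrite m1 oner_eq0 expr0 mulr1.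
Qed.

Lemma stalk_eval_restr W W' (s : W' `<=` W) (h : sect W) : open W' -> W' x ->
  stalk_eval (restr s h) = stalk_eval h.
Proof.
move=> oW Wx; have [f [a [_ [n [hf _]]]]] := fraction_ex (restr s h) 0 oW Wx.
rewrite (stalk_eval_eq hf); symmetry; apply: stalk_eval_eq.
have [hs [mf e]] := hf; exists (subset_trans hs s); split=> //.
by rewrite e (restr_comp _ hs (subset_trans hs s)).
Qed.

Section OnOpen.
Variables (W : set X) (oW : open W) (Wx : W x).
Implicit Types h : sect W.

Lemma stalk_evalD_ex h1 h2 : exists a1 a2 b, [/\ mu b != 0, stalk_eval h1 = mu a1 / mu b,
  stalk_eval h2 = mu a2 / mu b & stalk_eval (h1 + h2) = mu (a1 + a2) / mu b].
Proof.
have [f [a1 [a2 [n [f1 f2]]]]] := fraction_ex h1 h2 oW Wx.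
exists a1, a2, (f ^+ n); rewrite mpointX//.
split; [|exact: stalk_eval_eq f1|exact: stalk_eval_eq f2|].
  by rewrite expf_neq0//; case: f1 => hs [].
apply: stalk_eval_eq; have [hs [mf e1]] := f1; have [hs' [_ e2]] := f2.
by exists hs; split=> //; rewrite !rmorphD e1 e2 mulrDl (restr_irr hs' hs).
Qed.

Lemma stalk_evalM h1 h2 : stalk_eval (h1 * h2) = stalk_eval h1 * stalk_eval h2.
Proof.
have [f [a1 [a2 [n [f1 f2]]]]] := fraction_ex h1 h2 oW Wx.
rewrite (stalk_eval_eq f1) (stalk_eval_eq f2).
have [_ _ mM _] := hmu.
have [hs [mf e1]] := f1; have [hs' [_ e2]] := f2.
rewrite (@stalk_eval_eq _ _ f (a1 * a2) (n + n)); first by rewrite mM mulf_div exprD.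
by exists hs; split=> //; rewrite !rmorphM e1 e2 (restr_irr hs' hs) exprD mulrACA.
Qed.

Lemma stalk_eval1 : stalk_eval (1 : sect W) = 1.
Proof.
have -> : (1 : sect W) = restr (@subset_refl _ W) 1 by rewrite rmorph1.
have h : W `&` U `<=` W by exact: subIsetl.
have h' : W `&` U `<=` U by exact: subIsetr.
have [Ux _] := cx; have oWU : open (W `&` U) by apply: openI => //; exact: affine_open.
rewrite rmorph1 -(stalk_eval_restr h 1 oWU)// rmorph1 -(rmorph1 (restr h')).
by rewrite stalk_eval_restr// stalk_eval_self; case: hmu.
Qed.

Lemma stalk_eval0 : stalk_eval (0 : sect W) = 0.
Proof.
have h : W `&` U `<=` W by exact: subIsetl.
have h' : W `&` U `<=` U by exact: subIsetr.
have [Ux _] := cx; have oWU : open (W `&` U) by apply: openI => //; exact: affine_open.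
rewrite -(stalk_eval_restr h 0 oWU)// rmorph0 -(rmorph0 (restr h')).
by rewrite stalk_eval_restr// stalk_eval_self; case: hmu.
Qed.

Lemma stalk_eval_mpoint : mpoint (@stalk_eval W).
Proof.
split; [exact: stalk_eval0|exact: stalk_eval1|exact: stalk_evalM|].
move=> h1 h2; have [a1 [a2 [c [c0 -> -> ->]]]] := stalk_evalD_ex h1 h2.
have ic : (mu c)^-1 != 0 by rewrite invr_eq0.
have [_ _ _ mD] := hmu.
move=> /eqP; rewrite mulf_eq0 (negPf ic) orbF => /eqP e1.
move=> /eqP; rewrite mulf_eq0 (negPf ic) orbF => /eqP e2.
by rewrite mD// mul0r.
Qed.

End OnOpen.

Lemma stalk_eval_neq0 W (h : sect W) : open W -> W x -> invertible_at h x ->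
  stalk_eval h != 0.
Proof.
move=> oW Wx [V [hV [oV Vx [g hg]]]]; rewrite -(stalk_eval_restr hV _ oV Vx).
have := stalk_evalM oV Vx (restr hV h) g; rewrite hg (stalk_eval1 oV Vx) => e.
by apply: contra_eq_neq e => ->; rewrite mul0r oner_eq0.
Qed.

Lemma stalk_eval_centered W : open W -> W x -> centered (@stalk_eval W) x.
Proof.
move=> oW Wx; split=> // h; split=> [h0 hi|hn].
  by have := stalk_eval_neq0 oW Wx hi; rewrite h0 eqxx.
apply/eqP/negPn/negP => hne; apply: hn.
have [f [a [_ [n [hf _]]]]] := fraction_ex h 0 oW Wx.
rewrite (stalk_eval_eq hf) in hne.
have ma : mu a != 0 by apply: contraNneq hne => ->; rewrite mul0r.
have [hs [/(centered_neq0 _ cx) mf e]] := hf.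
have oD := principal_open_open f.
rewrite -(invertible_restr hs h oD mf).
move/(centered_neq0 _ cx): ma; rewrite -(invertible_restr (@fin f) a oD mf) e.
by move=> /invertibleM[].
Qed.

End Extension.

End Points.

(** * Points over the field of germs *)

Section GlobalPoints.
Variables (k : fieldType) (X : ringed_space k) (F : fieldType).

(** A point of the scheme together with a value at it for every section
    defined near it: independent of the choice of an affine neighborhood. *)
Record gpoint := GPoint {
  gx : X;
  gev : forall W : set X, sect W -> F;
  gev_mpoint : forall W, open W -> W gx -> mpoint (@gev W);
  gev_centered : forall W, open W -> W gx -> centered (@gev W) gx;
  gev_restr : forall W W' (s : W' `<=` W) (h : sect W), open W' -> W' gx ->
    gev (restr s h) = gev h
}.

(** The point is the center of [mu], and the values are those of fractions. *)
Lemma gpoint_of (U : set X) (mu : sect U -> F) : is_affine U -> mpoint mu ->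
  exists P : gpoint, U (gx P) /\ gev P (W := U) =1 mu.
Proof.
move=> aU hmu; have [x cx] := center_ex aU hmu.
exists (GPoint (stalk_eval_mpoint aU hmu cx) (stalk_eval_centered aU hmu cx)
  (stalk_eval_restr aU hmu cx)).
by split; [case: cx|move=> h; exact: stalk_eval_self].
Qed.

(** Near the center every section is a fraction of sections of [U], so the values on
    [U] determine all others. *)
Lemma gev_stalk (P : gpoint) (U W : set X) : is_affine U -> U (gx P) ->
  open W -> W (gx P) -> gev P (W := W) =1 @stalk_eval _ _ _ U (gev P (W := U)) W.
Proof.
move=> aU Ux oW Wx h; have oU := affine_open aU.
have hm := gev_mpoint oU Ux; have hc := gev_centered oU Ux.
have [f [a [_ [n [hf _]]]]] := fraction_ex aU hc h 0 oW Wx.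
rewrite (stalk_eval_eq aU hm hf); have [hs [nf ef]] := hf.
have fx : principal_open f (gx P) by exact: (proj1 (centered_neq0 _ hc) nf).
have oD := principal_open_open f.
have := congr1 (@gev P _) ef; have hmD := gev_mpoint oD fx.
have [_ _ mM _] := hmD.
rewrite mM (mpointX _ _ hmD) !gev_restr// => ->.
by rewrite mulfK// expf_neq0.
Qed.

Lemma gpoint_ext (P Q : gpoint) (U : set X) : is_affine U -> U (gx P) -> U (gx Q) ->
  gev P (W := U) =1 gev Q (W := U) ->
  gx P = gx Q /\ forall W, open W -> W (gx P) -> gev P (W := W) =1 gev Q (W := W).
Proof.
move=> aU UP UQ e; have oU := affine_open aU.
have {}e : gev P (W := U) = gev Q (W := U) by apply/funext.
have exy : gx P = gx Q.
  have hc := gev_centered oU UQ; rewrite -e in hc.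
  exact: (center_uniq aU (gev_mpoint oU UP) (gev_centered oU UP) hc).
split=> // W oW Wx h; rewrite (gev_stalk aU UP oW Wx) e.
by rewrite (gev_stalk aU UQ oW)// -exy.
Qed.

(** The property passes from [U] to fractions with a common denominator. *)
Lemma gevD (P : gpoint) (U : set X) : is_affine U -> U (gx P) ->
  (forall a b : sect U, gev P (a + b) = gev P a + gev P b) ->
  forall W, open W -> W (gx P) -> forall a b : sect W, gev P (a + b) = gev P a + gev P b.
Proof.
move=> aU UP e W oW Wx a b; have oU := affine_open aU.
rewrite !(gev_stalk aU UP oW Wx).
have [a1 [a2 [c [c0 -> -> ->]]]] :=
  stalk_evalD_ex aU (gev_mpoint oU UP) (gev_centered oU UP) oW Wx a b.
by rewrite e mulrDl.
Qed.

Lemma gev_scal (P : gpoint) (U : set X) c : open U -> U (gx P) ->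
  forall W, open W -> W (gx P) -> gev P (scal W c) = gev P (scal U c).
Proof.
move=> oU UP W oW Wx.
have oUW := openI oU oW.
rewrite -(gev_restr (@subIsetl _ U W) _ oUW (conj UP Wx)) restr_scal.
by rewrite -(gev_restr (@subIsetr _ U W) _ oUW (conj UP Wx)) restr_scal.
Qed.

Lemma gevM (P : gpoint) W (a b : sect W) : open W -> W (gx P) ->
  gev P (a * b) = gev P a * gev P b.
Proof. by move=> oW Wx; have [] := gev_mpoint oW Wx. Qed.

Lemma gevX (P : gpoint) W (a : sect W) n : open W -> W (gx P) ->
  gev P (a ^+ n) = gev P a ^+ n.
Proof. by move=> oW Wx; rewrite (mpointX _ _ (gev_mpoint oW Wx)). Qed.

Lemma gev1 (P : gpoint) W : open W -> W (gx P) -> gev P (1 : sect W) = 1.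
Proof. by move=> oW Wx; have [] := gev_mpoint oW Wx. Qed.

Lemma gev0 (P : gpoint) W : open W -> W (gx P) -> gev P (0 : sect W) = 0.
Proof. by move=> oW Wx; have [] := gev_mpoint oW Wx. Qed.

Lemma gev_neq0 (P : gpoint) W (a : sect W) : open W -> W (gx P) ->
  gev P a != 0 <-> principal_open a (gx P).
Proof. by move=> oW Wx; apply: centered_neq0; exact: gev_centered. Qed.

End GlobalPoints.

Lemma peval_hom (k : fieldType) (A B : comPzRingType) (f : A -> B) n (c : k -> A)
    (x : 'I_n -> A) p : f 0 = 0 -> f 1 = 1 -> {morph f : a b / a + b} ->
  {morph f : a b / a * b} -> f (peval c x p) = peval (f \o c) (f \o x) p.
Proof.
move=> f0 f1 fD fM; rewrite /peval (big_morph f fD f0); apply: eq_bigr => m _.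
rewrite fM; congr (_ * _); rewrite (big_morph f fM f1); apply: eq_bigr => i _ /=.
by elim: (m i) => [|e IH]; rewrite ?expr0// !exprS fM IH.
Qed.

Section GermPoints.
Variables (R : realType) (X : ringed_space (laurent R)).
Local Notation C := R[i].
Local Notation K := (laurent R).
Hypothesis sepX : Defs.separated X.
Variables (S : Type) (E : place R S).
Local Notation F := (pl_filter E).
Local Notation t := (pl_t E).
Let FU : UltraFilter F := pl_ultra E.
Local Existing Instance FU.
Local Notation row y := (fun i => germ_of E (fun s => y s 0 i)).

Definition ring_gpoint (P : gpoint X (germ E)) :=
  (forall W, open W -> W (gx P) -> forall a b : sect W, gev P (a + b) = gev P a + gev P b) /\
  (forall W c, open W -> W (gx P) -> gev P (scal W c) = germ_laurent E c).

Lemma ring_gpoint_peval P : ring_gpoint P -> forall W n (w : 'I_n -> sect W) p,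
  open W -> W (gx P) ->
  gev P (peval (scal W) w p) = peval (germ_laurent E) (fun l => gev P (w l)) p.
Proof.
move=> [hD hs] W n w p oW Wx; rewrite (@peval_hom _ _ _ (@gev _ _ _ P W)).
- by apply: eq_peval => c //=; rewrite hs.
- exact: gev0.
- exact: gev1.
- exact: hD.
- by move=> a b; rewrite gevM.
Qed.

(** A family of coordinates that satisfies each equation of [W] along the
    ultrafilter is a ring morphism from the sections of [W] to the field of germs.
    Each equation may hold on its own set of the ultrafilter. *)
Lemma gpoint_of_coords (W : set X) n (w : 'I_n -> sect W) (y : S -> 'rV[C]_n) :
  is_affine W -> generates w ->
  (forall p, peval (scal W) w p = 0 -> F [set s | poly_at (t s) p (y s) = 0]) ->
  exists P : gpoint X (germ E), [/\ ring_gpoint P, W (gx P) &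
    forall l, gev P (w l) = germ_of E (fun s => y s 0 l)].
Proof.
move=> aW hw hy; have oW := affine_open aW.
have sel h : exists p, peval (scal W) w p = h by exact: hw.
pose phi h := peval (germ_laurent E) (row y) (sval (cid (sel h))).
have phiE p : phi (peval (scal W) w p) = peval (germ_laurent E) (row y) p.
  rewrite /phi; case: cid => q /= e; apply/eqP; rewrite -subr_eq0 -pevalB.
  by apply/eqP/germ_poly_at0; apply: hy; rewrite pevalB e subrr.
have phi0 : phi 0 = 0 by rewrite -(peval0 (scal W) w) phiE peval0.
have phi1 : phi 1 = 1 by rewrite -(peval1 (scal W) w) phiE peval1.
have phiD a b : phi (a + b) = phi a + phi b.
  by have [p <-] := sel a; have [q <-] := sel b; rewrite -pevalD !phiE pevalD.
have phiM a b : phi (a * b) = phi a * phi b.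
  by have [p <-] := sel a; have [q <-] := sel b; rewrite -pevalM !phiE pevalM.
have hphi : mpoint phi.
  split; [exact: phi0|exact: phi1|exact: phiM|].
  by move=> a b ha hb; rewrite phiD ha hb addr0.
have [P [Wx eP]] := gpoint_of aW hphi; exists P; split=> //.
  split; first by apply: gevD Wx _ => // a b; rewrite !eP.
  move=> V c oV Vx; rewrite (gev_scal c oW Wx oV Vx) eP.
  by rewrite -(pevalC (scal W) w) phiE pevalC.
by move=> l; rewrite eP -(pevalX (scal W) w) phiE pevalX.
Qed.

Definition at_chart (P : gpoint X (germ E)) (c : affine_chart X) (x : S -> 'rV[C]_(dim c)) :=
  dom c (gx P) /\ forall l, gev P (coord (a := c) l) = germ_of E (fun s => x s 0 l).

Lemma at_chart_peval P c x p : ring_gpoint P -> at_chart P x ->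
  gev P (peval (scal (dom c)) (@coord _ _ c) p) = germ_of E (fun s => poly_at (t s) p (x s)).
Proof.
move=> hP [cx hx]; rewrite (ring_gpoint_peval hP)//; last exact: (affine_open (dom_affine c)).
by rewrite germ_poly_at; apply: eq_peval.
Qed.

Lemma at_chart_ex P c : dom c (gx P) -> exists x, at_chart P (c := c) x.
Proof.
move=> cx; exists (fun s => \row_l germ_repr (gev P (coord (a := c) l)) s); split=> // l.
by rewrite -[LHS]germ_reprK; congr germ_of; apply/funext => s; rewrite mxE.
Qed.

Lemma chart_gpoint c (x : S -> 'rV[C]_(dim c)) :
  (forall p, peval (scal (dom c)) (@coord _ _ c) p = 0 -> F [set s | poly_at (t s) p (x s) = 0]) ->
  exists2 P, ring_gpoint P & at_chart P x.
Proof.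
move=> h; have [P [hP cx e]] := gpoint_of_coords (dom_affine c) (@coord_generates _ _ c) h.
by exists P.
Qed.

Lemma at_chart_kernel P c (x : S -> 'rV[C]_(dim c)) : ring_gpoint P -> at_chart P x ->
  forall p, peval (scal (dom c)) (@coord _ _ c) p = 0 -> F [set s | poly_at (t s) p (x s) = 0].
Proof.
move=> hP hx p p0; apply/(germ_ofP E (fun s => poly_at (t s) p (x s)) (fun=> 0)).
rewrite -(at_chart_peval p hP hx) p0 gev0 ?germ_of0//; last by case: hx.
exact: (affine_open (dom_affine c)).
Qed.

Lemma at_chart_near P c (x y : S -> 'rV[C]_(dim c)) : at_chart P x -> at_chart P y ->
  F [set s | x s = y s].
Proof.
move=> [_ hx] [_ hy].
have : F [set s | forall l, x s 0 l = y s 0 l].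
  apply: filter_forall => l; apply/(germ_ofP E (fun s => x s 0 l) (fun s => y s 0 l)).
  by rewrite -hx -hy.
by apply: filterS => s /= h; apply/rowP.
Qed.

(** By separation the sections on the overlap are spanned by products of a section of
    one chart and a section of the other. *)
Lemma overlap_coord_gen (c d : affine_chart X) : generates (@overlap_coord _ _ c d).
Proof.
move=> h; have [_ /(_ h)[n [f [g ->]]]] := sepX (dom_affine c) (dom_affine d).
have hl l : pvalues (scal (dom c `&` dom d)) (@overlap_coord _ _ c d)
    (restr (@subIsetl _ (dom c) (dom d)) (coord l)).
  have -> : restr (@subIsetl _ (dom c) (dom d)) (coord l) =
      overlap_coord (lshift (dim d) l).
    by rewrite /overlap_coord; case: splitP => j /= e; [congr (restr _ (coord _)); apply/val_inj|
      have := ltn_ord l; rewrite e; lia].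
  exact: pvaluesX.
have hr l : pvalues (scal (dom c `&` dom d)) (@overlap_coord _ _ c d)
    (restr (@subIsetr _ (dom c) (dom d)) (coord l)).
  have -> : restr (@subIsetr _ (dom c) (dom d)) (coord l) =
      overlap_coord (rshift (dim c) l).
    rewrite /overlap_coord; case: splitP => j /= e; first by have := ltn_ord j; rewrite -e; lia.
    by congr (restr _ (coord _)); apply/val_inj => /=; lia.
  exact: pvaluesX.
suff hh (i : 'I_n) : pvalues (scal (dom c `&` dom d)) (@overlap_coord _ _ c d)
    (restr (@subIsetl _ (dom c) (dom d)) (f i) * restr (@subIsetr _ (dom c) (dom d)) (g i)).
  elim/big_rec: _ => [|i a _ ha]; last exact: pvaluesD.
  by exists 0; rewrite peval0.
have [p <-] := coord_generates (f i); have [q <-] := coord_generates (g i).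
apply: pvaluesM; rewrite peval_rmorph.
  rewrite (@eq_peval _ _ _ _ (scal (dom c `&` dom d)) _ (fun l => restr (@subIsetl _ (dom c) (dom d)) (coord l)))//.
    by apply: pvalues_peval.
  by move=> a /=; rewrite restr_scal.
rewrite (@eq_peval _ _ _ _ (scal (dom c `&` dom d)) _ (fun l => restr (@subIsetr _ (dom c) (dom d)) (coord l)))//.
  by apply: pvalues_peval.
by move=> a /=; rewrite restr_scal.
Qed.

Definition overlap_zero (c d : affine_chart X) (x : S -> 'rV[C]_(dim c))
    (y : S -> 'rV[C]_(dim d)) :=
  forall p, peval (scal (dom c `&` dom d)) (@overlap_coord _ _ c d) p = 0 ->
    F [set s | poly_at (t s) p (row_mx (x s) (y s)) = 0].

(** Together with its converse [at_chart_overlap], this gives the equations of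
    overlaps their meaning: they hold along the place exactly when [x] and [y] are
    coordinates of one point over the field of germs. *)
Lemma overlap_gpoint c d x y : @overlap_zero c d x y ->
  exists P, [/\ ring_gpoint P, at_chart P x & at_chart P y].
Proof.
move=> h; have [aW _] := sepX (dom_affine c) (dom_affine d).
have [P [hP [cx dx] e]] := gpoint_of_coords aW (@overlap_coord_gen c d) h.
have oW := affine_open aW.
exists P; split=> //; split=> // l.
  have := e (lshift (dim d) l); rewrite /overlap_coord.
  case: splitP => j /= ej; last by have := ltn_ord l; rewrite ej; lia.
  rewrite gev_restr// => eg; have -> : l = j by apply/val_inj.
  by rewrite eg; congr germ_of; apply/funext => s; rewrite row_mxEl; congr (x s 0 _); apply/val_inj.
have := e (rshift (dim c) l); rewrite /overlap_coord.
case: splitP => j /= ej; first by have := ltn_ord j; rewrite -ej; lia.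
have lj : l = j by apply/val_inj => /=; lia.
rewrite gev_restr// -lj => ->.
by congr germ_of; apply/funext => s; rewrite row_mxEr.
Qed.

Lemma at_chart_overlap P c d x y : ring_gpoint P -> at_chart P x -> at_chart P y ->
  @overlap_zero c d x y.
Proof.
move=> hP [cx hx] [dx hy] p p0.
have [aW _] := sepX (dom_affine c) (dom_affine d); have oW := affine_open aW.
have Wx : (dom c `&` dom d) (gx P) by [].
apply/germ_poly_at0.
have := ring_gpoint_peval hP (@overlap_coord _ _ c d) p oW Wx; rewrite p0 (gev0 oW Wx) => h.
rewrite [RHS]h; apply: eq_peval; [by []|move=> l].
rewrite /overlap_coord; case: splitP => j e.
  rewrite gev_restr// hx; congr germ_of; apply/funext => s.
  have -> : l = lshift _ j by apply/val_inj.
  by rewrite row_mxEl.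
rewrite gev_restr// hy; congr germ_of; apply/funext => s.
have -> : l = rshift _ j by apply/val_inj.
by rewrite row_mxEr.
Qed.

Lemma overlap_zeroP c d (G : seq (mpoly (dim c + dim d) K)) x y : overlap_equations G ->
  @overlap_zero c d x y <-> F [set s | zeros_at (t s) G (row_mx (x s) (y s))].
Proof.
move=> hG; split=> h.
  have hg g : g \in G -> F [set s | poly_at (t s) g (row_mx (x s) (y s)) = 0].
    move=> gG; apply: h; apply/hG; exists (fun i => (i == index g G :> nat)%:R).
    have ig : (index g G < size G)%N by rewrite index_mem.
    rewrite (bigD1 (Ordinal ig))//= eqxx mul1r nth_index// big1 ?addr0// => i /negPf ni.
    have -> : (i == index g G :> nat) = false by rewrite -ni.
    by rewrite mul0r.
  exact: filter_seq.
move=> p /hG[q ->]; apply/germ_poly_at0.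
elim/big_rec: _ => [|i a _ ha]; first by rewrite peval0.
rewrite pevalD ha addr0 pevalM.
have /germ_poly_at0 -> : F [set s | poly_at (t s) G`_i (row_mx (x s) (y s)) = 0].
  by apply: filterS h => s /=; apply; rewrite mem_nth.
by rewrite mulr0.
Qed.

End GermPoints.

(** * Points of the analytification as absolute values *)

Section AbsoluteValues.
Variable R : realType.
Local Notation C := R[i].
Local Notation K := (laurent R).
Implicit Types (u v : \bar R) (a b : R).

(** The inverse of [abs_semivaluation] on nonnegative numbers. *)
Definition log_value a : \bar R := if a == 0 then +oo%E else (- ln a)%:E.

Lemma abs_semivaluation_ge0 v : 0 <= abs_semivaluation v.
Proof. by rewrite /abs_semivaluation fine_ge0// expeR_ge0. Qed.

Lemma abs_log_value a : 0 <= a -> abs_semivaluation (log_value a) = a.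
Proof.
rewrite /log_value le_eqVlt => /predU1P[<-|a0]; first by rewrite eqxx /abs_semivaluation.
by rewrite gt_eqF// /abs_semivaluation /= opprK lnK.
Qed.

Lemma log_abs_value v : v != -oo%E -> log_value (abs_semivaluation v) = v.
Proof.
case: v => [r| |]//= _; rewrite /log_value /abs_semivaluation /=; last by rewrite eqxx.
by rewrite expR_eq0 expRK opprK.
Qed.

Lemma log_value_neqNy a : log_value a != -oo%E.
Proof. by rewrite /log_value; case: ifP. Qed.

Lemma abs_semivaluationD u v : u != -oo%E -> v != -oo%E ->
  abs_semivaluation (u + v) = abs_semivaluation u * abs_semivaluation v.
Proof.
case: u v => [r| |] [s| |]//= _ _; rewrite /abs_semivaluation /= ?mulr0 ?mul0r//.
by rewrite opprD expRD.
Qed.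

Lemma abs_semivaluation_le u v : u != -oo%E -> v != -oo%E ->
  (abs_semivaluation u <= abs_semivaluation v) = (v <= u)%E.
Proof.
case: u v => [r| |] [s| |]//= _ _; rewrite /abs_semivaluation /= ?lexx ?expR_ge0 ?leey//.
  by rewrite ler_expR lerN2.
by rewrite leNgt expR_gt0 leye_eq.
Qed.

Lemma abs_semivaluation_eq0 v : v != -oo%E -> abs_semivaluation v = 0 <-> v = +oo%E.
Proof.
case: v => [r| |]//= _; rewrite /abs_semivaluation /=; split=> // /eqP.
by rewrite expR_eq0.
Qed.

Lemma log_valueM a b : 0 <= a -> 0 <= b -> log_value (a * b) = (log_value a + log_value b)%E.
Proof.
move=> a0 b0; rewrite -[RHS]log_abs_value; last first.
  by rewrite /log_value; case: ifP => _; case: ifP.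
by rewrite abs_semivaluationD ?log_value_neqNy// !abs_log_value.
Qed.

Lemma log_value_le a b : 0 <= a -> 0 <= b -> (log_value a <= log_value b)%E = (b <= a).
Proof.
by move=> a0 b0; rewrite -abs_semivaluation_le ?log_value_neqNy// !abs_log_value.
Qed.

Lemma ord_zero_neqNy (c : K) : ord_zero c != -oo%E.
Proof.
have [->|c0] := eqVneq c 0; first by rewrite ord_zero0.
by have [s [cs hs]] := laurent_neq0 c0; rewrite (ord_zeroE cs hs).
Qed.

Lemma ord_zero1 : ord_zero (1 : K) = 0%E.
Proof.
have c0 : coef (1 : K) 0 = 1 by [].
have s0 : starts (1 : K) 0 by move=> k /= k0; rewrite ifF// lt_eqF.
by rewrite (ord_zeroE _ s0) ?c0 ?oner_eq0.
Qed.

End AbsoluteValues.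

Section BerkovichPoints.
Variables (R : realType) (X : ringed_space (laurent R)).
Local Notation C := R[i].
Local Notation K := (laurent R).

(** Points of the analytification, as absolute values on local sections. *)
Definition abs_gpoint (P : gpoint X R) := forall W, open W -> W (gx P) ->
  [/\ forall f : sect W, 0 <= gev P f,
      forall f g : sect W, gev P (f + g) <= Num.max (gev P f) (gev P g) &
      forall c, gev P (scal W c) = abs_semivaluation (ord_zero c)].

Lemma abs_gpoint_of (U : set X) (mu : sect U -> R) : is_affine U -> mpoint mu ->
  (forall f, 0 <= mu f) -> (forall f g, mu (f + g) <= Num.max (mu f) (mu g)) ->
  (forall c, mu (scal U c) = abs_semivaluation (ord_zero c)) ->
  exists P, [/\ abs_gpoint P, U (gx P) & gev P (W := U) =1 mu].
Proof.
move=> aU hmu h0 hD hs; have [P [UP e]] := gpoint_of aU hmu; exists P; split=> //.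
have oU := affine_open aU.
move=> W oW Wx; split.
- move=> f; rewrite (gev_stalk aU UP oW Wx).
  have [a1 [a2 [b [b0 -> _ _]]]] :=
    stalk_evalD_ex aU (gev_mpoint oU UP) (gev_centered oU UP) oW Wx f f.
  by rewrite divr_ge0// e.
- move=> f g; rewrite !(gev_stalk aU UP oW Wx).
  have [a1 [a2 [b [b0 -> -> ->]]]] :=
    stalk_evalD_ex aU (gev_mpoint oU UP) (gev_centered oU UP) oW Wx f g.
  have ib : 0 <= (gev P b)^-1 by rewrite invr_ge0 e.
  by rewrite -maxr_pMl// ler_wpM2r// !e.
- by move=> c; rewrite (gev_scal c oU UP oW Wx) e.
Qed.

Definition represents (P : gpoint X R) (v : affine_semivaluation X) :=
  sv_dom v (gx P) /\ forall f, gev P f = abs_semivaluation (@sv_fun _ _ v f).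

Lemma semivaluation_gpoint v : exists P, abs_gpoint P /\ represents P v.
Proof.
case: v => U v aU [[v1 v2] v3 v4 v5].
have [||||P [hP UP e]] := @abs_gpoint_of U (fun f => abs_semivaluation (v f)) aU.
- have vN f : v f != -oo%E by exact: v1.
  split.
  + by rewrite v2.
  + by rewrite -(rmorph1 (scal U)) v5 ord_zero1 /abs_semivaluation /= oppr0 expR0.
  + by move=> f g; rewrite v3 abs_semivaluationD.
  + move=> f g /(abs_semivaluation_eq0 (vN f)) hf /(abs_semivaluation_eq0 (vN g)) hg.
    apply/(abs_semivaluation_eq0 (vN _)).
    by have := v4 f g; rewrite hf hg minxx leye_eq => /eqP.
- by move=> f; exact: abs_semivaluation_ge0.
- have vN f : v f != -oo%E by exact: v1.
  move=> f g; rewrite le_max !abs_semivaluation_le//.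
  by have := v4 f g; rewrite ge_min.
- by move=> c; rewrite v5.
by exists P.
Qed.

Lemma semivaluation_of (P : gpoint X R) (U : set X) : abs_gpoint P -> is_affine U ->
  U (gx P) -> exists v : affine_semivaluation X, represents P v /\ sv_dom v = U.
Proof.
move=> hP aU UP; have oU := affine_open aU; have [h0 hD hs] := hP U oU UP.
have sv : semivaluation (fun f : sect U => log_value (gev P f)).
  split.
  - split; first by move=> f; exact: log_value_neqNy.
    by rewrite gev0// /log_value eqxx.
  - by move=> f g; rewrite gevM// log_valueM.
  - move=> f g; rewrite ge_min !log_value_le//.
    by have := hD f g; rewrite le_max.
  - by move=> c; rewrite hs log_abs_value// ord_zero_neqNy.
exists (AffineSemivaluation aU sv); split=> //; split=> //= f.
by rewrite abs_log_value.
Qed.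

Lemma represents_sv P v : represents P v -> forall f, sv_fun f = log_value (gev P (W := sv_dom v) f).
Proof.
move=> [_ h] f; rewrite h log_abs_value//.
by have [[h1 _] _ _ _] := sv_semival v; exact: h1.
Qed.

(** The equivalence identifying semivaluations only remembers the point of the
    scheme and the absolute values of the sections near it. *)
Lemma represents_same P v w : same_semivaluation v w -> represents P v <-> represents P w.
Proof.
suff hh (z v' : affine_semivaluation X) (hv : sv_dom z `<=` sv_dom v') :
    (forall f, sv_fun (restr hv f) = sv_fun f) -> represents P v' <-> represents P z.
  move=> [z [hv [hw [ev ew]]]]; rewrite (hh _ _ _ ev); symmetry; exact: hh ew.
move=> e; have az := sv_affine z; have av := sv_affine v'.
have oz := affine_open az; have ov := affine_open av.
split=> [[vP hP]|[zP hP]]; last first.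
  split; first exact (hv _ zP).
  by move=> f; rewrite -e -hP gev_restr.
have [Q [hQ [zQ eQ]]] := semivaluation_gpoint z.
have vQ := hv _ zQ.
have [|exy hPQ] := @gpoint_ext _ _ _ P Q _ av vP vQ.
  by move=> f; rewrite hP -e -eQ gev_restr.
split; first by rewrite exy.
by move=> f; rewrite -eQ hPQ// exy.
Qed.

Lemma represents_glue P v w : glue (@same_semivaluation _ X) v = glue (@same_semivaluation _ X) w ->
  represents P v <-> represents P w.
Proof.
move=> /eqP; rewrite /glue; move=> /eqP/eqquotP/asboolP; elim.
- by move=> x y; exact: represents_same.
- by [].
- by move=> x y _ ->.
- by move=> x y z _ -> _ ->.
Qed.

(** The overlap of the two domains is affine, and both semivaluations restrict there
    to the one given by [P]. *)
Lemma represents_glue_eq P v w : Defs.separated X -> abs_gpoint P ->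
  represents P v -> represents P w ->
  glue (@same_semivaluation _ X) v = glue (@same_semivaluation _ X) w.
Proof.
move=> sepX hP rv rw; apply/eqP; rewrite /glue; apply/eqP/eqquotP/asboolP; apply: rst_step.
have [[vP hv] [wP hw]] := (rv, rw).
have [aW _] := sepX _ _ (sv_affine v) (sv_affine w).
have [z [rz ez]] := semivaluation_of hP aW (conj vP wP).
have sv : sv_dom z `<=` sv_dom v by rewrite ez; exact: subIsetl.
have sw : sv_dom z `<=` sv_dom w by rewrite ez; exact: subIsetr.
have [zP hz] := rz; have oz := affine_open (sv_affine z).
exists z, sv, sw; split=> f.
  by rewrite (represents_sv rz) (represents_sv rv) gev_restr.
by rewrite (represents_sv rz) (represents_sv rw) gev_restr.
Qed.

Lemma berkovich_ex (b : berkovich X) : exists v, b = glue (@same_semivaluation _ X) v.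
Proof.
exists (glued_repr b); rewrite /glue /glued_repr.
by symmetry; exact: (reprK (b : {eq_quot _}%qT)).
Qed.

(** The representatives of [b] on different affine opens yield one absolute value
    on local sections, so that no affine open has to be chosen. *)
Definition berk_point (b : berkovich X) P :=
  abs_gpoint P /\ exists2 v, b = glue (@same_semivaluation _ X) v & represents P v.

Lemma berk_point_ex b : exists P, berk_point b P.
Proof.
have [v ->] := berkovich_ex b; have [P [hP rP]] := semivaluation_gpoint v.
by exists P; split=> //; exists v.
Qed.

Lemma berk_of_point P : Defs.separated X -> (exists2 U, is_affine U & U (gx P)) -> abs_gpoint P ->
  exists b, berk_point b P.
Proof.
move=> sepX [U aU UP] hP; have [v [rv _]] := semivaluation_of hP aU UP.
by exists (glue (@same_semivaluation _ X) v); split=> //; exists v.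
Qed.

Lemma berk_point_inj b b' P Q (U : set X) : Defs.separated X -> is_affine U ->
  berk_point b P -> berk_point b' Q -> U (gx P) -> U (gx Q) ->
  gev P (W := U) =1 gev Q (W := U) -> b = b'.
Proof.
move=> sepX aU [hP [v -> rv]] [hQ [w -> rw]] UP UQ e.
have [exy hPQ] := gpoint_ext aU UP UQ e.
apply: (represents_glue_eq sepX hP rv); have [wQ hw] := rw.
split; first by rewrite exy.
by move=> f; rewrite -hw hPQ ?exy//; exact: affine_open (sv_affine w).
Qed.

(** A semivaluation on the domain of [d] is one of many representatives of [b], all of
    which have the values of [P]; by separation they are identified in one step. *)
Lemma hybrid_basic_inr (A : atlas X) (r : R) (b : berkovich X) P d G p s W :
  Defs.separated X -> berk_point b P ->
  @hybrid_basic _ _ A r d G p s W (inr b) <->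
  dom d (gx P) /\ W (gev P (peval (scal (dom d)) (@coord _ _ d) p)).
Proof.
move=> sepX [hP [v bv rv]]; rewrite /hybrid_basic /=; split.
  move=> [w [hw [bw Ww]]].
  have [dP e] : represents P (AffineSemivaluation (dom_affine d) hw).
    by rewrite -(@represents_glue _ v)// -bv.
  by split=> //; rewrite e.
move=> [dP hW]; have [w [rw ew]] := semivaluation_of hP (dom_affine d) dP.
case: w ew rw => U w aU hw /= ew; subst U => rw.
exists w, hw; split; last by case: rw => _ /(_ (peval _ _ _)) <-.
rewrite bv; apply: (represents_glue_eq sepX hP) => //.
Qed.

End BerkovichPoints.

(** * Small radii *)

Section PolynomialContinuity.
Variable R : realType.
Local Notation C := R[i].
Local Notation K := (laurent R).

(** Continuity along an arbitrary filter covers both neighborhoods in coordinates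
    and ultrafilters of the hybrid space. *)
Definition poly_good (r : R) n (p : mpoly n K) := poly_converges_on r p /\
  forall (S : Type) (F : set_system S), Filter F ->
  forall (t : S -> C) (x : S -> 'rV[C]_n) t0 (x0 : 'rV[C]_n), 0 < cmod t0 < r ->
    tends F t t0 -> (forall l, tends F (fun s => x s 0 l) (x0 0 l)) ->
    tends F (fun s => poly_at (t s) p (x s)) (poly_at t0 p x0).

Lemma converges_on_le (r r' : R) (f : K) : r' <= r -> converges_on r f -> converges_on r' f.
Proof. by move=> rr h t /andP[t0 tr]; apply: h; rewrite t0 (lt_le_trans tr). Qed.

Definition near0R (P : R -> Prop) := exists2 d : R, 0 < d & forall r, 0 < r < d -> P r.

Lemma near0RI (P Q : R -> Prop) : near0R P -> near0R Q -> near0R (fun r => P r /\ Q r).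
Proof.
move=> [d d0 h] [d' d'0 h']; exists (Num.min d d'); first by rewrite lt_min d0.
by move=> r; rewrite lt_min => /and3P[r0 r1 r2]; split; [apply: h|apply: h']; rewrite r0.
Qed.

Lemma near0RS (P Q : R -> Prop) : (forall r, P r -> Q r) -> near0R P -> near0R Q.
Proof. by move=> PQ [d d0 h]; exists d => // r /h/PQ. Qed.

Lemma near0R_all (I : eqType) (s : seq I) (P : I -> R -> Prop) :
  (forall i, i \in s -> near0R (P i)) -> near0R (fun r => forall i, i \in s -> P i r).
Proof.
elim: s => [|i s IH] h; first by exists 1.
have h1 := h i (mem_head _ _).
have h2 : near0R (fun r => forall j, j \in s -> P j r).
  by apply: IH => j js; apply: h; rewrite in_cons js orbT.
apply: near0RS (near0RI h1 h2) => r [p1 p2] j; rewrite in_cons => /predU1P[->//|].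
exact: p2.
Qed.

Lemma near0R_fin (I : finType) (P : I -> R -> Prop) :
  (forall i, near0R (P i)) -> near0R (fun r => forall i, P i r).
Proof.
move=> h; have : near0R (fun r => forall i, i \in enum I -> P i r) by apply: near0R_all.
by apply: near0RS => r hr i; apply: hr; rewrite mem_enum.
Qed.

Lemma near0R_of (P : C -> Prop) : near0 P ->
  near0R (fun r => forall t, 0 < cmod t < r -> P t).
Proof.
move=> [d d0 h]; exists d => // r /andP[r0 rd] t /andP[t0 tr]; apply: h.
by rewrite t0 (lt_trans tr).
Qed.

Lemma poly_good_near n (p : mpoly n K) : near0R (fun r => poly_good r p).
Proof.
pose L := (0 : K) :: [seq mcoeff m p | m <- msupp p].
have hL m : m \in msupp p -> mcoeff m p \in L.
  by move=> hm; rewrite in_cons; apply/orP; right; apply/mapP; exists m.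
have [r r0 hr] : near0R (fun r => forall f, f \in L -> converges_on r f /\
    forall (S : Type) (F : set_system S), Filter F -> forall (t : S -> C) t0,
    0 < cmod t0 < r -> tends F t t0 ->
    tends F (fun s => laurent_eval (t s) f) (laurent_eval t0 f)).
  apply: near0R_all => f _; have [d d0 [h1 h2]] := laurent_radius f.
  exists d => // r /andP[r0 rd]; split; first exact: converges_on_le (ltW rd) h1.
  move=> S F FF t t0 /andP[t00 t0r]; apply: h2.
  by rewrite t00 (lt_trans t0r).
exists r => // r' /hr h; split=> [m|S F FF t x t0 x0 t0r ht hx].
  case: (boolP (m \in msupp p)) => hm; last first.
    by rewrite (memN_msupp_eq0 hm); have [] := h 0 (mem_head _ _).
  by have [] := h _ (hL _ hm).
rewrite /poly_at /peval.
have hc m : m \in msupp p -> tends F (fun s => laurent_eval (t s) (mcoeff m p))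
    (laurent_eval t0 (mcoeff m p)).
  by move=> hm; have [_ hh] := h _ (hL _ hm); exact: hh.
move: hc; elim: (msupp p) => [|m u IH] hc.
  rewrite big_nil; apply: tends_near (tends_cst 0).
  by apply: filterE => s /=; rewrite big_nil.
rewrite big_cons; apply: (@tends_near _ _ _ _ (fun s =>
  laurent_eval (t s) (mcoeff m p) * \prod_(i < n) x s 0 i ^+ m i +
  \sum_(m <- u) laurent_eval (t s) (mcoeff m p) * \prod_(i < n) x s 0 i ^+ m i)).
  by apply: filterE => s /=; rewrite big_cons.
apply: tendsD; last by apply: IH => m' hm'; apply: hc; rewrite in_cons hm' orbT.
apply: tendsM; first by apply: hc; exact: mem_head.
by apply: tends_prod => i; exact: tendsX.
Qed.

End PolynomialContinuity.

Section RationalTransitions.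
Variables (R : realType) (X : ringed_space (laurent R)).
Local Notation C := R[i].
Local Notation K := (laurent R).
Hypothesis sepX : Defs.separated X.

(** Formulas [y_l = a_l(x) / f(x) ^ n] for the change of coordinates between
    two charts, on the locus where [f] does not vanish. *)
Definition rat_data (n m : nat) := (mpoly n K * {ffun 'I_m -> mpoly n K} * nat)%type.

Definition rat_den n m (u : rat_data n m) (t : C) (x : 'rV[C]_n) := poly_at t u.1.1 x.
Definition rat_val n m (u : rat_data n m) (t : C) (x : 'rV[C]_n) : 'rV[C]_m :=
  \row_l (poly_at t (u.1.2 l) x / rat_den u t x ^+ u.2).

Definition rat_good (r : R) n m (u : rat_data n m) :=
  poly_good r u.1.1 /\ forall l, poly_good r (u.1.2 l).

Lemma rat_good_near n m (u : rat_data n m) : near0R (fun r => rat_good r u).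
Proof.
by apply: near0RI; [exact: poly_good_near|apply: near0R_fin => l; exact: poly_good_near].
Qed.

Lemma rat_val_tends (r : R) n m (u : rat_data n m) (S : Type) (F : set_system S) (FF : Filter F)
    (t : S -> C) (x : S -> 'rV[C]_n) t0 (x0 : 'rV[C]_n) :
  rat_good r u -> 0 < cmod t0 < r -> tends F t t0 ->
  (forall l, tends F (fun s => x s 0 l) (x0 0 l)) -> rat_den u t0 x0 != 0 ->
  forall l, tends F (fun s => rat_val u (t s) (x s) 0 l) (rat_val u t0 x0 0 l).
Proof.
move=> [[_ hf] ha] ht0 ht hx den l; rewrite mxE.
apply: (@tends_near _ _ _ FF (fun s => poly_at (t s) (u.1.2 l) (x s) / rat_den u (t s) (x s) ^+ u.2)).
  by apply: filterE => s /=; rewrite mxE.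
apply: tendsM; first by have [_ h] := ha l; exact: h.
by apply: tendsV; [rewrite expf_neq0|apply: tendsX; exact: hf].
Qed.

Lemma rat_den_neq0 (r : R) n m (u : rat_data n m) (S : Type) (F : set_system S) (FF : Filter F)
    (t : S -> C) (x : S -> 'rV[C]_n) t0 (x0 : 'rV[C]_n) :
  rat_good r u -> 0 < cmod t0 < r -> tends F t t0 ->
  (forall l, tends F (fun s => x s 0 l) (x0 0 l)) -> rat_den u t0 x0 != 0 ->
  F [set s | rat_den u (t s) (x s) != 0].
Proof.
move=> [[_ hf] _] ht0 ht hx den.
have h : tends F (fun s => rat_den u (t s) (x s)) (rat_den u t0 x0) by exact: hf.
have e0 : 0 < cmod (rat_den u t0 x0) by rewrite cmod_gt0.
apply: filterS (h _ e0) => s /=; apply: contraTneq => ->.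
by rewrite sub0r cmodN ltxx.
Qed.

Section Charts.
Variables c d : affine_chart X.
Local Notation Pc p := (peval (scal (dom c)) (@coord _ _ c) p).

Definition rat_locus (u : rat_data (dim c) (dim d)) : set X := principal_open (Pc u.1.1).

Definition rat_valid (u : rat_data (dim c) (dim d)) :=
  exists hs : rat_locus u `<=` dom d, forall l,
    restr (principal_open_sub (f := Pc u.1.1)) (Pc (u.1.2 l)) =
    restr hs (coord l) * restr (principal_open_sub (f := Pc u.1.1)) (Pc u.1.1) ^+ u.2.

(** On a principal neighborhood of [x] inside the overlap, the coordinates of the
    second chart are fractions; they are brought to a common exponent. *)
Lemma rat_valid_ex x : dom c x -> dom d x -> exists2 u, rat_valid u & rat_locus u x.
Proof.
move=> cx dx; have [oc _ hb haff] := dom_affine c.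
have od := affine_open (dom_affine d).
have [||//|f fx fs] := hb (dom d `&` dom c) x; [exact: openI|exact: subIsetr|].
have [p ep] := coord_generates f.
have hs : principal_open f `<=` dom d by move=> y /fs[].
have [hfr _] := haff f.
have hl (l : 'I_(dim d)) : exists an : mpoly (dim c) K * nat,
    restr (principal_open_sub (f := f)) (Pc an.1) =
    restr hs (coord l) * restr (principal_open_sub (f := f)) f ^+ an.2.
  have [a [n e]] := hfr (restr hs (coord l)); have [q eq] := coord_generates a.
  by exists (q, n); rewrite /= eq.
pose an l := sval (cid (hl l)).
have han l := svalP (cid (hl l)).
(* a common upper bound of the exponents *)
pose N := \sum_l (an l).2.
have aN l : ((an l).2 <= N)%N by rewrite /N (bigD1 l)//= leq_addr.
exists (p, [ffun l => (an l).1 * p ^+ (N - (an l).2)], N); last by rewrite /rat_locus /= ep.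
have hs' : rat_locus (p, [ffun l => (an l).1 * p ^+ (N - (an l).2)], N) `<=` dom d.
  by rewrite /rat_locus /= ep.
exists hs' => l; rewrite /= ffunE.
have pX n : Pc (p ^+ n) = Pc p ^+ n.
  elim: n => [|n IH]; first by rewrite !expr0 peval1.
  by rewrite !exprS pevalM IH.
move: hs'; rewrite /rat_locus pevalM pX /= ep => hs'.
rewrite rmorphM (han l) -/(an l) rmorphXn -mulrA -exprD subnKC//.
by rewrite (restr_irr hs hs').
Qed.

Section AlongPlace.
Variables (S : Type) (E : place R S).
Local Notation F := (pl_filter E).
Local Notation t := (pl_t E).
Let FU : UltraFilter F := pl_ultra E.
Local Existing Instance FU.

Lemma germ_neq0 (a : S -> C) : germ_of E a != 0 <-> F [set s | a s != 0].
Proof.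
split=> [h|h].
  have : F (~` [set s | a s = 0]).
    apply: ultra_setVsetC => h0; move/eqP: h; apply.
    by apply/(germ_ofP E a (fun=> 0)).
  by apply: filterS => s /= /eqP.
apply/eqP => /(germ_ofP E a (fun=> 0)) h0.
have /filter_ex[s /= [/eqP h1 h2]] : F ([set s | a s != 0] `&` [set s | a s = 0]) by exact: filterI.
exact: h1.
Qed.

Lemma rat_locusP P x u : ring_gpoint P -> at_chart (E := E) P (c := c) x ->
  rat_locus u (gx P) <-> F [set s | rat_den u (t s) (x s) != 0].
Proof.
move=> hP hx; have oc := affine_open (dom_affine c); have [cx _] := hx.
rewrite /rat_locus -(gev_neq0 _ oc cx) (at_chart_peval _ hP hx); exact: germ_neq0.
Qed.

Lemma rat_valid_chart P x u : ring_gpoint P -> at_chart (E := E) P (c := c) x ->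
  rat_valid u -> rat_locus u (gx P) -> at_chart P (c := d) (fun s => rat_val u (t s) (x s)).
Proof.
move=> hP hx [hs hu] ux; have oc := affine_open (dom_affine c); have [cx _] := hx.
split; first exact (hs _ ux).
move=> l; have oD := principal_open_open (Pc u.1.1).
have := congr1 (@gev _ _ _ P _) (hu l).
rewrite (gevM _ _ oD ux) (gevX _ _ oD ux) !(gev_restr _ _ oD ux).
rewrite !(at_chart_peval _ hP hx) => e.
have h0 : germ_of E (fun s => poly_at (t s) u.1.1 (x s)) != 0.
  by apply/germ_neq0; exact/(rat_locusP u hP hx).
have -> : germ_of E (fun s => rat_val u (t s) (x s) 0 l) =
    germ_of E (fun s => poly_at (t s) (u.1.2 l) (x s)) /
    germ_of E (fun s => poly_at (t s) u.1.1 (x s)) ^+ u.2.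
  rewrite -germ_ofX -germ_ofV -germ_ofM; congr germ_of; apply/funext => s.
  by rewrite mxE.
by rewrite e mulfK// expf_neq0.
Qed.

End AlongPlace.
End Charts.
End RationalTransitions.

Section GoodRadius.
Variables (R : realType) (X : ringed_space (laurent R)).
Local Notation C := R[i].
Local Notation K := (laurent R).
Hypothesis sepX : Defs.separated X.
Variable A : atlas X.
Local Notation U i := (chart (a := A) i).

(** The radii over which the charts of the degeneration glue as they should:
    [same_point] is an equivalence relation on points with coordinates in the
    charts, and finitely many rational formulas give the changes of coordinates. *)
Record good_radius (r : R) : Prop := GoodRadius {
  good01 : 0 < r < 1;
  good_eval1 : forall t, 0 < cmod t < r -> laurent_eval t 1 = 1;
  good_one : forall i, poly_good r (1 : mpoly (dim (U i)) K);
  good_coord : forall i l, poly_good r (mpolyX K (mnm1 l) : mpoly (dim (U i)) K);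
  good_trans : forall i j g, g \in trans (a := A) i j -> poly_good r g;
  good_refl : forall i j t x y, 0 < cmod t < r ->
    zeros_at t (trans (a := A) i j) (row_mx x y) -> zeros_at t (trans i i) (row_mx x x);
  good_sym : forall i j t x y, 0 < cmod t < r ->
    zeros_at t (trans (a := A) i j) (row_mx x y) -> zeros_at t (trans j i) (row_mx y x);
  good_transitive : forall i j l t x y z, 0 < cmod t < r ->
    zeros_at t (trans (a := A) i j) (row_mx x y) -> zeros_at t (trans (a := A) j l) (row_mx y z) ->
    zeros_at t (trans i l) (row_mx x z);
  good_uniq : forall i t x y, 0 < cmod t < r ->
    zeros_at t (trans (a := A) i i) (row_mx x y) -> x = y;
  good_rat : forall i j, exists L : seq (rat_data R (dim (U i)) (dim (U j))),
    [/\ forall u, u \in L -> rat_good r u,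
        forall t x y, 0 < cmod t < r -> zeros_at t (trans (a := A) i j) (row_mx x y) ->
          exists2 u, u \in L & rat_den u t x != 0 /\ y = rat_val u t x &
        forall u t x, u \in L -> 0 < cmod t < r -> zeros_at t (trans (a := A) i i) (row_mx x x) ->
          rat_den u t x != 0 -> zeros_at t (trans i j) (row_mx x (rat_val u t x))]
}.

Section AlongPlace.
Variables (S : Type) (E : place R S).
Local Notation F := (pl_filter E).
Local Notation t := (pl_t E).

Lemma trans_gpoint i j (x : S -> 'rV[C]_(dim (U i))) (y : S -> 'rV[C]_(dim (U j))) :
  F [set s | zeros_at (t s) (trans i j) (row_mx (x s) (y s))] ->
  exists P : gpoint X (germ E), [/\ ring_gpoint P, at_chart (E := E) P (c := U i) x & at_chart P (c := U j) y].
Proof.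
move=> h; exact: (overlap_gpoint sepX (proj2 (overlap_zeroP E x y (@transP _ _ A i j)) h)).
Qed.

Lemma gpoint_trans (P : gpoint X (germ E)) i j (x : S -> 'rV[C]_(dim (U i))) (y : S -> 'rV[C]_(dim (U j))) :
  ring_gpoint P -> at_chart (E := E) P (c := U i) x -> at_chart P (c := U j) y ->
  F [set s | zeros_at (t s) (trans i j) (row_mx (x s) (y s))].
Proof.
move=> hP hx hy.
exact: (proj1 (overlap_zeroP E x y (@transP _ _ A i j)) (at_chart_overlap sepX hP hx hy)).
Qed.

(** Sections of the chart are polynomials in its coordinates. *)
Lemma at_chart_uniq (P Q : gpoint X (germ E)) (c : affine_chart X) x : ring_gpoint P -> ring_gpoint Q ->
  at_chart (E := E) P (c := c) x -> at_chart Q (c := c) x ->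
  gx P = gx Q /\ forall W, open W -> W (gx P) -> gev P (W := W) =1 gev Q (W := W).
Proof.
move=> hP hQ hx hx'; have [[cP _] [cQ _]] := (hx, hx').
apply: (gpoint_ext (dom_affine c) cP cQ) => h.
have [p <-] := coord_generates h.
by rewrite (at_chart_peval p hP hx) (at_chart_peval p hQ hx').
Qed.

Lemma at_chart_transfer (P Q : gpoint X (germ E)) (c d : affine_chart X) x y : ring_gpoint P -> ring_gpoint Q ->
  at_chart (E := E) P (c := c) x -> at_chart Q (c := c) x ->
  at_chart Q (c := d) y -> at_chart P (c := d) y.
Proof.
move=> hP hQ hx hx' [dQ hy]; have [exy e] := at_chart_uniq hP hQ hx hx'.
split; first by rewrite exy.
by move=> l; rewrite -hy e// ?exy//; exact: affine_open (dom_affine d).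
Qed.

End AlongPlace.

(** By saturation each clause is checked on points over a field of germs. There
    zeros of the equations of an overlap are the coordinates in two charts of one
    point, from which symmetry, transitivity and uniqueness are clear, and the formulas
    come from a principal neighborhood of that point. *)
Lemma good_radius_near : near0R good_radius.
Proof.
have n01 : near0R (fun r : R => 0 < r < 1) by exists 1.
have nT : near0R (fun r : R => forall i j g, g \in trans (a := A) i j -> poly_good r g).
  apply: near0R_fin => i; apply: near0R_fin => j; apply: near0R_all => g _.
  exact: poly_good_near.
have n1 : near0R (fun r : R => (forall t : C, 0 < cmod t < r -> laurent_eval t 1 = 1) /\
    (forall i, poly_good r (1 : mpoly (dim (U i)) K)) /\
    (forall i l, poly_good r (mpolyX K (mnm1 l) : mpoly (dim (U i)) K))).
  apply: near0RI; first exact: near0R_of (laurent_eval_const 1).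
  apply: near0RI; apply: near0R_fin => i; first exact: poly_good_near.
  by apply: near0R_fin => l; exact: poly_good_near.
have nuniq : near0R (fun r : R => forall i t x y, 0 < cmod t < r ->
    zeros_at t (trans (a := A) i i) (row_mx x y) -> x = y).
  apply: near0R_fin => i.
  pose S := (C * 'rV[C]_(dim (U i)) * 'rV[C]_(dim (U i)))%type.
  have h := @saturation0 R S (fun s => s.1.1)
    [set s | zeros_at s.1.1 (trans i i) (row_mx s.1.2 s.2)] [set s | s.1.2 = s.2].
  apply: near0RS (near0R_of (h _)) => [r hr t x y tr z|]; first exact: (hr t tr (t, x, y)).
  move=> E EU E0 EP; pose pE := Place EU E0.
  have [P [hP hx hy]] := @trans_gpoint _ pE i i (fun s => s.1.2) snd EP.
  exact: at_chart_near hx hy.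
have nref : near0R (fun r : R => forall i j t x y, 0 < cmod t < r ->
    zeros_at t (trans (a := A) i j) (row_mx x y) ->
      zeros_at t (trans i i) (row_mx x x) /\ zeros_at t (trans j i) (row_mx y x)).
  apply: near0R_fin => i; apply: near0R_fin => j.
  pose S := (C * 'rV[C]_(dim (U i)) * 'rV[C]_(dim (U j)))%type.
  have h := @saturation0 R S (fun s => s.1.1)
    [set s | zeros_at s.1.1 (trans i j) (row_mx s.1.2 s.2)]
    [set s | zeros_at s.1.1 (trans i i) (row_mx s.1.2 s.1.2) /\
             zeros_at s.1.1 (trans j i) (row_mx s.2 s.1.2)].
  apply: near0RS (near0R_of (h _)) => [r hr t x y tr z|]; first exact: (hr t tr (t, x, y)).
  move=> E EU E0 EP; pose pE := Place EU E0.
  have [P [hP hx hy]] := @trans_gpoint _ pE i j (fun s => s.1.2) snd EP.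
  apply: filterS2 (gpoint_trans hP hx hx) (gpoint_trans hP hy hx) => s /= h1 h2; by split.
have ntr : near0R (fun r : R => forall i j l t x y z, 0 < cmod t < r ->
    zeros_at t (trans (a := A) i j) (row_mx x y) -> zeros_at t (trans (a := A) j l) (row_mx y z) ->
    zeros_at t (trans i l) (row_mx x z)).
  apply: near0R_fin => i; apply: near0R_fin => j; apply: near0R_fin => l.
  pose S := (C * 'rV[C]_(dim (U i)) * 'rV[C]_(dim (U j)) * 'rV[C]_(dim (U l)))%type.
  have h := @saturation0 R S (fun s => s.1.1.1)
    [set s | zeros_at s.1.1.1 (trans i j) (row_mx s.1.1.2 s.1.2) /\
             zeros_at s.1.1.1 (trans j l) (row_mx s.1.2 s.2)]
    [set s | zeros_at s.1.1.1 (trans i l) (row_mx s.1.1.2 s.2)].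
  apply: near0RS (near0R_of (h _)) => [r hr t x y z tr z1 z2|].
    exact: (hr t tr (t, x, y, z)).
  move=> E EU E0 EP; pose pE := Place EU E0.
  have EP1 : E [set s : S | zeros_at s.1.1.1 (trans i j) (row_mx s.1.1.2 s.1.2)].
    by apply: filterS EP => s [].
  have EP2 : E [set s : S | zeros_at s.1.1.1 (trans j l) (row_mx s.1.2 s.2)].
    by apply: filterS EP => s [].
  have [P [hP hx hy]] := @trans_gpoint _ pE i j (fun s => s.1.1.2) (fun s => s.1.2) EP1.
  have [Q [hQ hy' hz]] := @trans_gpoint _ pE j l (fun s => s.1.2) snd EP2.
  exact: (gpoint_trans hP hx (at_chart_transfer hP hQ hy hy' hz)).
have nrat : near0R (fun r : R => forall i j, exists L : seq (rat_data R (dim (U i)) (dim (U j))),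
    [/\ forall u, u \in L -> rat_good r u,
        forall t x y, 0 < cmod t < r -> zeros_at t (trans (a := A) i j) (row_mx x y) ->
          exists2 u, u \in L & rat_den u t x != 0 /\ y = rat_val u t x &
        forall u t x, u \in L -> 0 < cmod t < r -> zeros_at t (trans (a := A) i i) (row_mx x x) ->
          rat_den u t x != 0 -> zeros_at t (trans i j) (row_mx x (rat_val u t x))]).
  apply: near0R_fin => i; apply: near0R_fin => j.
  pose S := (C * 'rV[C]_(dim (U i)) * 'rV[C]_(dim (U j)))%type.
  pose J := rat_data R (dim (U i)) (dim (U j)).
  have [|I0 [J0 hJ0]] := @saturation R S (fun s => s.1.1) unit J
    (fun=> [set s | zeros_at s.1.1 (trans i j) (row_mx s.1.2 s.2)])
    (fun u => [set s | rat_valid u /\ rat_den u s.1.1 s.1.2 != 0 /\ s.2 = rat_val u s.1.1 s.1.2]).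
    move=> E EU E0 /(_ tt) EP; pose pE := Place EU E0.
    have [P [hP hx hy]] := @trans_gpoint _ pE i j (fun s => s.1.2) snd EP.
    have [[cx _] [dx _]] := (hx, hy).
    have [u hu ux] := rat_valid_ex cx dx; exists u.
    have hy' := rat_valid_chart hP hx hu ux.
    have h1 := proj1 (rat_locusP u hP hx) ux.
    by apply: filterS2 h1 (at_chart_near hy hy') => s /= h1 h2; split.
  pose L := [seq u <- J0 | `[< rat_valid u >]].
  have hL : near0R (fun r : R => forall u, u \in L -> rat_good r u /\
      forall t x, 0 < cmod t < r -> zeros_at t (trans (a := A) i i) (row_mx x x) ->
          rat_den u t x != 0 -> zeros_at t (trans i j) (row_mx x (rat_val u t x))).
    apply: near0R_all => u; rewrite mem_filter => /andP[/asboolP hu _].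
    apply: near0RI; first exact: rat_good_near.
    pose S' := (C * 'rV[C]_(dim (U i)))%type.
    have h := @saturation0 R S' (fun s => s.1)
      [set s | zeros_at s.1 (trans i i) (row_mx s.2 s.2) /\ rat_den u s.1 s.2 != 0]
      [set s | zeros_at s.1 (trans i j) (row_mx s.2 (rat_val u s.1 s.2))].
    apply: near0RS (near0R_of (h _)) => [r hr t x tr z1 z2|]; first exact: (hr t tr (t, x)).
    move=> E EU E0 EP; pose pE := Place EU E0.
    have EP1 : E [set s : S' | zeros_at s.1 (trans i i) (row_mx s.2 s.2)].
      by apply: filterS EP => s [].
    have EP2 : E [set s : S' | rat_den u s.1 s.2 != 0] by apply: filterS EP => s [].
    have [P [hP hx _]] := @trans_gpoint _ pE i i snd snd EP1.
    apply: (gpoint_trans hP hx (rat_valid_chart hP hx hu _)).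
    exact/(rat_locusP u hP hx).
  apply: near0RS (near0RI (near0R_of hJ0) hL) => r [h1 h2]; exists L; split.
  - by move=> u /h2[].
  - move=> t x y tr z; have [//|u uJ [hu hz]] := h1 t tr (t, x, y) erefl.
    by exists u => //; rewrite mem_filter uJ andbT; exact/asboolP.
  - by move=> u t x /h2[_ h]; exact: h.
apply: near0RS (near0RI n01 (near0RI nT (near0RI nref (near0RI ntr
  (near0RI nrat (near0RI n1 nuniq)))))).
move=> r [h1 [h2 [h3 [h4 [h5 [[h6 [h7 h8]] h9]]]]]]; split=> //.
- by move=> i j t x y tr z; have [] := h3 i j t x y tr z.
- by move=> i j t x y tr z; have [] := h3 i j t x y tr z.
Qed.

End GoodRadius.

(** * The hybrid topology in coordinates *)

Section HybridTopology.
Variables (R : realType) (X : ringed_space (laurent R)).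
Local Notation C := R[i].
Local Notation K := (laurent R).
Variable A : atlas X.
Variable r : R.
Local Notation H := (hybrid A r).

Lemma hybrid_open_subbase (B : set H) : @hybrid_subbase R X A r B -> open B.
Proof.
move=> hB; exists [set B]; last by rewrite bigcup_set1.
by move=> _ ->; exact: finI_from1.
Qed.

Lemma hybrid_cvg (F : set_system H) (z : H) : Filter F ->
  (forall B, @hybrid_subbase R X A r B -> B z -> F B) -> F --> z.
Proof.
move=> FF h V [B [[D' sD <-] [W D'W Wz] sBV]]; apply: filterS sBV _.
apply: (@filterS _ F _ W); first by move=> w Ww; exists W.
have [D sDs eW] := sD _ D'W; rewrite -eW in Wz *.
apply: filter_bigI => Q QD; apply: h; last exact: Wz.
by have := sDs _ QD; rewrite inE.
Qed.

Hypothesis good : good_radius A r.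
Local Notation U i := (chart (a := A) i).
Local Notation fiber i t x := (chart_fiber (A := A) r (i := i) t x).

Lemma degeneration_eq i j t t' x y (h : fiber i t x) (h' : fiber j t' y) :
  degeneration_pt h = degeneration_pt h' <->
  t = t' /\ zeros_at t (trans i j) (row_mx x y).
Proof.
split; last first.
  move=> [e z]; subst t'; apply/eqP; rewrite /degeneration_pt /glue.
  by apply/eqP/eqquotP/asboolP; apply: rst_step; split.
move=> /eqP; rewrite /degeneration_pt /glue; move=> /eqP/eqquotP/asboolP.
suff hs p q : clos_refl_sym_trans _ (@same_point R X A r) p q -> same_point p q.
  by move=> /hs[/= <- z].
elim=> [//|{}p|{}p {}q _ [e z]|{}p q' {}q _ [e z] _ [e' z']].
- by split=> //; case: p => ? ? ? [].
- have tr : 0 < cmod (cp_t p) < r by case: p {e z} => ? ? ? [].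
  by split=> //; rewrite -e; apply: good_sym good _ _ _ _ _ tr z.
- have tr : 0 < cmod (cp_t p) < r by case: p {e z} => ? ? ? [].
  split; first by rewrite e.
  by rewrite -e in z'; apply: good_transitive good _ _ _ _ _ _ _ tr z z'.
Qed.

Lemma degeneration_ex (c : degeneration A r) :
  exists i t x (h : fiber i t x), c = degeneration_pt h.
Proof.
pose p := glued_repr c; have e : c = glue (@same_point R X A r) p.
  by rewrite /glue /p /glued_repr; symmetry; exact: (reprK (c : {eq_quot _}%qT)).
by move: p e => [i t x h] ->; exists i, t, x, h.
Qed.

Lemma hybrid_proj_inl i t x (h : fiber i t x) : hybrid_proj (inl (degeneration_pt h)) = t.
Proof.
rewrite /hybrid_proj; set p := glued_repr _.
have : glue (@same_point R X A r) p = degeneration_pt h.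
  by rewrite /glue /p /glued_repr; exact: (reprK (degeneration_pt h : {eq_quot _}%qT)).
case: p => j t' y h' e.
have {}e : degeneration_pt h' = degeneration_pt h := e.
by have [et _] := proj1 (degeneration_eq h' h) e.
Qed.

Lemma fiber_overlap i j t x y : fiber i t x -> zeros_at t (trans i j) (row_mx x y) ->
  fiber j t y.
Proof.
move=> [tr _] z; split=> //; apply: (good_refl good (j := i) (y := x) tr).
exact: (good_sym good tr z).
Qed.

Definition coord_open n (N : C -> 'rV[C]_n -> Prop) := forall t x, N t x ->
  exists2 e : R, 0 < e & forall (t' : C) (x' : 'rV[C]_n), cmod (t' - t) < e ->
    (forall l, cmod (x' 0 l - x 0 l) < e) -> N t' x'.

Lemma coord_open_tends n (N : C -> 'rV[C]_n -> Prop) (S : Type) (F : set_system S)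
    {FF : Filter F} (t : S -> C) (x : S -> 'rV[C]_n) t0 x0 : coord_open N -> N t0 x0 ->
  tends F t t0 -> (forall l, tends F (fun s => x s 0 l) (x0 0 l)) ->
  F [set s | N (t s) (x s)].
Proof.
move=> hN Nx ht hx; have [e e0 h] := hN _ _ Nx.
have hx' : F [set s | forall l, cmod (x s 0 l - x0 0 l) < e].
  by apply: filter_forall => l; exact: hx.
by apply: filterS2 (ht _ e0) hx' => s /=; exact: h.
Qed.

Lemma nbhs_row_tends n (t : C) (x : 'rV[C]_n) :
  tends (nbhs (t, x)) fst t /\ forall l, tends (nbhs (t, x)) (fun z => z.2 0 l) (x 0 l).
Proof. by split=> [e e0|l e e0]; apply/nbhsC_row; exists e => //= z y h1 h2. Qed.

Definition chart_set i (N : C -> 'rV[C]_(dim (U i)) -> Prop) : set (degeneration A r) :=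
  [set c | exists t x (h : fiber i t x), c = degeneration_pt h /\ N t x].

(** Near each of its points, coordinates in another chart are given by a rational
    formula whose denominator does not vanish, hence vary continuously. *)
Lemma chart_set_open i N : coord_open N -> analytic_open (@chart_set i N).
Proof.
move=> hN j t y h [t' [x [h' [/degeneration_eq[e z] Nx]]]]; subst t'.
have [tr _] := h; have [L [hL hz hu]] := good_rat good j i.
have [u uL [den ex]] := hz _ _ _ tr z.
have [ht hy] := nbhs_row_tends t y.
have gu := hL u uL.
have h1 := rat_den_neq0 (nbhs_filter _) gu tr ht hy den.
have hx := rat_val_tends (nbhs_filter _) gu tr ht hy den.
rewrite -ex in hx.
have h2 : nbhs (t, y) [set z | N z.1 (rat_val u z.1 z.2)] by exact: coord_open_tends hN Nx ht hx.
apply: filterS2 h1 h2 => -[t1 y1] /= den1 N1 h1'.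
have [tr1 z1] := h1'.
have z2 := hu u t1 y1 uL tr1 z1 den1.
exists t1, (rat_val u t1 y1), (fiber_overlap h1' z2); split=> //.
exact/degeneration_eq.
Qed.

(** It is enough to look at the two kinds of sets of the subbase, and for the second
    one this is required by its definition. *)
Lemma analytic_nbhs i t x (h : fiber i t x) (B : set H) : nbhs (inl (degeneration_pt h) : H) B ->
  \forall z \near (t, x), forall h' : fiber i z.1 z.2, B (inl (degeneration_pt h')).
Proof.
pose F : set_system H := fun B => \forall z \near (t, x),
  forall h' : fiber i z.1 z.2, B (inl (degeneration_pt h')).
have FF : Filter F.
  split; first by rewrite /F; near=> z.
  - by move=> P Q hP hQ; apply: (@filterS2 _ (nbhs (t, x)) _ _ _ _ _ hP hQ) => z pz qz h'; split; [exact: pz|exact: qz].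
  - by move=> P Q PQ hP; apply: (@filterS _ (nbhs (t, x)) _ _ _ _ hP) => z pz h'; apply: PQ; exact: pz.
move: B; apply: (hybrid_cvg FF) => B; case=> [[Q oQ ->] | [d [G [p [s [W [_ _ _ _ oB]]]]]]].
  move=> [c Qc [e]]; subst c; have := oQ _ _ _ h Qc; apply: filterS => z hz h'.
  by exists (degeneration_pt h').
by move=> Bz; exact: (oB _ _ _ h Bz).
Unshelve. all: by end_near. Qed.

Lemma inl_open (O : set (degeneration A r)) : analytic_open O -> open (inl @` O : set H).
Proof. by move=> oO; apply: hybrid_open_subbase; left; exists O. Qed.

(** A neighborhood of a point outside the central fiber contains all points with
    close coordinates, by [analytic_nbhs]. *)
Lemma inl_cvg (F : set_system H) i (t : H -> C) (x : H -> 'rV[C]_(dim (U i))) t0 x0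
    (h0 : fiber i t0 x0) : Filter F ->
  F [set z | exists h : fiber i (t z) (x z), z = inl (degeneration_pt h)] ->
  tends F t t0 -> (forall l, tends F (fun z => x z 0 l) (x0 0 l)) ->
  F --> (inl (degeneration_pt h0) : H).
Proof.
move=> FF hF ht hx B /analytic_nbhs/nbhsC_row[e e0 hB].
have hx' : F [set s | forall l, cmod (x s 0 l - x0 0 l) < e].
  by apply: filter_forall => l; exact: hx.
apply: filterS3 hF (ht _ e0) hx' => z /= [h ez] h1 h2.
have hh := hB _ _ h1 h2; have := hh h; by rewrite -ez.
Qed.

Lemma fiber_closed (S : Type) (F : set_system S) {FF : ProperFilter F} i (t : S -> C)
    (x : S -> 'rV[C]_(dim (U i))) t0 (x0 : 'rV[C]_(dim (U i))) : F [set s | fiber i (t s) (x s)] ->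
  0 < cmod t0 < r -> tends F t t0 -> (forall l, tends F (fun s => x s 0 l) (x0 0 l)) ->
  fiber i t0 x0.
Proof.
move=> hF tr ht hx; split=> // g gT; have [_ hg] := good_trans good gT.
have hxx l : tends F (fun s => row_mx (x s) (x s) 0 l) (row_mx x0 x0 0 l).
  case: (split_ordP l) => j ->.
    by rewrite row_mxEl; apply: tends_near (hx j); apply: filterE => s /=; rewrite row_mxEl.
  by rewrite row_mxEr; apply: tends_near (hx j); apply: filterE => s /=; rewrite row_mxEr.
have h1 : tends F (fun s => poly_at (t s) g (row_mx (x s) (x s)))
    (poly_at t0 g (row_mx x0 x0)) by exact: hg.
apply: (tends_uniq h1); apply: tends_near (tends_cst 0).
by apply: filterS hF => s /= [_ /(_ _ gT)].
Qed.

(** On a chart of the atlas the auxiliary coordinates in the definition of the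
    basic sets are other coordinates of the same point, and can be eliminated. *)
Local Notation basic j p s W := (@hybrid_basic _ _ A r (U j) (fun i => trans i j) p s W).

Lemma basic_inl j p s W c : basic j p s W (inl c) <->
  exists t y (h : fiber j t y), [/\ c = degeneration_pt h, cmod t < s &
    W (cmod (poly_at t p y) `^ hybrid_exponent t)].
Proof.
split=> [[i [t [x [h [y [-> ts z hW]]]]]]|[t [y [h [-> ts hW]]]]].
  exists t, y, (fiber_overlap h z); split=> //; exact/degeneration_eq.
by exists j, t, y, h, y; split=> //; case: h.
Qed.

Lemma hybrid_exponent_tends (S : Type) (F : set_system S) (FF : Filter F) (t : S -> C) t0 :
  0 < cmod t0 < 1 -> tends F t t0 ->
  hybrid_exponent (t s) @[s --> F] --> hybrid_exponent t0.
Proof.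
move=> /andP[t00 t1] ht.
have ln0 : ln (cmod t0)^-1 != 0 by rewrite lnV// oppr_eq0 lt_eqF// ln_lt0// t00.
apply: cvgV => //; apply: continuous_cvg; first by apply: continuous_ln; rewrite invr_gt0.
by apply: cvgV; [rewrite gt_eqF|exact: tends_cmod].
Qed.

Lemma powR_cmod_tends (S : Type) (F : set_system S) (FF : Filter F) (t a : S -> C) t0 a0 :
  0 < cmod t0 < 1 -> tends F t t0 -> tends F a a0 ->
  cmod (a s) `^ hybrid_exponent (t s) @[s --> F] --> cmod a0 `^ hybrid_exponent t0.
Proof.
move=> t01 ht ha; apply: powR_cvg; rewrite ?cmod_ge0 ?hybrid_exponent_gt0//.
- by move=> s; exact: cmod_ge0.
- exact: tends_cmod.
- exact: hybrid_exponent_tends.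
Qed.

Lemma basic_analytic j p s W : poly_good s p -> s <= r -> open W ->
  analytic_open (inl @^-1` basic j p s W).
Proof.
move=> hp sr oW.
pose N (t : C) (y : 'rV[C]_(dim (U j))) := 0 < cmod t < s /\
  W (cmod (poly_at t p y) `^ hybrid_exponent t).
have hN : coord_open N.
  move=> t y [ts Wy]; apply/(nbhsC_row t y (fun z => N z.1 z.2)).
  have [ht hy] := nbhs_row_tends t y.
  have [_ hc] := hp.
  have h1 : tends (nbhs (t, y)) (fun z => poly_at z.1 p z.2) (poly_at t p y) by exact: hc.
  have [r0 r1] := andP (good01 good); have [t0 ts'] := andP ts.
  have t01 : 0 < cmod t < 1 by rewrite t0 (lt_trans ts')// (le_lt_trans sr).
  have h2 := powR_cmod_tends (nbhs_filter _) t01 ht h1.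
  have h3 : nbhs (t, y) [set z | W (cmod (poly_at z.1 p z.2) `^ hybrid_exponent z.1)].
    by apply: h2; exact: open_nbhs_nbhs.
  have h4 : nbhs (t, y) [set z | cmod z.1 < s] by exact: tends_cmod_lt ht ts'.
  have h5 : nbhs (t, y) [set z | 0 < cmod z.1].
    apply: filterS (ht _ t0) => z /=; rewrite !cmod_gt0; apply: contraTneq => ->.
    by rewrite sub0r cmodN ltxx.
  by apply: filterS3 h3 h4 h5 => z /= z3 z4 z5; split=> //; rewrite z5.
suff -> : inl @^-1` basic j p s W = @chart_set j N by exact: chart_set_open.
apply/seteqP; split=> c /=.
  move=> /basic_inl[t [y [h [-> ts Wy]]]]; exists t, y, h; split=> //; split=> //.
  by have [/andP[-> _] _] := h.
move=> [t [y [h [-> [/andP[_ ts] Wy]]]]]; apply/basic_inl.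
by exists t, y, h.
Qed.

Lemma basic_subbase j p s W : 0 < s <= r -> poly_good s p -> open W ->
  @hybrid_subbase R X A r (basic j p s W).
Proof.
move=> /andP[s0 sr] hp oW; right.
exists (U j), (fun i => trans i j), p, s, W; split=> //.
- by move=> i; exact: transP.
- split; last by case: hp.
  by move=> i g gT; have [h _] := good_trans good gT; move=> m; exact: converges_on_le (h m).
- exact: basic_analytic.
Qed.

Lemma basic_open j p s W : 0 < s <= r -> poly_good s p -> open W ->
  open (basic j p s W).
Proof. by move=> hs hp oW; apply: hybrid_open_subbase; exact: basic_subbase. Qed.

Lemma poly_good_radius n (p : mpoly n K) (e : R) : 0 < e ->
  exists2 s, 0 < s <= r & poly_good s p /\ s < e.
Proof.
move=> e0; have [d d0 hd] := poly_good_near p.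
have [r0 _] := andP (good01 good).
pose s := Num.min r (Num.min (d / 2) (e / 2)).
have s0 : 0 < s by rewrite !lt_min r0 !divr_gt0.
have sd : s <= d / 2 by rewrite !ge_min lexx orbT.
have se : s <= e / 2 by rewrite !ge_min lexx !orbT.
exists s; first by rewrite s0 ge_min lexx.
split; last by lra.
by apply: hd; rewrite s0 /=; lra.
Qed.

Hypothesis sepX : Defs.separated X.

Lemma chart_at (x : X) : exists j, dom (U j) x.
Proof.
have : (\bigcup_j dom (U j)) x by rewrite chart_cover.
by move=> [j _ hj]; exists j.
Qed.

Lemma hybrid_proj_continuous : continuous (@hybrid_proj R X A r).
Proof.
move=> [c|b] B /nbhsC[e e0 hB].
  have [i [t [x [h ec]]]] := degeneration_ex c; subst c.
  pose N (t' : C) (_ : 'rV[C]_(dim (U i))) := cmod (t' - t) < e.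
  rewrite hybrid_proj_inl in hB.
  have hN : coord_open N.
    move=> t1 x1 h1; exists (e - cmod (t1 - t)); first by rewrite subr_gt0.
    move=> t' x' ht' _; apply: le_lt_trans (cmod_triangle t1 _ _) _.
    by rewrite -ltrBrDr.
  have o := inl_open (chart_set_open hN).
  apply: (@filterS _ (nbhs (inl (degeneration_pt h) : H)) _ (inl @` chart_set N)).
    move=> _ [_ [t' [x' [h' [-> h1]]]] <-].
    have /hB : cmod (@hybrid_proj _ _ A r (inl (degeneration_pt h')) - t) < e.
      by rewrite hybrid_proj_inl.
    by [].
  apply: open_nbhs_nbhs; split=> //; exists (degeneration_pt h) => //.
  by exists t, x, h; split=> //; rewrite /N subrr cmod0.
have [P hP] := berk_point_ex b; have [j jP] := chart_at (gx P).
(* the basic sets of the constant 1 consist of the points of a chart over a disc *)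
have [s hs [hp se]] := poly_good_radius (1 : mpoly (dim (U j)) K) e0.
have o := basic_open hs hp (@openT R).
apply: (@filterS _ (nbhs (inr b : H)) _ (basic j 1 s setT)); last first.
  apply: open_nbhs_nbhs; split=> //.
  by apply: (proj2 (@hybrid_basic_inr R X A r b P (U j) (fun i => trans i j) 1 s setT sepX hP)).
move=> [c /basic_inl[t [y [h [-> ts _]]]]|b' _]; last first.
  have /hB : cmod ((0 : C) - 0) < e by rewrite subrr cmod0.
  by [].
have /hB : cmod (@hybrid_proj _ _ A r (inl (degeneration_pt h)) - 0) < e.
  by rewrite hybrid_proj_inl subr0 (lt_trans ts).
by [].
Qed.

End HybridTopology.

(** * Limits of renormalized absolute values *)

Section Nets.
Variables (R : realType) (X : ringed_space (laurent R)).
Local Notation C := R[i].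
Local Notation K := (laurent R).
Variables (S : Type) (F : set_system S).

(** What remains, along an ultrafilter, of a family of points approaching the
    central fiber: the opens that eventually contain them, and the
    renormalized absolute values of sections at them. The factor [eta] is there
    because an archimedean absolute value raised to a small exponent is
    ultrametric only up to a factor tending to 1. *)
Record net := Net {
  nt_dom : set X -> Prop;
  nt_val : forall W : set X, sect W -> S -> R;
  nt_ge0 : forall W (h : sect W), open W -> nt_dom W -> F [set s | 0 <= nt_val h s];
  nt_mul : forall W (g h : sect W), open W -> nt_dom W ->
    F [set s | nt_val (g * h) s = nt_val g s * nt_val h s];
  nt_add : forall W (g h : sect W) (eta : R), open W -> nt_dom W -> 1 < eta ->
    F [set s | nt_val (g + h) s <= eta * Num.max (nt_val g s) (nt_val h s)];
  nt_one : forall W, open W -> nt_dom W -> F [set s | nt_val (1 : sect W) s = 1];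
  nt_scal : forall W c, open W -> nt_dom W ->
    nt_val (scal W c) s @[s --> F] --> abs_semivaluation (ord_zero c);
  nt_restr : forall W W' (u : W' `<=` W) (h : sect W), open W -> open W' -> nt_dom W' ->
    F [set s | nt_val (restr u h) s = nt_val h s];
  nt_up : forall W W', W' `<=` W -> nt_dom W' -> nt_dom W;
  nt_setI : forall W W', nt_dom W -> nt_dom W' -> nt_dom (W `&` W');
  nt_principal : forall W (h : sect W), open W -> nt_dom W ->
    F [set s | nt_val h s != 0] -> nt_dom (principal_open h);
  nt_cover : forall (I : finType) (V : I -> set X), \bigcup_i V i = setT ->
    exists i, nt_dom (V i)
}.

Variable N : net.
Hypothesis FU : UltraFilter F.
Local Existing Instance FU.

Lemma nt_exp W (h : sect W) n : open W -> nt_dom N W ->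
  F [set s | nt_val N (h ^+ n) s = nt_val N h s ^+ n].
Proof.
move=> oW dW; elim: n => [|n IH].
  by apply: filterS (nt_one oW dW) => s /= e; rewrite !expr0 e.
by apply: filterS2 IH (nt_mul h (h ^+ n) oW dW) => s /= e1 e2; rewrite !exprS e2 e1.
Qed.

Lemma real_cvg_uniq (a : S -> R) (l m : R) : a s @[s --> F] --> l -> a s @[s --> F] --> m -> l = m.
Proof. by move=> al am; apply: (cvg_unique _ al am). Qed.

Lemma real_cvg_ge (a : S -> R) (l m : R) : a s @[s --> F] --> l ->
  F [set s | m <= a s] -> m <= l.
Proof.
move=> al h; rewrite leNgt; apply/negP => lm.
have h2 : \forall s \near F, a s < m by exact: cvgr_lt al _ lm.
have /filter_ex[s /= [h3 h4]] : F ([set s | m <= a s] `&` [set s | a s < m]) by exact: filterI.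
by move: h3; rewrite leNgt h4.
Qed.

Lemma real_cvg_le (a : S -> R) (l m : R) : a s @[s --> F] --> l ->
  F [set s | a s <= m] -> l <= m.
Proof.
move=> al h; rewrite leNgt; apply/negP => lm.
have h2 : \forall s \near F, m < a s by exact: cvgr_gt al _ lm.
have /filter_ex[s /= [h3 h4]] : F ([set s | a s <= m] `&` [set s | m < a s]) by exact: filterI.
by move: h3; rewrite leNgt h4.
Qed.

Lemma real_cvgX (a : S -> R) (l : R) n : a s @[s --> F] --> l -> a s ^+ n @[s --> F] --> l ^+ n.
Proof.
move=> al; elim: n => [|n IH]; first by under eq_fun do rewrite expr0; exact: cvg_cst.
by under eq_fun do rewrite exprS; rewrite exprS; exact: cvgM.
Qed.

Section Limit.
Variables (W : set X) (aW : is_affine W) (dW : nt_dom N W).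
Variables (n : nat) (w : 'I_n -> sect W).
Hypotheses (gw : generates w)
  (bw : forall l, exists M, F [set s | nt_val N (w l) s <= M]).
Let oW := affine_open aW.

Let bounded (h : sect W) := exists M, F [set s | nt_val N h s <= M].

Let bounded_scal c : bounded (scal W c).
Proof.
exists (abs_semivaluation (ord_zero c) + 1).
have h := @nt_scal N W c oW dW.
have : \forall s \near F, nt_val N (scal W c) s < abs_semivaluation (ord_zero c) + 1.
  by apply: cvgr_lt h _ _; rewrite ltrDl.
by apply: filterS => s /ltW.
Qed.

Let boundedM g h : bounded g -> bounded h -> bounded (g * h).
Proof.
move=> [M hM] [M' hM']; exists (Num.max 0 M * Num.max 0 M').
have h1 : F [set s | nt_val N g s <= Num.max 0 M].
  by apply: filterS hM => s /= ?; rewrite le_max orbC; apply/orP; left.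
have h2 : F [set s | nt_val N h s <= Num.max 0 M'].
  by apply: filterS hM' => s /= ?; rewrite le_max orbC; apply/orP; left.
have h4 : F [set s | 0 <= nt_val N g s /\ 0 <= nt_val N h s].
  by apply: filterS2 (nt_ge0 g oW dW) (nt_ge0 h oW dW).
have h5 : F [set s | nt_val N g s <= Num.max 0 M /\ nt_val N h s <= Num.max 0 M'].
  by apply: filterS2 h1 h2.
by apply: filterS3 h4 h5 (nt_mul g h oW dW) => s /= [? ?] [? ?] ->; apply: ler_pM.
Qed.

Let boundedD g h : bounded g -> bounded h -> bounded (g + h).
Proof.
move=> [M hM] [M' hM']; exists (2 * Num.max M M').
have h2 : (1 : R) < 2 by rewrite ltr1n.
apply: filterS3 hM hM' (nt_add g h oW dW h2) => s /= h1 h3 /le_trans; apply.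
by rewrite ler_pM2l// ge_max !le_max h1 h3 orbT.
Qed.

Let bounded_all (h : sect W) : bounded h.
Proof.
have [p <-] := gw h; rewrite /peval.
elim/big_rec: _ => [|m a _ ha]; first by rewrite -(rmorph0 (scal W)); exact: bounded_scal.
apply: boundedD ha; apply: boundedM; first exact: bounded_scal.
elim/big_rec: _ => [|i b _ hb]; first by rewrite -(rmorph1 (scal W)); exact: bounded_scal.
apply: boundedM hb; elim: (m i) => [|e IH].
  by rewrite expr0 -(rmorph1 (scal W)); exact: bounded_scal.
by rewrite exprS; apply: boundedM.
Qed.

Let limit_ex (h : sect W) : exists l : R, nt_val N h s @[s --> F] --> l.
Proof.
have [M hM] := bounded_all h.
apply: (@ultra_bounded_real _ _ _ FU (nt_val N h) M).
by apply: filterS2 hM (nt_ge0 h oW dW) => s /= h1 h2; rewrite ger0_norm.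
Qed.

Let mu (h : sect W) : R := sval (cid (limit_ex h)).
Let muP (h : sect W) : nt_val N h s @[s --> F] --> mu h. Proof. exact: svalP (cid (limit_ex h)). Qed.

Let mu_ge0 h : 0 <= mu h.
Proof. apply: (real_cvg_ge (@muP h)); exact: nt_ge0. Qed.

Let muM g h : mu (g * h) = mu g * mu h.
Proof.
apply: (real_cvg_uniq (@muP (g * h))); apply: cvg_trans (cvgM (@muP g) (@muP h)).
by apply: near_eq_cvg; apply: filterS (nt_mul g h oW dW) => s /= ->.
Qed.

Let mu_scal c : mu (scal W c) = abs_semivaluation (ord_zero c).
Proof. exact: (real_cvg_uniq (@muP (scal W c)) (@nt_scal N W c oW dW)). Qed.

Let muD g h : mu (g + h) <= Num.max (mu g) (mu h).
Proof.
apply/ler_addgt0Pr => e e0; set m := Num.max _ _.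
have m0 : 0 <= m by rewrite le_max mu_ge0.
(* eta and d are such that eta (m + d) <= m + e *)
pose eta := 1 + e / 2 / (m + 1 + e).
have me : 0 < m + 1 + e by rewrite addr_gt0// ltr_wpDl.
have eta1 : 1 < eta by rewrite ltrDl !divr_gt0.
pose d := Num.min 1 (e / 4).
have d0 : 0 < d by rewrite lt_min ltr01 divr_gt0.
have hg : \forall s \near F, nt_val N g s < m + d.
  by apply: cvgr_lt (@muP g) _ _; rewrite (le_lt_trans (_ : _ <= m)) ?ltrDl// le_max lexx.
have hh : \forall s \near F, nt_val N h s < m + d.
  by apply: cvgr_lt (@muP h) _ _; rewrite (le_lt_trans (_ : _ <= m)) ?ltrDl// le_max lexx orbT.
apply: (real_cvg_le (@muP (g + h))); near=> s.
have h1 : nt_val N (g + h) s <= eta * Num.max (nt_val N g s) (nt_val N h s).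
  by near: s; exact: nt_add.
have h2 : Num.max (nt_val N g s) (nt_val N h s) <= m + d.
  by rewrite ge_max; apply/andP; split; apply: ltW; near: s.
apply: le_trans h1 _; apply: le_trans (_ : _ <= eta * (m + d)) _.
  by rewrite ler_pM2l// (lt_trans _ eta1).
have d1 : d <= 1 by rewrite /d ge_min lexx.
have de : d <= e / 4 by rewrite /d ge_min lexx orbT.
rewrite /eta mulrDl mul1r.
have : e / 2 / (m + 1 + e) * (m + d) <= e / 2.
  rewrite -mulrA ler_piMr ?divr_ge0 ?(ltW e0)// mulrC ler_pdivrMr// mul1r.
  lra.
lra.
Unshelve. all: by end_near. Qed.

(** Bounds on the generators bound all sections, so the renormalized values have
    limits along the ultrafilter. These limits are multiplicative, ultrametric and
    extend the absolute value of K: this is the compactness of the set of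
    semivaluations with bounded coordinates. *)
Lemma net_limit : exists P : gpoint X R, [/\ abs_gpoint P, W (gx P) &
  forall h : sect W, nt_val N h s @[s --> F] --> gev P h].
Proof.
have [||||P [hP WP e]] := @abs_gpoint_of _ _ W mu aW.
- split.
  + by rewrite -(rmorph0 (scal W)) mu_scal ord_zero0.
  + by rewrite -(rmorph1 (scal W)) mu_scal ord_zero1 /abs_semivaluation /= oppr0 expR0.
  + exact: muM.
  + move=> f g f0 g0; apply/eqP; rewrite eq_le mu_ge0 andbT.
    by apply: le_trans (muD f g) _; rewrite f0 g0 maxxx.
- exact: mu_ge0.
- exact: muD.
- exact: mu_scal.
by exists P; split=> // h; rewrite e; exact: (@muP h).
Qed.

End Limit.

(** The limit controls the sections on every open containing its center, even
    those not contained in the affine open used to find it. *)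
Lemma net_conv (P : gpoint X R) (W : set X) : is_affine W -> nt_dom N W -> W (gx P) ->
  (forall h : sect W, nt_val N h s @[s --> F] --> gev P h) ->
  forall V, open V -> V (gx P) -> nt_dom N V /\
    forall h : sect V, nt_val N h s @[s --> F] --> gev P h.
Proof.
move=> aW dW WP hN V oV VP; have oW := affine_open aW.
have hm := gev_mpoint oW WP; have hc := gev_centered oW WP.
have key (h : sect V) : nt_dom N V /\ nt_val N h s @[s --> F] --> gev P h.
  have [f [a [_ [n [hf _]]]]] := fraction_ex aW hc h 0 oV VP.
  have [hs [nf ef]] := hf; have oD := principal_open_open f.
  have f0 : F [set s | nt_val N f s != 0].
    have h0 := hN f.
    have fp : 0 < `|gev P f| by rewrite normr_gt0.
    have := h0; move=> /cvgrPdist_lt/(_ _ fp); apply: filterS => s /=.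
    by apply: contraTneq => ->; rewrite subr0 ltxx.
  have dD := nt_principal oW dW f0.
  have dV := nt_up hs dD; split=> //.
  rewrite (gev_stalk aW WP oV VP) (stalk_eval_eq aW hm hf).
  have hl : nt_val N a s / nt_val N f s ^+ n @[s --> F] --> gev P a / gev P f ^+ n.
    apply: cvgM; first exact: hN.
    apply: cvgV; first by rewrite expf_neq0.
    exact: real_cvgX (hN f).
  apply: cvg_trans hl; apply: near_eq_cvg.
  have e1 := nt_restr (principal_open_sub (f := f)) a oW oD dD.
  have e2 := nt_restr hs h oV oD dD.
  have e3 := nt_restr (principal_open_sub (f := f)) f oW oD dD.
  have e4 := nt_exp (restr (principal_open_sub (f := f)) f) n oD dD.
  have e5 := nt_mul (restr hs h) (restr (principal_open_sub (f := f)) f ^+ n) oD dD.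
  apply: filterS2 (filterI e1 (filterI e2 e3)) (filterI e4 (filterI e5 f0)).
  move=> s [E1 [E2 E3]] [E4 [E5 E6]]; move: E1 E2 E3 E4 E5 E6; rewrite /mkset => E1 E2 E3 E4 E5 E6.
  by rewrite -E1 ef E5 E4 E3 E2 mulfK// expf_neq0.
split; first by have [] := key 0.
by move=> h; have [] := key h.
Qed.

End Nets.

(** * Ultrafilters approaching the central fiber *)

Section GermNet.
Variables (R : realType) (X : ringed_space (laurent R)).
Local Notation C := R[i].
Local Notation K := (laurent R).
Variables (S : Type) (E : place R S) (P : gpoint X (germ E)).
Hypothesis hP : ring_gpoint P.
Local Notation F := (pl_filter E).
Local Notation t := (pl_t E).
Let FU : UltraFilter F := pl_ultra E.
Local Existing Instance FU.

Definition germ_abs (x : germ E) (s : S) : R :=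
  cmod (germ_repr x s) `^ hybrid_exponent (t s).

Lemma germ_abs_of (a : S -> C) : F [set s | germ_abs (germ_of E a) s =
  cmod (a s) `^ hybrid_exponent (t s)].
Proof. by apply: filterS (germ_repr_of E a) => s /= e; rewrite /germ_abs e. Qed.

Lemma germ_absM x y : F [set s | germ_abs (x * y) s = germ_abs x s * germ_abs y s].
Proof.
have [[a ->] [b ->]] := (germ_ex x, germ_ex y); rewrite -germ_ofM.
apply: filterS3 (germ_abs_of a) (germ_abs_of b) (germ_abs_of (fun s => a s * b s)).
by move=> s /= -> -> ->; rewrite cmodM powRM ?cmod_ge0.
Qed.

(** |a + b| <= 2 max (|a|, |b|), and the renormalization of 2 tends to 1. *)
Lemma germ_absD x y (eta : R) : 1 < eta ->
  F [set s | germ_abs (x + y) s <= eta * Num.max (germ_abs x s) (germ_abs y s)].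
Proof.
move=> eta1; have [[a ->] [b ->]] := (germ_ex x, germ_ex y); rewrite -germ_ofD.
have h2 : \forall s \near F, (2 : R) `^ hybrid_exponent (t s) < eta.
  apply: cvgr_lt _ _ eta1; apply: (powR_hybrid_cvg1 (pl_to0 E) (l := 2)) => //.
  exact: cvg_cst.
have h3 : F [set s | 0 < hybrid_exponent (t s) < 1] by apply: (hybrid_exponent_small (pl_to0 E)); exact: ltr01.
have h4 : F [set s | (2 : R) `^ hybrid_exponent (t s) < eta /\ 0 < hybrid_exponent (t s) < 1].
  by apply: filterS2 h2 h3.
have h5 : F [set s | germ_abs (germ_of E a) s = cmod (a s) `^ hybrid_exponent (t s) /\
    germ_abs (germ_of E b) s = cmod (b s) `^ hybrid_exponent (t s)].
  by apply: filterS2 (germ_abs_of a) (germ_abs_of b).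
apply: filterS3 h4 h5 (germ_abs_of (fun s => a s + b s)).
move=> s /= [e2 /andP[e0 _]] [-> ->] ->.
set u := cmod (a s); set v := cmod (b s); set e := hybrid_exponent (t s).
have u0 : 0 <= u by exact: cmod_ge0.
have v0 : 0 <= v by exact: cmod_ge0.
have m0 : 0 <= Num.max u v by rewrite le_max u0.
have h : cmod (a s + b s) <= 2 * Num.max u v.
  apply: le_trans (cmodD _ _) _; rewrite mulr_natl mulr2n lerD//.
    by rewrite le_max lexx.
  by rewrite le_max lexx orbT.
apply: (@le_trans _ _ ((2 * Num.max u v) `^ e)).
  by apply: (ge0_ler_powR (ltW e0)); rewrite ?nnegrE ?cmod_ge0// mulr_ge0.
rewrite powRM//.
have -> : Num.max u v `^ e = Num.max (u `^ e) (v `^ e).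
  have [uv|vu] := leP u v.
    by rewrite max_r//; apply: (ge0_ler_powR (ltW e0)); rewrite ?nnegrE.
  by rewrite max_l//; apply: (ge0_ler_powR (ltW e0)); rewrite ?nnegrE ?(ltW vu).
by rewrite ler_wpM2r ?(ltW e2)// le_max powR_ge0.
Qed.

Lemma germ_abs_neq0 x : F [set s | germ_abs x s != 0] -> x != 0.
Proof.
move=> h; apply/eqP => x0.
have h1 := germ_abs_of (fun=> 0); rewrite germ_of0 -x0 in h1.
have h3 : F [set s | 0 < hybrid_exponent (t s) < 1] by apply: (hybrid_exponent_small (pl_to0 E)); exact: ltr01.
have /filter_ex[s [/eqP h4 [h5 /andP[h6 _]]]] : F ([set s | germ_abs x s != 0] `&`
  ([set s | germ_abs x s = cmod (0 : C) `^ hybrid_exponent (t s)] `&`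
   [set s | 0 < hybrid_exponent (t s) < 1])).
  by apply: filterI h _; exact: filterI.
have z0 : cmod (0 : C) = 0 by exact: cmod0.
by apply: h4; rewrite h5 z0 powR0// gt_eqF.
Qed.

Lemma germ_abs_scal (c : K) :
  germ_abs (germ_laurent E c) s @[s --> F] --> abs_semivaluation (ord_zero c).
Proof.
have h : cmod (laurent_eval (t s) c) `^ hybrid_exponent (t s) @[s --> F] -->
    abs_semivaluation (ord_zero c) by apply: laurent_eval_cvg; exact: pl_to0.
apply: cvg_trans h; apply: near_eq_cvg.
by apply: filterS (germ_abs_of (fun s => laurent_eval (t s) c)) => s /= <-.
Qed.

Lemma germ_abs1 : F [set s | germ_abs 1 s = 1].
Proof. by apply: filterS (germ_abs_of (fun=> 1)) => s e; rewrite /mkset e cmod1 powR1. Qed.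

(** A family of points of the degeneration is one point over the field of germs. *)
Definition germ_net : net X F.
Proof.
apply: (@Net _ _ _ _ (fun W => W (gx P)) (fun W h => germ_abs (gev P h))).
- by move=> W h _ _; apply: filterE => s; exact: powR_ge0.
- by move=> W g h oW Wx; rewrite (gevM _ _ oW Wx); exact: germ_absM.
- move=> W g h eta oW Wx eta1; have [hD _] := hP; rewrite hD//; exact: germ_absD.
- by move=> W oW Wx; rewrite (gev1 oW Wx); exact: germ_abs1.
- by move=> W c oW Wx; have [_ hs] := hP; rewrite hs//; exact: germ_abs_scal.
- by move=> W W' u h oW oW' Wx; rewrite gev_restr//; exact: filterE.
- by move=> W W' s Wx; exact: s.
- by [].
- by move=> W h oW Wx /germ_abs_neq0; move/(gev_neq0 h oW Wx).
- by move=> I V cV; have : (\bigcup_i V i) (gx P) by [rewrite cV]; move=> [i _ Vi]; exists i.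
Defined.

End GermNet.

Section BerkovichNet.
Variables (R : realType) (X : ringed_space (laurent R)).
Variables (S : Type) (F : set_system S) (FU : UltraFilter F).
Variables (Q : S -> gpoint X R).
Hypothesis hQ : forall s, abs_gpoint (Q s).
Local Existing Instance FU.

(** A family of points of the central fiber, with their absolute values. *)
Definition berkovich_net : net X F.
Proof.
apply: (@Net _ _ _ _ (fun W => F [set s | W (gx (Q s))]) (fun W h s => gev (Q s) h)).
- by move=> W h oW; apply: filterS => s Wx /=; have [] := hQ oW Wx.
- by move=> W g h oW; apply: filterS => s Wx /=; exact: gevM.
- move=> W g h eta oW; move=> dW eta1; move: dW; apply: filterS => s Wx /=.
  have [h0 hD _] := hQ oW Wx; apply: le_trans (hD _ _) _.
  by rewrite ler_peMl ?(ltW eta1)// le_max h0.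
- by move=> W oW; apply: filterS => s Wx /=; exact: gev1.
- move=> W c oW dW; apply: (@cvg_trans _ ((fun=> abs_semivaluation (ord_zero c)) @ F)).
    apply: near_eq_cvg; move: dW; apply: filterS => s Wx /=.
    by have [_ _ ->] := hQ oW Wx.
  exact: cvg_cst.
- by move=> W W' u h oW oW'; apply: filterS => s Wx /=; exact: gev_restr.
- by move=> W W' u; apply: filterS => s; exact: u.
- by move=> W W' h1 h2; apply: filterS2 h1 h2 => s.
- move=> W h oW dW h0; apply: filterS2 dW h0 => s /= Wx; exact: (proj1 (gev_neq0 h oW Wx)).
- move=> I V cV; apply: (ultra_finite FU); apply: filterE => s.
  by have : (\bigcup_i V i) (gx (Q s)) by [rewrite cV]; move=> [i _ Vi]; exists i.
Defined.

End BerkovichNet.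

Section HybridNets.
Variables (R : realType) (X : ringed_space (laurent R)).
Local Notation C := R[i].
Local Notation K := (laurent R).
Hypothesis sepX : Defs.separated X.
Variables (A : atlas X) (r : R).
Hypothesis good : good_radius A r.
Local Notation H := (hybrid A r).
Local Notation U i := (chart (a := A) i).
Local Notation fiber i t x := (chart_fiber (A := A) r (i := i) t x).
Local Notation basic j p s W := (@hybrid_basic _ _ A r (U j) (fun i => trans i j) p s W).
Local Notation proj := (@hybrid_proj R X A r).

Definition has_coord i (z : H) (x : 'rV[C]_(dim (U i))) :=
  exists h : fiber i (proj z) x, z = inl (degeneration_pt h).

Lemma has_coord_ex (c : degeneration A r) : exists i x, @has_coord i (inl c) x.
Proof.
have [i [t [x [h ->]]]] := degeneration_ex c; exists i, x.
have e : proj (inl (degeneration_pt h)) = t by exact: hybrid_proj_inl.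
rewrite /has_coord; rewrite e; by exists h.
Qed.

Lemma has_coord_trans i j z x y : @has_coord i z x -> @has_coord j z y ->
  zeros_at (proj z) (trans i j) (row_mx x y).
Proof.
move=> [h e] [h' e'].
have [e2] : (inl (degeneration_pt h) : H) = inl (degeneration_pt h') by rewrite -e -e'.
by have [_] := proj1 (degeneration_eq good h h') e2.
Qed.

Lemma basic_has_coord j p s W c : basic j p s W (inl c) -> exists y,
  [/\ @has_coord j (inl c) y, cmod (proj (inl c)) < s &
      W (cmod (poly_at (proj (inl c)) p y) `^ hybrid_exponent (proj (inl c)))].
Proof.
move=> /(basic_inl good)[t [y [h [-> ts hW]]]]; exists y.
have e : proj (inl (degeneration_pt h)) = t by exact: hybrid_proj_inl.
by rewrite /has_coord e; split=> //; exists h.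
Qed.

Variables (F : set_system H) (FU : UltraFilter F).
Local Existing Instance FU.

Lemma ultra_coord : F (range inl) -> exists i (x : H -> 'rV[C]_(dim (U i))),
  F [set z | has_coord z (x z)].
Proof.
move=> hF; have [i hi] : exists i, F [set z | exists x, @has_coord i z x].
  apply: (ultra_finite FU); apply: filterS hF => _ [c _ <-].
  by have [i [x hx]] := has_coord_ex c; exists i => //; exists x.
exists i, (fun z => xget 0 [set x | has_coord z x]).
by apply: filterS hi => z /= [x hx]; case: xgetP => [y _|/(_ x)].
Qed.

Lemma ultra_inl_or_inr : F (range inl) \/ F (range inr).
Proof.
have [|h] := in_ultra_setVsetC (range inl : set H) FU; first by left.
right; apply: filterS h => -[c|b] h; last by exists b.
by exfalso; apply: h; exists c.
Qed.

Hypothesis F0 : tends F proj 0.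

Lemma inl_to0 : F (range inl) -> to0 F proj.
Proof.
move=> hF d d0; apply: filterS2 hF (F0 d0) => _ [c _ <-].
have [i [t [x [h ->]]]] := degeneration_ex c.
have e : proj (inl (degeneration_pt h)) = t by exact: hybrid_proj_inl.
by rewrite /mkset e subr0 => ->; have [/andP[-> _] _] := h.
Qed.

(** A net attached to an ultrafilter of the hybrid space converging to the
    central fiber: its limits are limits in the hybrid topology, and the basic
    open sets of the atlas can be read off it. *)
Definition hybrid_net (N : net X F) :=
  (forall b P, berk_point b P ->
     (forall V, open V -> V (gx P) -> nt_dom N V /\
        forall h : sect V, nt_val N h s @[s --> F] --> gev P h) ->
     F --> (inr b : H)) /\
  (forall j p s W, F (basic j p s W) -> nt_dom N (dom (U j)) /\
     F [set z | W (nt_val N (peval (scal (dom (U j))) (@coord _ _ (U j)) p) z)]).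

Lemma hybrid_net_inl : F (range inl) -> exists N, hybrid_net N.
Proof.
move=> hF; pose E := Place FU (inl_to0 hF).
have [i [x hx]] := ultra_coord hF.
have hxx : F [set z | zeros_at (proj z) (trans i i) (row_mx (x z) (x z))].
  by apply: filterS hx => z hz; exact: (has_coord_trans hz (hz)).
have [P [hP Px _]] := @trans_gpoint _ _ sepX A _ E i i x x hxx.
exists (germ_net hP); split.
- move=> b Q hQ hN; apply: hybrid_cvg => B; case=> [[V oV ->] [c Vc]//|].
  move=> [d [G [p [s [W [hG [_ _] [s0 oW] -> _]]]]]].
  move=> /(proj1 (@hybrid_basic_inr R X A r b Q d G p s W sepX hQ))[dQ hW].
  have [dP hval] := hN _ (affine_open (dom_affine d)) dQ.
  have [y Py] := at_chart_ex dP.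
  have h1 : F [set z | W (germ_abs (gev P (peval (scal (dom d)) (@coord _ _ d) p)) z)].
    by apply: (hval (peval (scal (dom d)) (@coord _ _ d) p)); exact: open_nbhs_nbhs.
  rewrite (at_chart_peval p hP Py) in h1.
  have h2 := germ_abs_of E (fun z => poly_at (proj z) p (y z)).
  have h3 : F [set z | zeros_at (proj z) (G i) (row_mx (x z) (y z))].
    exact: (proj1 (overlap_zeroP E x y (hG i)) (at_chart_overlap sepX hP Px Py)).
  have h4 : F [set z | cmod (proj z) < s].
    by apply: filterS (F0 s0) => z /=; rewrite subr0.
  have h12 : F [set z | W (cmod (poly_at (proj z) p (y z)) `^ hybrid_exponent (proj z))].
    by apply: filterS2 h1 h2 => z /= + <-.
  have h34 : F [set z | zeros_at (proj z) (G i) (row_mx (x z) (y z)) /\ cmod (proj z) < s].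
    by apply: filterS2 h3 h4.
  apply: filterS3 hx h12 h34 => z [h ez] /= hz [z1 z2].
  suff : hybrid_basic G p s W (inl (degeneration_pt h) : H) by rewrite -ez.
  by exists i, (proj z), (x z), h, (y z).
- move=> j p s W hB.
  have hB' : F [set z | exists y, @has_coord j z y /\
      W (cmod (poly_at (proj z) p y) `^ hybrid_exponent (proj z))].
    apply: filterS2 (hF) hB => _ [c _ <-] /basic_has_coord[y [h1 _ h2]].
    by exists y.
  pose Py z : set 'rV[C]_(dim (U j)) := [set y | @has_coord j z y /\
      W (cmod (poly_at (proj z) p y) `^ hybrid_exponent (proj z))].
  pose y z := xget 0 (Py z).
  have hy : F [set z | Py z (y z)].
    by apply: filterS hB' => z hz; exact: (xgetPex 0 hz).
  have hxy : F [set z | zeros_at (proj z) (trans i j) (row_mx (x z) (y z))].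
    by apply: filterS2 hx hy => z h1 [h2 _]; exact: has_coord_trans h1 h2.
  have [Q [hQ Qx Qy]] := @trans_gpoint _ _ sepX A _ E i j x y hxy.
  have Pj := at_chart_transfer hP hQ Px Qx Qy.
  split; first by case: Pj.
  have h2 := germ_abs_of E (fun z => poly_at (proj z) p (y z)).
  rewrite -(at_chart_peval p hP Pj) in h2.
  by apply: filterS2 h2 hy => z e [_ hW]; rewrite /mkset [nt_val _ _ _]e.
Qed.

Lemma hybrid_net_inr : F (range inr) -> exists N, hybrid_net N.
Proof.
move=> hF; have [_ [b0 _ _]] := filter_ex hF.
(* the value on points of the degeneration, which the ultrafilter avoids, is arbitrary *)
pose Q (z : H) : gpoint X R := match z with
  | inl _ => sval (cid (berk_point_ex b0)) | inr b => sval (cid (berk_point_ex b)) end.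
have hQ b : berk_point b (Q (inr b)) by exact: (svalP (cid (berk_point_ex b))).
have aQ s : abs_gpoint (Q s).
  case: s => [c|b]; last by case: (hQ b).
  by have := hQ b0; case.
exists (berkovich_net FU aQ); split.
- move=> b P hP hN; apply: hybrid_cvg => B; case=> [[V oV ->] [c Vc]//|].
  move=> [d [G [p [s [W [hG [_ _] [s0 oW] -> _]]]]]].
  move=> /(proj1 (@hybrid_basic_inr R X A r b P d G p s W sepX hP))[dP hW].
  have [dN hval] := hN _ (affine_open (dom_affine d)) dP.
  have h1 : F [set z | W (gev (Q z) (peval (scal (dom d)) (@coord _ _ d) p))].
    by apply: (hval (peval (scal (dom d)) (@coord _ _ d) p)); exact: open_nbhs_nbhs.
  have dN' : F [set z | dom d (gx (Q z))] by exact: dN.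
  apply: filterS3 hF dN' h1 => _ [b' _ <-] h1 h2.
  by apply: (proj2 (@hybrid_basic_inr R X A r b' (Q (inr b')) d G p s W sepX (hQ b'))).
- move=> j p s W hB.
  have hB' : F [set z | dom (U j) (gx (Q z)) /\
      W (gev (Q z) (peval (scal (dom (U j))) (@coord _ _ (U j)) p))].
    apply: filterS2 hF hB => _ [b _ <-].
    exact: (proj1 (@hybrid_basic_inr R X A r b (Q (inr b)) (U j) (fun i => trans i j) p s W sepX (hQ b))).
  have h1 : F [set z | dom (U j) (gx (Q z))] by apply: filterS hB' => z [].
  split; first exact: h1.
  by apply: (@filterS _ F) hB' => z [_ h2].
Qed.

Lemma hybrid_net_ex : exists N, hybrid_net N.
Proof.
by have [|] := ultra_inl_or_inr; [exact: hybrid_net_inl|exact: hybrid_net_inr].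
Qed.

End HybridNets.

(** * Separation *)

Section Separation.
Variables (R : realType) (X : ringed_space (laurent R)).
Local Notation C := R[i].
Local Notation K := (laurent R).
Hypothesis sepX : Defs.separated X.
Variables (A : atlas X) (r : R).
Hypothesis good : good_radius A r.
Local Notation H := (hybrid A r).
Local Notation U i := (chart (a := A) i).
Local Notation fiber i t x := (chart_fiber (A := A) r (i := i) t x).
Local Notation basic j p s W := (@hybrid_basic _ _ A r (U j) (fun i => trans i j) p s W).
Local Notation proj := (@hybrid_proj R X A r).

Lemma proj_tends (F : set_system H) (FF : Filter F) (z : H) : F --> z -> tends F proj (proj z).
Proof.
move=> Fz e e0; apply: Fz.
have := hybrid_proj_continuous good sepX (x := z).
move=> /(_ [set t | cmod (t - proj z) < e]); apply.
by apply/nbhsC; exists e.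
Qed.

Lemma basic_nbhs_inr b P j p s W : berk_point b P -> dom (U j) (gx P) ->
  0 < s <= r -> poly_good s p -> open W ->
  W (gev P (peval (scal (dom (U j))) (@coord _ _ (U j)) p)) ->
  nbhs (inr b : H) (basic j p s W).
Proof.
move=> hP jP hs hp oW hW; apply: open_nbhs_nbhs; split.
  exact: (basic_open good hs hp oW).
by apply: (proj2 (@hybrid_basic_inr R X A r b P (U j) (fun i => trans i j) p s W sepX hP)).
Qed.

(** A limit in the central fiber is in particular a limit for the basic sets of the
    charts of the atlas, which test the sections of these charts. *)
Lemma net_at_inr (F : set_system H) (FU : UltraFilter F) (N : net X F) b P j :
  hybrid_net N -> F --> (inr b : H) -> berk_point b P -> dom (U j) (gx P) ->
  nt_dom N (dom (U j)) /\
  forall h : sect (dom (U j)), nt_val N h s @[s --> F] --> gev P h.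
Proof.
move=> [_ hC] Fb hP jP.
have r0 : 0 < r by have /andP[] := good01 good.
split.
  have [] // := hC j 1 r setT; apply: Fb.
  apply: (basic_nbhs_inr hP jP _ (good_one good j)) => //; first by rewrite r0 lexx.
  exact: openT.
move=> h; have [p <-] := coord_generates h.
move=> W; rewrite nbhsE => -[W' [oW' W'h] sW].
have [s hs [hp _]] := poly_good_radius good p ltr01.
have [_] := hC j p s W' (Fb _ (basic_nbhs_inr hP jP hs hp oW' W'h)).
by apply: filterS => z /sW.
Qed.

(** Let [b] be in U_i and [b'] in U_j. Along the net the coordinates of both charts
    converge, hence are bounded, and by separation they generate the sections of the
    affine open where U_i meets U_j. The net therefore has a limit there, and this
    limit agrees with [b] on U_i and with [b'] on U_j. *)
Lemma inr_unique (F : set_system H) (FU : UltraFilter F) b b' :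
  F --> (inr b : H) -> F --> (inr b' : H) -> b = b'.
Proof.
move=> Fb Fb'.
have F0 : tends F proj 0 by exact: (proj_tends _ Fb).
have [N hN] := hybrid_net_ex sepX good FU F0.
have [[P hP] [P' hP']] := (berk_point_ex b, berk_point_ex b').
have [[i iP] [j jP']] := (chart_at A (gx P), chart_at A (gx P')).
have [dI hI] := net_at_inr FU hN Fb hP iP.
have [dJ hJ] := net_at_inr FU hN Fb' hP' jP'.
have [aW _] := sepX (dom_affine (U i)) (dom_affine (U j)).
have oW := affine_open aW.
have oI := affine_open (dom_affine (U i)); have oJ := affine_open (dom_affine (U j)).
have dW := nt_setI dI dJ.
have resI (h : sect (dom (U i))) : nt_val N (restr (@subIsetl _ (dom (U i)) (dom (U j))) h) s @[s --> F] --> gev P h.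
  apply: cvg_trans (hI h); apply: near_eq_cvg.
  by apply: filterS (nt_restr (@subIsetl _ (dom (U i)) (dom (U j))) h oI oW dW) => s /= ->.
have resJ (h : sect (dom (U j))) : nt_val N (restr (@subIsetr _ (dom (U i)) (dom (U j))) h) s @[s --> F] --> gev P' h.
  apply: cvg_trans (hJ h); apply: near_eq_cvg.
  by apply: filterS (nt_restr (@subIsetr _ (dom (U i)) (dom (U j))) h oJ oW dW) => s /= ->.
have bounded (a : H -> R) (l : R) : a s @[s --> F] --> l -> exists M, F [set s | a s <= M].
  move=> al; exists (l + 1).
  have : \forall s \near F, a s < l + 1 by apply: cvgr_lt al _ _; rewrite ltrDl.
  by apply: filterS => s /ltW.
have [|Q [hQ WQ eQ]] := net_limit FU aW dW (overlap_coord_gen sepX (c := U i) (d := U j)).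
  move=> l; rewrite /overlap_coord; case: fintype.split => m.
    exact: bounded (resI (coord m)).
  exact: bounded (resJ (coord m)).
have [iQ jQ] := WQ.
have [b0 hb0] : exists b0, berk_point b0 Q.
  by apply: berk_of_point => //; exists (dom (U i)) => //; exact: dom_affine.
have eI : gev P (W := dom (U i)) =1 gev Q (W := dom (U i)).
  move=> h; rewrite -(gev_restr (@subIsetl _ (dom (U i)) (dom (U j))) h oW WQ).
  exact: (real_cvg_uniq FU (resI h) (eQ _)).
have eJ : gev P' (W := dom (U j)) =1 gev Q (W := dom (U j)).
  move=> h; rewrite -(gev_restr (@subIsetr _ (dom (U i)) (dom (U j))) h oW WQ).
  exact: (real_cvg_uniq FU (resJ h) (eQ _)).
rewrite (berk_point_inj sepX (dom_affine (U i)) hP hb0 iP iQ eI).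
by rewrite (berk_point_inj sepX (dom_affine (U j)) hP' hb0 jP' jQ eJ).
Qed.

(** An equation of the overlap that is nonzero at [(x, y)] is nonzero on a product
    of neighborhoods of [x] and [y], which are then disjoint. *)
Lemma inl_unique (F : set_system H) (FU : UltraFilter F) c c' :
  F --> (inl c : H) -> F --> (inl c' : H) -> c = c'.
Proof.
have [i [t [x [h ->]]]] := degeneration_ex c.
have [j [t' [y [h' ->]]]] := degeneration_ex c'.
move=> Fc Fc'.
have et : t = t'.
  rewrite -(hybrid_proj_inl good h) -(hybrid_proj_inl good h').
  exact: (tends_uniq (proj_tends _ Fc) (proj_tends _ Fc')).
subst t'; apply/(degeneration_eq good); split=> // g gT.
apply/eqP/negPn/negP => g0; have [tr _] := h.
have [_ hg] := good_trans good gT.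
have [ht hxy] := nbhs_row_tends t (row_mx x y).
have h1 : tends (nbhs (t, row_mx x y)) (fun z => poly_at z.1 g z.2) (poly_at t g (row_mx x y)).
  exact: hg.
have e0 : 0 < cmod (poly_at t g (row_mx x y)) by rewrite cmod_gt0.
have /nbhsC_row[e e1 he] := h1 _ e0.
pose N n (u : 'rV[C]_n) (t1 : C) (x1 : 'rV[C]_n) := cmod (t1 - t) < e /\
  forall l, cmod (x1 0 l - u 0 l) < e.
have oN n (u : 'rV[C]_n) : coord_open (N n u).
  move=> t1 x1 [n1 n2]; apply/(nbhsC_row t1 x1 (fun z => N n u z.1 z.2)).
  have [ht1 hx1] := nbhs_row_tends t1 x1.
  have m1 : nbhs (t1, x1) [set z | cmod (z.1 - t) < e].
    by apply: tends_cmod_lt n1; apply: tendsB => //; exact: tends_cst.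
  have m2 : nbhs (t1, x1) [set z : C * 'rV[C]_n | forall l, cmod (z.2 0 l - u 0 l) < e].
    apply: (@filter_forall _ _ (fun l (z : C * 'rV[C]_n) => cmod (z.2 0 l - u 0 l) < e) (nbhs (t1, x1))) => l.
    by apply: tends_cmod_lt (n2 l); apply: tendsB => //; exact: tends_cst.
  by apply: filterS2 m1 m2.
have near_in k (u : 'rV[C]_(dim (U k))) (hk : fiber k t u) :
    nbhs (inl (degeneration_pt hk) : H) (inl @` chart_set (N _ u)).
  apply: open_nbhs_nbhs; split; first exact: (inl_open (chart_set_open good (oN _ u))).
  exists (degeneration_pt hk) => //; exists t, u, hk; split=> //.
  by split=> [|l]; rewrite subrr cmod0.
have /filter_ex[_ [[_ [t1 [x1 [h1' [-> [n1 n2]]]]] <-] [_ [t2 [y2 [h2' [-> [m1 m2]]]]] [e2]]]] :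
    F ((inl @` chart_set (N _ x)) `&` (inl @` chart_set (N _ y))).
  by apply: filterI; [exact: Fc (near_in _ _ h)|exact: Fc' (near_in _ _ h')].
have [et z] := proj1 (degeneration_eq good h1' h2') (esym e2).
have hh l : cmod (row_mx x1 y2 0 l - row_mx x y 0 l) < e.
  by case: (split_ordP l) => m ->; rewrite ?row_mxEl ?row_mxEr.
have : cmod (poly_at t1 g (row_mx x1 y2) - poly_at t g (row_mx x y)) <
    cmod (poly_at t g (row_mx x y)) := he t1 (row_mx x1 y2) n1 hh.
by rewrite z// sub0r cmodN ltxx.
Qed.

(** Two points that cannot be separated are limits of one ultrafilter. *)
Lemma hybrid_hausdorff : hausdorff_space H.
Proof.
move=> p q; rewrite cluster_cvgE => -[G PG [Gq pG]].
have [F [FU GF]] := ultraFilterLemma PG.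
have Fq : F --> q by move=> B /Gq/GF.
have Fp : F --> p by move=> B /pG/GF.
have inl_inr c b : F --> (inl c : H) -> F --> (inr b : H) -> False.
  have [i [t [x [h ->]]]] := degeneration_ex c.
  move=> F1 F2; have := tends_uniq (proj_tends _ F1) (proj_tends _ F2).
  rewrite (hybrid_proj_inl good h); have [/andP[t0 _] _] := h => te.
  by move: t0; rewrite cmod_gt0 te /= eqxx.
case: p q Fp Fq {Gq pG} => [c|b] [c'|b'] Fp Fq.
- by rewrite (inl_unique FU Fp Fq).
- by case: (inl_inr _ _ Fp Fq).
- by case: (inl_inr _ _ Fq Fp).
- by rewrite (inr_unique FU Fp Fq).
Qed.

End Separation.

(** * Local compactness *)

Section LocalCompactness.
Variables (R : realType) (X : ringed_space (laurent R)).
Local Notation C := R[i].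
Local Notation K := (laurent R).
Hypothesis sepX : Defs.separated X.
Variables (A : atlas X) (r : R).
Hypothesis good : good_radius A r.
Local Notation H := (hybrid A r).
Local Notation U i := (chart (a := A) i).
Local Notation fiber i t x := (chart_fiber (A := A) r (i := i) t x).
Local Notation basic j p s W := (@hybrid_basic _ _ A r (U j) (fun i => trans i j) p s W).
Local Notation proj := (@hybrid_proj R X A r).
Local Notation Xv i l := (mpolyX K (mnm1 l) : mpoly (dim (U i)) K).

Lemma poly_at_coord i l (t : C) (x : 'rV[C]_(dim (U i))) : 0 < cmod t < r ->
  poly_at t (Xv i l) x = x 0 l.
Proof.
move=> tr; rewrite /poly_at /peval msuppX big_seq1 mcoeffX eqxx (good_eval1 good)// mul1r.
rewrite (bigD1 l)//= mnm1E eqxx expr1 big1 ?mulr1// => m ml.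
by rewrite mnm1E eq_sym (negPf ml) expr0.
Qed.

(** These are the compact neighborhoods: renormalized absolute values are defined
    on all fibers, so that one bound on coordinates cuts out a closed polydisc
    in every fiber. The set attached to the constant 1 is the chart itself. *)
Definition polydisc i (s M : R) : set H := [set z | [/\ cmod (proj z) <= s,
  basic i 1 r setT z & forall l, basic i (Xv i l) r [set a | a <= M] z]].

Lemma has_coord_uniq i z x y : has_coord (A := A) (r := r) (i := i) z x -> has_coord z y -> x = y.
Proof.
move=> hx hy; have hz := has_coord_trans good hx hy.
by have [[tr _] _] := hx; exact: (good_uniq good tr hz).
Qed.

Lemma has_coord_fiber i z x : has_coord (A := A) (r := r) (i := i) z x -> fiber i (proj z) x.
Proof. by case. Qed.

Lemma polydisc_coord i s M c : polydisc i s M (inl c) ->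
  exists x, has_coord (i := i) (inl c : H) x /\
    forall l, cmod (x 0 l) `^ hybrid_exponent (proj (inl c)) <= M.
Proof.
move=> [_ h1 hl]; have [x [hx _ _]] := basic_has_coord good h1.
exists x; split=> // l; have [y [hy _ hM]] := basic_has_coord good (hl l).
rewrite -(has_coord_uniq hx hy) in hM.
by move: hM; rewrite poly_at_coord//; have [] := has_coord_fiber hx.
Qed.

(** The exponent varies with the parameter, and the bound must not depend on it. *)
Lemma powR_le_bound (a e e0 M : R) : 0 <= a -> 0 < e0 -> e0 / 2 <= e -> a `^ e <= M ->
  a <= Num.max 1 (M `^ (e0 / 2)^-1).
Proof.
move=> a0 e00 ee aM; rewrite le_max; have [//|a1 /=] := leP a 1.
have h2 : 0 < e0 / 2 by rewrite divr_gt0.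
have h3 : a `^ (e0 / 2) <= M.
  by apply: le_trans aM; apply: ler_powR ee; exact: ltW.
have -> : a = (a `^ (e0 / 2)) `^ (e0 / 2)^-1.
  by rewrite -powRrM mulfV ?lt0r_neq0// powRr1.
by apply: ge0_ler_powR; rewrite ?nnegrE ?invr_ge0 ?(ltW h2) ?powR_ge0// (le_trans _ h3) ?powR_ge0.
Qed.

Lemma row_limit (S : Type) (F : set_system S) (FU : UltraFilter F) n (x : S -> 'rV[C]_n) (M : R) :
  F [set s | forall l, cmod (x s 0 l) <= M] ->
  exists x0 : 'rV[C]_n, forall l, tends F (fun s => x s 0 l) (x0 0 l).
Proof.
move=> h; have hl l : exists a, tends F (fun s => x s 0 l) a.
  by apply: (@ultra_bounded _ _ _ FU (fun s => x s 0 l) M); apply: filterS h => s; exact.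
exists (\row_l sval (cid (hl l))) => l; rewrite mxE; exact: svalP (cid (hl l)).
Qed.

Lemma tends_neq0_inl (F : set_system H) (FF : Filter F) t0 : t0 != 0 -> tends F proj t0 ->
  F (range inl).
Proof.
move=> t00 ht; have e0 : 0 < cmod t0 by rewrite cmod_gt0.
apply: filterS (ht _ e0) => -[c _|b]; first by exists c.
move=> h; have : cmod (0 - t0) < cmod t0 := h.
by rewrite sub0r cmodN ltxx.
Qed.

(** Along an ultrafilter the parameter converges. If its limit is not 0, the
    coordinates are bounded, and their limit is a point of the closed fiber. If it
    is 0, the limit is the absolute value provided by [net_limit]. *)
Lemma polydisc_compact i s M : s < r -> compact (polydisc i s M).
Proof.
move=> sr; rewrite compact_ultra => F FU FP.
have [r0 r1] := andP (good01 good).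
have [t0 ht] : exists t0, tends F proj t0.
  by apply: (@ultra_bounded _ _ _ FU proj s); apply: filterS FP => z [].
have t0s : cmod t0 <= s by apply: (tends_le ht); apply: filterS FP => z [].
have [t00|t00] := eqVneq t0 0; last first.
  have tr : 0 < cmod t0 < r by rewrite cmod_gt0 t00 (le_lt_trans t0s).
  have t01 : 0 < cmod t0 < 1 by have /andP[-> h] := tr; rewrite (lt_trans h).
  have Fi : F (range inl) by exact: (tends_neq0_inl _ t00 ht).
  pose Px z : set 'rV[C]_(dim (U i)) := [set x | has_coord (i := i) z x /\
    forall l, cmod (x 0 l) `^ hybrid_exponent (proj z) <= M].
  pose x z := xget 0 (Px z).
  have hx : F [set z | Px z (x z)].
    apply: filterS2 Fi FP => _ [c _ <-] /polydisc_coord hc.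
    exact: (xgetPex 0 hc).
  have e00 := hybrid_exponent_gt0 t01.
  have he : hybrid_exponent (proj z) @[z --> F] --> hybrid_exponent t0.
    exact: (hybrid_exponent_tends _ t01 ht).
  have hb : F [set z | hybrid_exponent t0 / 2 <= hybrid_exponent (proj z)].
    have lt2 : hybrid_exponent t0 / 2 < hybrid_exponent t0 by lra.
    have : \forall z \near F, hybrid_exponent t0 / 2 < hybrid_exponent (proj z).
      exact: cvgr_gt he _ lt2.
    by apply: filterS => z /ltW.
  have [x0 hx0] : exists x0 : 'rV[C]_(dim (U i)), forall l, tends F (fun z => x z 0 l) (x0 0 l).
    apply: (@row_limit _ _ FU _ x (Num.max 1 (M `^ (hybrid_exponent t0 / 2)^-1))).
    apply: filterS2 hx hb => z [_ hz] hzb l.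
    exact: (powR_le_bound (cmod_ge0 _) e00 hzb (hz l)).
  have hfib : F [set z | fiber i (proj z) (x z)].
    by apply: filterS hx => z [hz _]; exact: has_coord_fiber hz.
  have h0 : fiber i t0 x0 by exact: (fiber_closed good hfib tr ht hx0).
  have hc : F [set z | exists h : fiber i (proj z) (x z), z = inl (degeneration_pt h)].
    by apply: filterS hx => z [].
  exists (inl (degeneration_pt h0)); split; last exact: inl_cvg hc ht hx0.
  have hcoord : has_coord (i := i) (inl (degeneration_pt h0) : H) x0.
    by rewrite /has_coord (hybrid_proj_inl good h0); exists h0.
  split; first by rewrite (hybrid_proj_inl good h0).
    by apply/(basic_inl good); exists t0, x0, h0; split=> //; have /andP[] := tr.
  move=> l; apply/(basic_inl good); exists t0, x0, h0; split=> //.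
    by have /andP[] := tr.
  rewrite /mkset poly_at_coord//.
  apply: (real_cvg_le FU (powR_cmod_tends _ t01 ht (hx0 l))).
  by apply: filterS hx => z [_]; exact.
rewrite t00 in ht t0s.
have [N hN] := hybrid_net_ex sepX good FU ht.
have [hA hC] := hN.
have [dU _] : nt_dom N (dom (U i)) /\ F [set z | setT (nt_val N (peval (scal (dom (U i))) (@coord _ _ (U i)) 1) z)].
  by apply: hC 1 r _ _; apply: filterS FP => z [].
have hM l : F [set z | nt_val N (coord (a := U i) l) z <= M].
  have [_] : nt_dom N (dom (U i)) /\ F [set z | [set a | a <= M] (nt_val N (peval (scal (dom (U i))) (@coord _ _ (U i)) (Xv i l)) z)].
    by apply: (hC i _ r); apply: filterS FP => z [].
  by rewrite pevalX.
have oU := affine_open (dom_affine (U i)).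
have [|P [hP UP eP]] := net_limit FU (dom_affine (U i)) dU (@coord_generates _ _ (U i)).
  by move=> l; exists M.
have [b hb] : exists b, berk_point b P.
  by apply: berk_of_point => //; exists (dom (U i)) => //; exact: dom_affine.
exists (inr b); split; last first.
  exact: (hA b P hb (net_conv FU (dom_affine (U i)) dU UP eP)).
split; first by rewrite /= in t0s *.
  exact: (proj2 (@hybrid_basic_inr R X A r b P (U i) (fun j => trans j i) 1 r setT sepX hb) (conj UP I)).
move=> l; apply: (proj2 (@hybrid_basic_inr R X A r b P (U i) (fun j => trans j i) _ r _ sepX hb)).
by split=> //; rewrite pevalX; exact: (real_cvg_le FU (eP _) (hM l)).
Qed.

Lemma finite_bound n (a : 'I_n -> R) : exists M, forall l, a l < M.
Proof.
exists (1 + \sum_l `|a l|) => l; rewrite (bigD1 l)//=.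
have h1 := ler_norm (a l).
have h2 : 0 <= \sum_(i < n | i != l) `|a i| by apply: sumr_ge0.
by rewrite ltr_pwDl// ler_wpDr.
Qed.

Lemma polydisc_nbhs z : exists i s M, s < r /\ nbhs (z : H) (polydisc i s M).
Proof.
have [r0 r1] := andP (good01 good).
have rr : 0 < r <= r by rewrite r0 lexx.
(* the strict inequalities cut out an open set inside the polydisc, so it is
     enough to bound the coordinates of [z] itself *)
suff [i [M [s [sr [zs [h1 hl]]]]]] : exists i M s, s < r /\ (cmod (proj z) < s /\
    (basic i 1 r setT z /\ forall l, basic i (Xv i l) r [set a | a < M] z)).
  exists i, s, M; split=> //.
  have n1 : nbhs (z : H) [set z' | cmod (proj z') < s].
    have := tends_cmod_lt (proj_tends sepX good (nbhs_filter z) (fun _ => id)) zs; exact.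
  have n2 : nbhs (z : H) (basic i 1 r setT).
    apply: open_nbhs_nbhs; split=> //.
    exact: (basic_open good rr (good_one good i) (@openT R)).
  have n3 : nbhs (z : H) [set z' | forall l, basic i (Xv i l) r [set a | a < M] z'].
    apply: (@filter_forall _ _ (fun l => basic i (Xv i l) r [set a | a < M]) (nbhs (z : H))) => l.
    apply: open_nbhs_nbhs; split=> //.
    exact: (basic_open good rr (good_coord good l) (@open_lt R M)).
  apply: filterS3 n1 n2 n3 => z' m1 m2 m3; split=> //; first exact: ltW.
  move=> l; case: z' {m1 m2} m3 => [c|b] /(_ l).
    move=> [k [t [x [h [y [e1 e2 e3 e4]]]]]]; exists k, t, x, h, y; split=> //; exact: ltW.
  by move=> [v [hv [e1 e2]]]; exists v, hv; split=> //; exact: ltW.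
case: z => [c|b].
  have [i [t [x [h ->]]]] := degeneration_ex c.
  have [tr _] := h; have [t0 tr'] := andP tr.
  have [M hM] := finite_bound (fun l => cmod (x 0 l) `^ hybrid_exponent t).
  exists i, M, ((cmod t + r) / 2); split; first lra.
  rewrite (hybrid_proj_inl good h); split; first lra.
  split; first by apply/(basic_inl good); exists t, x, h.
  move=> l; apply/(basic_inl good); exists t, x, h; split=> //.
  by rewrite /mkset poly_at_coord.
have [P hP] := berk_point_ex b; have [i iP] := chart_at A (gx P).
have [M hM] := finite_bound (fun l => gev P (coord (a := U i) l)).
exists i, M, (r / 2); split; first lra.
split; first by rewrite [proj _]/(0 : C) cmod0 divr_gt0.
split.
  exact: (proj2 (@hybrid_basic_inr R X A r b P (U i) (fun j => trans j i) 1 r setT sepX hP) (conj iP I)).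
move=> l; apply: (proj2 (@hybrid_basic_inr R X A r b P (U i) (fun j => trans j i) _ r _ sepX hP)).
by split=> //; rewrite pevalX; exact: hM.
Qed.

Theorem hybrid_locally_compact : locally_compact [set: H].
Proof.
move=> z _; have [i [s [M [sr hz]]]] := polydisc_nbhs z.
exists (polydisc i s M); first by apply: filterS hz.
split; first exact: polydisc_compact.
apply: compact_closed; [exact: hybrid_hausdorff|exact: polydisc_compact].
Qed.

End LocalCompactness.

(** * Properness for projective varieties *)

Section ProjectiveCharts.
Variables (k : fieldType) (X : ringed_space k).

(** The standard charts of a projective space, pulled back to [X]: [hc_coord i j]
    is the quotient [T_j / T_i] of homogeneous coordinates. *)
Record homogeneous_cover (n : nat) := HomogeneousCover {
  hc_dom : 'I_n.+1 -> set X;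
  hc_coord : forall i, 'I_n.+1 -> sect (hc_dom i);
  hc_affine : forall i, is_affine (hc_dom i);
  hc_cover : \bigcup_i hc_dom i = setT;
  hc_one : forall i, hc_coord i i = 1;
  hc_principal : forall i j, principal_open (hc_coord i j) `<=` hc_dom j;
  hc_trans : forall i j l,
    restr (@subIsetl _ (hc_dom i) (hc_dom j)) (hc_coord i l) =
    restr (@subIsetl _ (hc_dom i) (hc_dom j)) (hc_coord i j) *
    restr (@subIsetr _ (hc_dom i) (hc_dom j)) (hc_coord j l);
  hc_generates : forall i, generates (fun l : 'I_n => hc_coord i (lift i l))
}.

(** Along a closed immersion the preimage of an affine open is affine, and its
    sections are pulled back from projective space. *)
Lemma projective_cover : projective X -> exists n, inhabited (homogeneous_cover n).
Proof.
move=> [n [P [phi [[_ [D [u [[aD cD] u1 uD ut ug]]]] imm]]]]; exists n; constructor.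
pose oD i := affine_open (aD i).
pose w i l : sect (phi @^-1` D i) := pull phi (oD i) (u i l).
apply: (@HomogeneousCover n (fun i => phi @^-1` D i) w).
- by move=> i; have [] := imm _ (oD i) (aD i).
- apply/seteqP; split=> // x _; have : (\bigcup_i D i) (phi x) by rewrite cD.
  by move=> [i _ Di]; exists i.
- by move=> i; rewrite /w u1 rmorph1.
- move=> i j x hx; have Dx : D i (phi x) := principal_open_sub hx.
  have := pull_local Dx hx; rewrite -[invertible_at _ _]/(principal_open (u i j) (phi x)).
  by rewrite -uD => -[].
- move=> i j l; have oDD : open (D i `&` D j) by exact: openI.
  rewrite -!(pull_restr _ oDD) -rmorphM; congr (pull _ _ _); exact: ut.
- move=> i g; have [_ /(_ g)[f <-]] := imm _ (oD i) (aD i).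
  have [p [<- _]] := ug i f; exists p; rewrite peval_rmorph; apply: eq_peval => [a|//] /=.
  by rewrite pull_scal.
Qed.

End ProjectiveCharts.

Section NetInProjective.
Variables (R : realType) (X : ringed_space (laurent R)).
Variables (S : Type) (F : set_system S) (FU : UltraFilter F) (N : net X F).
Local Existing Instance FU.

(** Dividing by the largest homogeneous coordinate bounds the others by 1. *)
Lemma net_homogeneous n (V : homogeneous_cover X n) : exists j, nt_dom N (hc_dom V j) /\
  forall l, F [set s | nt_val N (hc_coord V j l) s <= 1].
Proof.
have [i dVi] := nt_cover N (hc_cover V).
have oV j := affine_open (hc_affine V j).
pose a l s := nt_val N (hc_coord V i l) s.
have [j hj] : exists j, F [set s | forall l, a l s <= a j s].
  apply: (ultra_finite FU); apply: filterE => s.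
  exists [arg max_(j > i) a j s]%O => // l.
  by case: arg_maxP => // m _; apply.
exists j.
have h1 : F [set s | a i s = 1].
  by rewrite /a hc_one; exact: nt_one.
have aj : F [set s | 1 <= a j s].
  by apply: filterS2 hj h1 => s /= /(_ i) + e; rewrite e.
have dVj : nt_dom N (hc_dom V j).
  apply: (nt_up (@hc_principal _ _ _ V i j)); apply: nt_principal => //.
  by apply: filterS aj => s /= h; apply: lt0r_neq0; rewrite (lt_le_trans ltr01).
split=> // l; have dV := nt_setI dVi dVj.
have oVV := openI (oV i) (oV j).
have e1 := nt_restr (@subIsetl _ (hc_dom V i) (hc_dom V j)) (hc_coord V i l) (oV i) oVV dV.
have e2 := nt_restr (@subIsetl _ (hc_dom V i) (hc_dom V j)) (hc_coord V i j) (oV i) oVV dV.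
have e3 := nt_restr (@subIsetr _ (hc_dom V i) (hc_dom V j)) (hc_coord V j l) (oV j) oVV dV.
have e4 := nt_mul (restr (@subIsetl _ (hc_dom V i) (hc_dom V j)) (hc_coord V i j))
  (restr (@subIsetr _ (hc_dom V i) (hc_dom V j)) (hc_coord V j l)) oVV dV.
rewrite -hc_trans in e4.
apply: filterS2 (filterI e1 (filterI e2 e3)) (filterI e4 (filterI aj hj)).
move=> s [E1 [E2 E3]] [E4 [E5 E6]]; move: E1 E2 E3 E4; rewrite /mkset => E1 E2 E3.
rewrite E1 E2 E3 => E4; have a0 : 0 < a j s by apply: lt_le_trans E5.
by have := E6 l; rewrite /a E4 -[leRHS]mulr1 ler_pM2l.
Qed.

End NetInProjective.

Section ProjectiveRadius.
Variables (R : realType) (X : ringed_space (laurent R)).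
Local Notation C := R[i].
Local Notation K := (laurent R).
Hypothesis sepX : Defs.separated X.
Variables (A : atlas X) (n : nat) (V : homogeneous_cover X n).
Local Notation U i := (chart (a := A) i).

Definition hc_chart j : affine_chart X := AffineChart (hc_affine V j) (hc_generates (h := V) (i := j)).

Let J := {b : 'I_(natlas A) & rat_data R n (dim (U b))}.
Implicit Type v : J.

(** Every point over the punctured disc has coordinates at most 1 in one of the
    homogeneous charts, hence in a compact set. Here [Hs] is part of the
    equations of these charts, [Gs] of those of their overlaps with the atlas, and
    the formulas [Js] bring limits of such coordinates back to the atlas. All
    three are finite lists, so that one radius serves them. *)
Record projective_radius (r : R) : Prop := ProjectiveRadius {
  pr_data : exists (Hs : 'I_n.+1 -> seq (mpoly n K))
      (Gs : 'I_n.+1 -> forall a, seq (mpoly (dim (U a) + n) K)) (Js : 'I_n.+1 -> seq J),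
    [/\ (forall j g, g \in Hs j -> poly_good r g) /\
        (forall j v, v \in Js j -> rat_good r (tagged v)),
        forall a t x, 0 < cmod t < r -> zeros_at t (trans (a := A) a a) (row_mx x x) ->
          exists j (y : 'rV[C]_n), [/\ zeros_at t (Gs j a) (row_mx x y),
            zeros_at t (Hs j) y & forall l, cmod (y 0 l) <= 1],
        forall j t y, 0 < cmod t < r -> zeros_at t (Hs j) y ->
          exists2 v, v \in Js j & rat_den (tagged v) t y != 0,
        forall j v t y, v \in Js j -> 0 < cmod t < r -> zeros_at t (Hs j) y ->
          rat_den (tagged v) t y != 0 ->
          zeros_at t (trans (tag v) (tag v)) (row_mx (rat_val (tagged v) t y) (rat_val (tagged v) t y)) &
        forall j v a t x y, v \in Js j -> 0 < cmod t < r -> zeros_at t (Gs j a) (row_mx x y) ->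
          rat_den (tagged v) t y != 0 ->
          zeros_at t (trans (a := A) a (tag v)) (row_mx x (rat_val (tagged v) t y))]
}.

Let ker j : pred (mpoly n K) := fun p =>
  `[< peval (scal (dom (hc_chart j))) (@coord _ _ (hc_chart j)) p = 0 >].
Let oker a j : pred (mpoly (dim (U a) + n) K) := fun p =>
  `[< peval (scal (dom (U a) `&` dom (hc_chart j))) (@overlap_coord _ _ (U a) (hc_chart j)) p = 0 >].
Let valid j v := @rat_valid R X (hc_chart j) (U (tag v)) (tagged v).

Let zeros1 (s : C * 'rV[C]_n) j p := p \in ker j -> poly_at s.1 p s.2 = 0.

Let gpoint1 j (E : set_system (C * 'rV[C]_n)) (EU : UltraFilter E) (E0 : to0 E fst) :
  (forall p, E [set s | zeros1 s j p]) ->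
  exists2 P : gpoint X (germ (Place EU E0)), ring_gpoint P & at_chart P (c := hc_chart j) snd.
Proof.
move=> EP; apply: chart_gpoint => p p0; apply: filterS (EP p) => s /= h.
by apply: h; exact/asboolP.
Qed.

Lemma projective_cover_finite j : exists (H1 : seq (mpoly n K)) (J0 : seq J),
  near0 (fun t => forall y : 'rV[C]_n, (forall p, p \in H1 -> zeros1 (t, y) j p) ->
    exists2 v, v \in J0 & valid j v /\ rat_den (tagged v) t y != 0).
Proof.
have [|H1 [J0 h]] := @saturation R (C * 'rV[C]_n)%type fst (mpoly n K) J
  (fun p => [set s | zeros1 s j p])
  (fun v => [set s | valid j v /\ rat_den (tagged v) s.1 s.2 != 0]).
  move=> E EU E0 EP; have [P hP hy] := @gpoint1 j E EU E0 EP.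
  have [jP _] := hy; have [b bP] := chart_at A (gx P).
  have [u hu ux] := @rat_valid_ex R X (hc_chart j) (U b) _ jP bP.
  exists (Tagged (fun b => rat_data R n (dim (U b))) u).
  by apply: filterS (proj1 (rat_locusP u hP hy) ux) => s; split.
by exists H1, J0; apply: near0S h => t ht y hy; apply: (ht (t, y)).
Qed.

Lemma projective_fiber_finite j v : exists H2 : seq (mpoly n K),
  near0 (fun t => forall y : 'rV[C]_n, (forall p, p \in H2 -> zeros1 (t, y) j p) ->
    valid j v -> rat_den (tagged v) t y != 0 ->
    zeros_at t (trans (tag v) (tag v)) (row_mx (rat_val (tagged v) t y) (rat_val (tagged v) t y))).
Proof.
have [|H2 h] := @saturation1 R (C * 'rV[C]_n)%type fst (mpoly n K) (fun p => [set s | zeros1 s j p])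
  [set s | valid j v -> rat_den (tagged v) s.1 s.2 != 0 ->
    zeros_at s.1 (trans (tag v) (tag v))
      (row_mx (rat_val (tagged v) s.1 s.2) (rat_val (tagged v) s.1 s.2))].
  move=> E EU E0 EP; have [P hP hy] := @gpoint1 j E EU E0 EP.
  have [hv|hv] := pselect (valid j v); last by apply: filterE => s /hv.
  have [hd|hd] := in_ultra_setVsetC [set s | rat_den (tagged v) s.1 s.2 != 0] EU; last first.
    by apply: filterS hd => s /= h _ h'; exfalso; exact: h.
  have vx := proj2 (@rat_locusP R X (hc_chart j) (U (tag v)) _ _ P snd (tagged v) hP hy) hd.
  have hx := rat_valid_chart hP hy hv vx.
  by apply: filterS (gpoint_trans sepX hP hx hx) => s hs _ _; exact: hs.
by exists H2; apply: near0S h => t ht y hy; apply: (ht (t, y)).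
Qed.

Lemma projective_match_finite (j : 'I_n.+1) v a : exists G : seq (mpoly (dim (U a) + n) K),
  near0 (fun t => forall x (y : 'rV[C]_n),
    (forall p, p \in G -> p \in @oker a j -> poly_at t p (row_mx x y) = 0) ->
    valid j v -> rat_den (tagged v) t y != 0 ->
    zeros_at t (trans (a := A) a (tag v)) (row_mx x (rat_val (tagged v) t y))).
Proof.
pose S := (C * 'rV[C]_(dim (U a)) * 'rV[C]_n)%type.
have [|G h] := @saturation1 R S (fun s => s.1.1) (mpoly (dim (U a) + n) K)
  (fun p => [set s | p \in @oker a j -> poly_at s.1.1 p (row_mx s.1.2 s.2) = 0])
  [set s | valid j v -> rat_den (tagged v) s.1.1 s.2 != 0 ->
    zeros_at s.1.1 (trans a (tag v)) (row_mx s.1.2 (rat_val (tagged v) s.1.1 s.2))].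
  move=> E EU E0 EP; pose pE := Place EU E0.
  have hz : @overlap_zero R X S pE (U a) (hc_chart j) (fun s => s.1.2) snd.
    by move=> p p0; apply: filterS (EP p) => s /= h; apply: h; exact/asboolP.
  have [P [hP hx hy]] := overlap_gpoint sepX hz.
  have [hv|hv] := pselect (valid j v); last by apply: filterE => s /hv.
  have [hd|hd] := in_ultra_setVsetC [set s : S | rat_den (tagged v) s.1.1 s.2 != 0] EU; last first.
    by apply: filterS hd => s /= h _ h'; exfalso; exact: h.
  have vx := proj2 (@rat_locusP R X (hc_chart j) (U (tag v)) _ _ P snd (tagged v) hP hy) hd.
  have hx' := rat_valid_chart hP hy hv vx.
  by apply: filterS (gpoint_trans sepX hP hx hx') => s hs _ _; exact: hs.
by exists G; apply: near0S h => t ht x y hy; apply: (ht (t, x, y)).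
Qed.

(** Points of the degeneration with no bounded coordinates would form a point over a
    field of germs, and [net_homogeneous] gives a chart where its coordinates are
    bounded by 1. *)
Lemma bounded_chart_near (Hs : 'I_n.+1 -> seq (mpoly n K))
    (Gs : 'I_n.+1 -> forall a, seq (mpoly (dim (U a) + n) K)) a :
  (forall j p, p \in Hs j -> p \in ker j) -> (forall j p, p \in Gs j a -> p \in @oker a j) ->
  near0 (fun t => forall x, zeros_at t (trans (a := A) a a) (row_mx x x) ->
    exists j (y : 'rV[C]_n), [/\ zeros_at t (Gs j a) (row_mx x y),
      zeros_at t (Hs j) y & forall l, cmod (y 0 l) <= 1]).
Proof.
move=> hH hG; pose S := (C * 'rV[C]_(dim (U a)))%type.
have h := @saturation0 R S fst
  [set s | zeros_at s.1 (trans a a) (row_mx s.2 s.2)]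
  [set s | exists j (y : 'rV[C]_n), [/\ zeros_at s.1 (Gs j a) (row_mx s.2 y),
      zeros_at s.1 (Hs j) y & forall l, cmod (y 0 l) <= 1]].
apply: near0S (h _) => [t ht x hx|]; first exact: (ht (t, x)).
move=> E EU E0 EP; pose pE := Place EU E0.
have [P [hP hx _]] := @trans_gpoint _ _ sepX A _ pE a a snd snd EP.
have [j [jP hj]] := net_homogeneous EU (germ_net hP) V.
have [y hy] := @at_chart_ex _ _ _ pE P (hc_chart j) jP.
have hE : E [set s : S | 0 < hybrid_exponent s.1 < 1].
  by apply: (hybrid_exponent_small E0); exact: ltr01.
have y1 : E [set s | forall l, cmod (y s 0 l) <= 1].
  apply: (@filter_forall _ _ (fun l s => cmod (y s 0 l) <= 1)) => l.
  have [_ /(_ l) e] := hy.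
  have h1 : E [set s | germ_abs (germ_of pE (fun s => y s 0 l)) s <= 1].
    by rewrite -e; exact: (hj (lift j l)).
  have h2 : E [set s | cmod (y s 0 l) `^ hybrid_exponent s.1 <= 1].
    by apply: filterS2 h1 (germ_abs_of pE (fun s => y s 0 l)) => s h0 es; move: h0; rewrite /mkset es.
  apply: filterS2 h2 hE => s h3 /andP[e0 _]; rewrite /mkset leNgt; apply/negP => y1.
  move: h3; rewrite /mkset leNgt => /negP; apply.
  rewrite -[ltLHS](congr1 (fun f => f (hybrid_exponent s.1)) (@powR1 R)); apply: (gt0_ltr_powR e0) => //.
    by rewrite nnegrE.
  by rewrite nnegrE cmod_ge0.
have zG : E [set s | forall g, g \in Gs j a -> poly_at s.1 g (row_mx s.2 (y s)) = 0].
  apply: filter_seq => g gG.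
  by apply: (at_chart_overlap sepX hP hx hy); exact/asboolP/hG.
have zH : E [set s | forall g, g \in Hs j -> poly_at s.1 g (y s) = 0].
  apply: filter_seq => g gH.
  by apply: (at_chart_kernel hP hy); exact/asboolP/hH.
by apply: filterS3 y1 zG zH => s h1 h2 h3; exists j, (y s).
Qed.

Lemma projective_radius_near : near0R projective_radius.
Proof.
have [H1 hH1] := choice (projective_cover_finite).
have [J0 hJ0] := choice hH1.
have [H2 hH2] := choice (fun jv : 'I_n.+1 * J => projective_fiber_finite jv.1 jv.2).
pose Js j := [seq v <- J0 j | `[< valid j v >]].
have [G hG] : exists G : 'I_n.+1 -> J -> forall a, seq (mpoly (dim (U a) + n) K),
    forall j v a, near0 (fun t => forall x (y : 'rV[C]_n),
    (forall p, p \in G j v a -> p \in @oker a j -> poly_at t p (row_mx x y) = 0) ->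
    valid j v -> rat_den (tagged v) t y != 0 ->
    zeros_at t (trans (a := A) a (tag v)) (row_mx x (rat_val (tagged v) t y))).
  exists (fun j v a => sval (cid (projective_match_finite j v a))) => j v a.
  exact: svalP (cid (projective_match_finite j v a)).
pose Hs j := [seq p <- H1 j ++ flatten [seq H2 (j, v) | v <- Js j] | p \in ker j].
pose Gs j a := [seq p <- flatten [seq G j v a | v <- Js j] | p \in @oker a j].
have kH j p : p \in Hs j -> p \in ker j by rewrite mem_filter => /andP[].
have kG j a p : p \in Gs j a -> p \in @oker a j by rewrite mem_filter => /andP[].
have zH1 j t y : zeros_at t (Hs j) y -> forall p, p \in H1 j -> zeros1 (t, y) j p.
  by move=> h p pH pk; apply: h; rewrite mem_filter pk mem_cat pH.
have zH2 j t y v : v \in Js j -> zeros_at t (Hs j) y ->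
    forall p, p \in H2 (j, v) -> zeros1 (t, y) j p.
  move=> vJ h p pH pk; apply: h; rewrite mem_filter pk mem_cat; apply/orP; right.
  by apply/flattenP; exists (H2 (j, v)) => //; apply/mapP; exists v.
have zG j a t x y v : v \in Js j -> zeros_at t (Gs j a) (row_mx x y) ->
    forall p, p \in G j v a -> p \in @oker a j -> poly_at t p (row_mx x y) = 0.
  move=> vJ h p pG pk; apply: h; rewrite mem_filter pk.
  by apply/flattenP; exists (G j v a) => //; apply/mapP; exists v.
have n1 : near0R (fun r => forall j g, g \in Hs j -> poly_good r g).
  by apply: near0R_fin => j; apply: near0R_all => g _; exact: poly_good_near.
have n2 : near0R (fun r => forall j v, v \in Js j -> rat_good r (tagged v)).
  by apply: near0R_fin => j; apply: near0R_all => v _; exact: rat_good_near.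
have n3 : near0R (fun r => forall a t, 0 < cmod t < r -> forall x,
    zeros_at t (trans (a := A) a a) (row_mx x x) ->
    exists j (y : 'rV[C]_n), [/\ zeros_at t (Gs j a) (row_mx x y),
            zeros_at t (Hs j) y & forall l, cmod (y 0 l) <= 1]).
  by apply: near0R_fin => a; apply: near0R_of; apply: bounded_chart_near => [|j]; [exact: kH|exact: kG].
have n4 := near0R_fin (fun j => near0R_of (hJ0 j)).
have n5 : near0R (fun r => forall j v, v \in Js j -> forall t, 0 < cmod t < r ->
    forall y : 'rV[C]_n, (forall p, p \in H2 (j, v) -> zeros1 (t, y) j p) ->
    valid j v -> rat_den (tagged v) t y != 0 ->
    zeros_at t (trans (tag v) (tag v)) (row_mx (rat_val (tagged v) t y) (rat_val (tagged v) t y))).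
  apply: near0R_fin => j; apply: near0R_all => v _; apply: near0R_of; exact: (hH2 (j, v)).
have n6 : near0R (fun r => forall j v, v \in Js j -> forall a t, 0 < cmod t < r ->
    forall x (y : 'rV[C]_n),
    (forall p, p \in G j v a -> p \in @oker a j -> poly_at t p (row_mx x y) = 0) ->
    valid j v -> rat_den (tagged v) t y != 0 ->
    zeros_at t (trans (a := A) a (tag v)) (row_mx x (rat_val (tagged v) t y))).
  apply: near0R_fin => j; apply: near0R_all => v _; apply: near0R_fin => a.
  exact: near0R_of (hG j v a).
apply: near0RS (near0RI n1 (near0RI n2 (near0RI n3 (near0RI n4 (near0RI n5 n6))))).
move=> r [m1 [m2 [m3 [m4 [m5 m6]]]]]; constructor; exists Hs, Gs, Js.
have vJ j v : v \in Js j -> valid j v by rewrite mem_filter => /andP[/asboolP].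
split=> //.
- by move=> a t x tr; exact: m3.
- move=> j t y tr hy; have [v vJ0 [hv hd]] := m4 j t tr y (zH1 _ _ _ hy).
  by exists v => //; rewrite mem_filter vJ0 andbT; exact/asboolP.
- by move=> j v t y vj tr hy; apply: (m5 j v vj t tr y (zH2 _ _ _ _ vj hy)); exact: vJ.
- by move=> j v a t x y vj tr hz; apply: (m6 j v vj a t tr x y (zG _ _ _ _ _ _ vj hz)); exact: vJ.
Qed.

End ProjectiveRadius.

Section Proper.
Variables (R : realType) (X : ringed_space (laurent R)).
Local Notation C := R[i].
Local Notation K := (laurent R).
Hypothesis sepX : Defs.separated X.
Variables (A : atlas X) (n : nat) (V : homogeneous_cover X n) (r : R).
Hypotheses (good : good_radius A r) (goodV : projective_radius A n r).
Local Notation H := (hybrid A r).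
Local Notation U i := (chart (a := A) i).
Local Notation fiber i t x := (chart_fiber (A := A) r (i := i) t x).
Local Notation proj := (@hybrid_proj R X A r).

(** Along the ultrafilter one homogeneous chart is used, with coordinates bounded by
    1. Their limit satisfies the equations of that chart, and a formula with a
    nonvanishing denominator carries it to the atlas. *)
Lemma projective_cvg_inl (F : set_system H) (FU : UltraFilter F) t0 : 0 < cmod t0 < r ->
  tends F proj t0 -> exists2 z : H, proj z = t0 & F --> z.
Proof.
move=> tr ht; have [Hs [Gs [Js [[gH gJ] q1 q2 q3 q4]]]] := pr_data goodV.
have t00 : t0 != 0 by rewrite -cmod_gt0; case/andP: tr.
have Fi : F (range inl) by exact: (tends_neq0_inl _ t00 ht).
have [a [x hx]] := ultra_coord good FU Fi.
pose Py j z : set 'rV[C]_n := [set y | [/\ zeros_at (proj z) (Gs j a) (row_mx (x z) y),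
  zeros_at (proj z) (Hs j) y & forall l, cmod (y 0 l) <= 1]].
have [j hj] : exists j, F [set z | exists y, Py j z y].
  apply: (ultra_finite FU); apply: filterS hx => z hz.
  have [tz zz] := has_coord_fiber hz.
  by have [j [y hy]] := q1 a _ _ tz zz; exists j => //; exists y.
pose y z := xget 0 (Py j z).
have hy : F [set z | Py j z (y z)] by apply: filterS hj => z hz; exact: (xgetPex 0 hz).
have [y0 hy0] : exists y0 : 'rV[C]_n, forall l, tends F (fun z => y z 0 l) (y0 0 l).
  by apply: (row_limit FU (M := 1)); apply: filterS hy => z [].
have zH : zeros_at t0 (Hs j) y0.
  move=> g gj; have [_ hg] := gH j g gj.
  have h1 : tends F (fun z => poly_at (proj z) g (y z)) (poly_at t0 g y0) by exact: hg.
  apply: (tends_uniq h1); apply: tends_near (tends_cst 0).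
  by apply: filterS hy => z [_ /(_ _ gj)].
have [v vJ hd] := q2 j t0 y0 tr zH.
have gu := gJ j v vJ.
have hd' : F [set z | rat_den (tagged v) (proj z) (y z) != 0].
  exact: (rat_den_neq0 _ gu tr ht hy0 hd).
have h0 : fiber (tag v) t0 (rat_val (tagged v) t0 y0).
  by split=> //; exact: (q3 j v t0 y0 vJ tr zH hd).
exists (inl (degeneration_pt h0)); first exact: hybrid_proj_inl.
apply: (inl_cvg (t := proj) (x := fun z => rat_val (tagged v) (proj z) (y z))) (ht) _.
  apply: filterS3 hx hy hd' => z hz [z1 z2 _] hdz.
  have fz := has_coord_fiber hz; have [tz _] := fz.
  have z3 := q4 j v a _ _ _ vJ tz z1 hdz.
  exists (fiber_overlap good fz z3); have [h e] := hz.
  by rewrite {1}e; congr inl; apply/(degeneration_eq good).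
exact: (rat_val_tends _ gu tr ht hy0 hd).
Qed.

(** In the chart of the largest homogeneous coordinate the bounds required by
    [net_limit] hold. *)
Lemma projective_cvg_inr (F : set_system H) (FU : UltraFilter F) :
  tends F proj 0 -> exists2 z : H, proj z = 0 & F --> z.
Proof.
move=> F0; have [N [hA _]] := hybrid_net_ex sepX good FU F0.
have [j [dV hj]] := net_homogeneous FU N V.
have aV := hc_affine V j.
have [|P [hP VP eP]] := net_limit FU aV dV (hc_generates (h := V) (i := j)).
  by move=> l; exists 1; exact: hj.
have [b hb] : exists b, berk_point b P.
  by apply: berk_of_point => //; exists (hc_dom V j).
by exists (inr b) => //; exact: (hA b P hb (net_conv FU aV dV VP eP)).
Qed.

Theorem hybrid_is_proper : hybrid_proper A r.
Proof.
split; first exact: hybrid_proj_continuous.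
move=> L; rewrite !compact_ultra => cL Lr F FU FL.
have [t0 [Lt0 ht0]] := cL _ (ultra_fmap proj FU) FL.
have ht : tends F proj t0.
  by move=> e e0; apply: (ht0 [set t | cmod (t - t0) < e]); apply/nbhsC; exists e.
have [z pz Fz] : exists2 z : H, proj z = t0 & F --> z.
  have [t00|t00] := eqVneq t0 0; last first.
    by apply: projective_cvg_inl => //; rewrite cmod_gt0 t00; exact: Lr.
  by move: ht; rewrite t00; exact: projective_cvg_inr.
by exists z; split=> //; rewrite /preimage /mkset pz.
Qed.

End Proper.

Theorem proposition3p4 (R : realType) (X : ringed_space (laurent R))
    (hX : algebraic_variety X) (A : atlas X) :
  \forall r \near (0 : R)^'+,
    [/\ hausdorff_space (hybrid A r),
        locally_compact [set: hybrid A r] &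
        projective X -> hybrid_proper A r].
Proof.
have [_ _ sepX _] := hX.
have small (P : R -> Prop) : near0R P -> \forall r \near (0 : R)^'+, P r.
  move=> [d d0 hP]; near=> r; apply: hP; apply/andP; split.
    by near: r; exact: nbhs_right_gt.
  by near: r; exact: nbhs_right_lt.
have goodX := good_radius_near sepX A.
have [projX|nprojX] := pselect (projective X).
  have [n [V]] := projective_cover projX.
  apply: small; apply: near0RS (near0RI goodX (projective_radius_near sepX A V)).
  move=> r [good goodV]; split; first exact: hybrid_hausdorff.
    exact: hybrid_locally_compact.
  by move=> _; exact: (hybrid_is_proper sepX V good goodV).
apply: small; apply: near0RS goodX => r good; split=> //; first exact: hybrid_hausdorff.
exact: hybrid_locally_compact.
Unshelve. all: by end_near. Qed.
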